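(* Let $C(D)^H$ be a Hopf Galois coextension. The maps $\psi: C^n(H,C^D)\to C^n(C(D),C)$, $n\ge 0$, given by $$h_1\otimes\cdots\otimes h_n\otimes c\longmapsto c^{(1)}\otimes c^{(2)}\triangleleft h_1^{(1)}\otimes c^{(3)}\triangleleft h_1^{(2)}h_2^{(1)}\otimes\cdots\otimes c^{(n)}\triangleleft h_1^{(n-1)}\cdots h_{n-1}^{(1)}\otimes c^{(n+1)}\triangleleft h_1^{(n)}\cdots h_{n-1}^{(2)}h_n$$ induce an isomorphism between the cocyclic modules $C^n(H,C^D)$ and $C^n(C(D),C)$, and consequently $$HC^n(H,C^D)\cong HC^n(C(D),C).$$
   Context: The ground field is $k=\mathbb{C}$; $\otimes=\otimes_k$. Sweedler notation (summation suppressed): $\Delta(c)=c^{(1)}\otimes c^{(2)}$; $\varepsilon$ denotes counits and $S$ the antipode of a Hopf algebra. Hopf Galois coextension. Let $H$ be a Hopf algebra and $C$ a right $H$-module coalgebra with action $\triangleleft: C\otimes H\to C$. The span $I$ of the elements $c\triangleleft h-\varepsilon(h)c$ is a two-sided coideal; put $D=C/I$, a coalgebra, with natural surjection $\pi:C\to D$. $C$ is a $D$-bicomodule by $c\mapsto \pi(c^{(1)})\otimes c^{(2)}$ and $c\mapsto c^{(1)}\otimes\pi(c^{(2)})$, and $C\,\square_D\,C$ is the corresponding cotensor product (a subspace of $C\otimes C$); its elements are written $c\,\square_D\,c'$ (or $c\otimes c'$), summation suppressed. $\pi:C\to D$ is a (right) Hopf Galois coextension, denoted $C(D)^H$, if $\beta: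 C\otimes H\to C\,\square_D\,C$, $c\otimes h\mapsto c^{(1)}\otimes c^{(2)}\triangleleft h$, is bijective. Set $D^*=\mathrm{Hom}_k(D,k)$ and $C^D=\{c\in C:\ c^{(1)}\varphi(\pi(c^{(2)}))=c^{(2)}\varphi(\pi(c^{(1)}))\ \forall\varphi\in D^*\}$. Set $C_D=C/W$, $W$ the span of all $c^{(1)}\varphi(\pi(c^{(2)}))-c^{(2)}\varphi(\pi(c^{(1)}))$, $c\in C,\varphi\in D^*$. Set $(C\,\square_D\,C)_D=(C\,\square_D\,C)/W'$, $W'$ the span of all $c\otimes c'^{(1)}\varphi(\pi(c'^{(2)}))-c^{(2)}\otimes c'\varphi(\pi(c^{(1)}))$ with $c\otimes c'\in C\,\square_D\,C$, $\varphi\in D^*$. Classes are denoted by an overline. $\beta$ induces a bijection $\bar\beta:C_D\otimes H\to (C\,\square_D\,C)_D$, $\bar c\otimes h\mapsto\overline{\beta(c\otimes h)}$, and $\kappa=(\varepsilon\otimes \mathrm{Id}_H)\circ\bar\beta^{-1}:(C\,\square_D\,C)_D\to H$. The space $C^D$ is a right $H$-module by restriction of $\triangleleft$, and a left $H$-comodule by $c\mapsto \kappa(\overline{c^{(3)}\,\square_D\,c^{(1)}})\otimes c^{(2)}$; with these it is a right-left stable anti Yetter-Drinfeld module, i.e. $(c\triangleleft h)_{<-1>}\otimes (c\triangleleft h)_{<0>}=S(h^{(3)})c_{<-1>}h^{(1)}\otimes c_{<0>}\triangleleft h^{(2)}$ and $c_{<0>}\triangleleft c_{<-1>}=c$, where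 $c_{<-1>}\otimes c_{<0>}$ denotes the coaction. A cocyclic module is a cosimplicial vector space $(C^n)_{n\ge0}$ (cofaces $\delta_i:C^n\to C^{n+1}$, $0\le i\le n+1$; codegeneracies $\sigma_i:C^n\to C^{n-1}$, $0\le i\le n-1$) with operators $\tau_n:C^n\to C^n$ such that $\tau\delta_i=\delta_{i-1}\tau$ ($i\geq 1$), $\tau\delta_0=\delta_{n+1}$ (the last coface), $\tau\sigma_i=\sigma_{i-1}\tau$ ($i\ge1$), $\tau\sigma_0=\sigma_{\rm last}\tau^2$, $\tau_n^{n+1}=\mathrm{Id}$. $HC^*$ denotes its cyclic cohomology. The cocyclic module $C^n(H,C^D)=H^{\otimes n}\otimes C^D$ (Hopf cyclic cohomology $HC^n(H,C^D)$ of $H$ with coefficients in $C^D$) has, for $h_1\otimes\cdots\otimes h_n\otimes c$: - $\delta_i(h_1\otimes\cdots\otimes h_n\otimes c)=h_1\otimes\cdots\otimes h_i\otimes 1_H\otimes h_{i+1}\otimes\cdots\otimes h_n\otimes c$, $0\le i\le n$; - $\delta_{n+1}(h_1\otimes\cdots\otimes h_n\otimes c)=h_1^{(1)}\otimes\cdots\otimes h_n^{(1)}\otimes S(h_1^{(2)}\cdots h_n^{(2)})\kappa(\overline{c^{(3)}\,\square_D\,c^{(1)}})\otimes c^{(2)}$; - $\sigma_i(h_1\otimes\cdots\otimes h_n\otimes c)=h_1\otimes\cdots\otimes h_{i+1}h_{i+2}\otimes\cdots\otimes h_n\otimes c$, $0\le i\le n-2$; - $\sigma_{n-1}(h_1\otimes\cdots\otimes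 h_n\otimes c)=h_1\otimes\cdots\otimes h_{n-1}\varepsilon(h_n)\otimes c$; - $\tau_n(h_1\otimes\cdots\otimes h_n\otimes c)=h_2^{(1)}\otimes\cdots\otimes h_n^{(1)}\otimes S(h_1^{(2)}\cdots h_n^{(2)})\kappa(\overline{c^{(3)}\,\square_D\,c^{(1)}})\otimes c^{(2)}\triangleleft h_1^{(1)}$ for $n\ge1$, and $\tau_0=\mathrm{Id}$. The relative cocyclic module of the coalgebra coextension $\pi:C\to D$ is the cyclic cotensor product $$C^n(C(D),C)=D\,\square_{D^e}\,(\underbrace{C\,\square_D\cdots\square_D\,C}_{n+1})\cong(\underbrace{C\,\square_D\cdots\square_D\,C}_{n+1})^D,$$ where $D^e=D\otimes D^{cop}$ and the right-hand side (used as the model) consists of those $c_0\otimes\cdots\otimes c_n$ (sums suppressed) in the $(n+1)$-fold cotensor product over $D$ with $\pi(c_0^{(1)})\otimes c_0^{(2)}\otimes c_1\otimes\cdots\otimes c_n=\pi(c_n^{(2)})\otimes c_0\otimes\cdots\otimes c_{n-1}\otimes c_n^{(1)}$ (for $n=0$ this is $C^D$). Its structure is: - $d_0(c_0\otimes\cdots\otimes c_n)=c_0^{(1)}\otimes c_0^{(2)}\otimes c_1\otimes\cdots\otimes c_n$; - $d_i(c_0\otimes\cdots\otimes c_n)=c_0\otimes\cdots\otimes\Delta(c_i)\otimes\cdots\otimes c_n$, $0<i<n+1$; - $d_{n+1}(c_0\otimes\cdots\otimes c_n)=c_0^{(2)}\otimes c_1\otimes\cdots\otimes c_n\otimes c_0^{(1)}$;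 - $s_i(c_0\otimes\cdots\otimes c_n)=c_0\otimes\cdots\otimes\varepsilon(c_{i+1})\otimes\cdots\otimes c_n$, $0\le i\le n-1$; - $t_n(c_0\otimes\cdots\otimes c_n)=c_1\otimes\cdots\otimes c_n\otimes c_0$. Its cyclic cohomology $HC^n(C(D),C)$ is the relative cyclic cohomology of the coextension. *)

(* Defs.v *)
From HB Require Import structures.
From mathcomp Require Import all_boot all_order all_algebra.
From mathcomp Require Import finmap.
From mathcomp Require Import boolp classical_sets.
From mathcomp.multinomials Require Import monalg.

Set Implicit Arguments.
Unset Strict Implicit.
Unset Printing Implicit Defensive.

Import GRing.Theory.
Local Open Scope ring_scope.
Local Open Scope quotient_scope.

Section Subspaces.
Variables (k : fieldType) (V : lmodType k).

Record subspace := Subspace {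
  smem :> V -> Prop;
  smem0 : smem 0;
  smemD : forall u v, smem u -> smem v -> smem (u + v);
  smemZ : forall a u, smem u -> smem (a *: u)
}.

Lemma smemN (U : subspace) u : U u -> U (- u).
Proof. by move=> Uu; rewrite -scaleN1r; apply: smemZ. Qed.

Lemma smem_sum (U : subspace) (I : Type) (s : seq I) (F : I -> V) :
  (forall i, U (F i)) -> U (\sum_(i <- s) F i).
Proof.
by move=> UF; elim/big_ind: _ => //; [exact: smem0 | exact: smemD].
Qed.

Section Span.
Variable P : V -> Prop.

Definition in_span (v : V) : Prop :=
  exists2 s : seq (k * V),
    (forall p, p \in s -> P p.2) & v = \sum_(p <- s) p.1 *: p.2.

Lemma in_span0 : in_span 0.
Proof. by exists [::] => //; rewrite big_nil. Qed.

Lemma in_spanD u v : in_span u -> in_span v -> in_span (u + v).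
Proof.
move=> [s sP ->] [t tP ->]; exists (s ++ t); last by rewrite big_cat.
by move=> p; rewrite mem_cat => /orP[/sP|/tP].
Qed.

Lemma in_spanZ a u : in_span u -> in_span (a *: u).
Proof.
move=> [s sP ->]; exists [seq (a * p.1, p.2) | p <- s].
  by move=> p /mapP[q /sP Pq ->].
by rewrite big_map scaler_sumr; apply: eq_bigr => p _; rewrite scalerA.
Qed.

Definition span : subspace := Subspace in_span0 in_spanD in_spanZ.

Lemma mem_span v : P v -> span v.
Proof.
move=> Pv; exists [:: (1, v)]; last by rewrite big_seq1 scale1r.
by move=> p; rewrite inE => /eqP ->.
Qed.

Lemma span_min (U : subspace) v : (forall u, P u -> U u) -> span v -> U v.
Proof.
move=> PU [s sP ->]; rewrite big_seq; elim/big_ind: _ => [||p /sP/PU].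
- exact: smem0.
- exact: smemD.
- exact: smemZ.
Qed.
End Span.

Definition smemb (U : subspace) : pred V := fun v => `[< U v >].

Record subvect (U : subspace) := SubVect {
  subvect_val : V;
  subvectP : smemb U subvect_val
}.

Section SubVectStructure.
Variable U : subspace.

Lemma smemb_submod : subsemimod_closed (smemb U).
Proof.
split; first split.
- exact/asboolP/smem0.
- by move=> u v /asboolP Uu /asboolP Uv; apply/asboolP/smemD.
- by move=> a u /asboolP Uu; apply/asboolP/smemZ.
Qed.

HB.instance Definition _ := GRing.isSubmodClosed.Build k V (smemb U) smemb_submod.
HB.instance Definition _ := [isSub of subvect U for @subvect_val U].
HB.instance Definition _ := [Choice of subvect U by <:].
HB.instance Definition _ := [SubChoice_isSubLmodule of subvect U by <:].
End SubVectStructure.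

Definition insubvect (U : subspace) v (Uv : U v) : subvect U :=
  SubVect (asboolT Uv).

Lemma subvect_mem (U : subspace) (u : subvect U) : U (\val u).
Proof. exact/asboolP/subvectP. Qed.

Section Quotient.
Variable U : subspace.

Definition qrel : rel V := fun u v => `[< U (u - v) >].

Lemma qrel_equiv : equiv_class_of qrel.
Proof.
split=> [u|u v|v u w].
- by apply/asboolP; rewrite subrr; exact: smem0.
- by apply/asboolP/asboolP => /smemN; rewrite opprB.
- by move=> /asboolP uv /asboolP vw; apply/asboolP; have := smemD uv vw;
    rewrite addrA subrK.
Qed.

Canonical qrel_equivRel := EquivRelPack qrel_equiv.

Definition quotvect := {eq_quot qrel}.
HB.instance Definition _ := Choice.on quotvect.
HB.instance Definition _ := EqQuotient.on quotvect.

Definition qclass (v : V) : quotvect := \pi_quotvect v.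

Lemma qclass_eq u v : qclass u = qclass v <-> U (u - v).
Proof.
split; last by move=> h; apply/eqmodP/asboolP.
by move/eqmodP/asboolP.
Qed.

Lemma qclassK x : qclass (repr x) = x.
Proof. exact: reprK. Qed.

Definition qadd (x y : quotvect) := qclass (repr x + repr y).
Definition qopp (x : quotvect) := qclass (- repr x).
Definition qscale a (x : quotvect) := qclass (a *: repr x).

Let reprU v : U (repr (qclass v) - v).
Proof. by apply/qclass_eq; rewrite qclassK. Qed.

Lemma qaddE u v : qadd (qclass u) (qclass v) = qclass (u + v).
Proof.
apply/qclass_eq; rewrite opprD addrACA; apply: smemD; exact: reprU.
Qed.
Lemma qoppE u : qopp (qclass u) = qclass (- u).
Proof. by apply/qclass_eq; rewrite -opprD; apply/smemN/reprU. Qed.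
Lemma qscaleE a u : qscale a (qclass u) = qclass (a *: u).
Proof. by apply/qclass_eq; rewrite -scalerBr; apply/smemZ/reprU. Qed.

Fact qaddA : associative qadd.
Proof.
by move=> x y z; rewrite -(qclassK x) -(qclassK y) -(qclassK z) !qaddE addrA.
Qed.
Fact qaddC : commutative qadd.
Proof. by move=> x y; rewrite -(qclassK x) -(qclassK y) !qaddE addrC. Qed.
Fact qadd0 : left_id (qclass 0) qadd.
Proof. by move=> x; rewrite -(qclassK x) !qaddE add0r. Qed.
Fact qaddN : left_inverse (qclass 0) qopp qadd.
Proof. by move=> x; rewrite -(qclassK x) qoppE qaddE addNr. Qed.

HB.instance Definition _ := GRing.isZmodule.Build quotvect qaddA qaddC qadd0 qaddN.

Fact qscaleA a b x : qscale a (qscale b x) = qscale (a * b) x.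
Proof. by rewrite -(qclassK x) !qscaleE scalerA. Qed.
Fact qscale1 : left_id 1 qscale.
Proof. by move=> x; rewrite -(qclassK x) qscaleE scale1r. Qed.
Fact qscaleDr : right_distributive qscale +%R.
Proof.
move=> a x y; rewrite -(qclassK x) -(qclassK y).
by rewrite [qclass _ + qclass _]qaddE !qscaleE scalerDr -qaddE.
Qed.
Fact qscaleDl x : {morph qscale^~ x : a b / a + b}.
Proof.
by move=> a b; rewrite -(qclassK x) !qscaleE scalerDl -qaddE.
Qed.

HB.instance Definition _ := GRing.Zmodule_isLmodule.Build k quotvect
  qscaleA qscale1 qscaleDr qscaleDl.

Fact qclass_linear : linear qclass.
Proof.
by move=> a u v; rewrite -qaddE -qscaleE.
Qed.
HB.instance Definition _ := GRing.isLinear.Build k V quotvect _ qclass qclass_linear.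

Section Lift.
Variables (X : lmodType k) (f : {linear V -> X}).

Definition qlift (x : quotvect) : X := f (repr x).

Lemma qlift_class : (forall u, U u -> f u = 0) -> forall u, qlift (qclass u) = f u.
Proof. by move=> f0 u; apply/eqP; rewrite -subr_eq0 -linearB f0. Qed.

Lemma qlift_linear : (forall u, U u -> f u = 0) -> linear qlift.
Proof.
move=> f0 a x y; rewrite -(qclassK x) -(qclassK y) -linearP !qlift_class //.
exact: linearP.
Qed.
End Lift.
End Quotient.
End Subspaces.

Section FreeModule.
Variables (k : fieldType) (G : choiceType) (X : lmodType k).

Definition freelift (f : G -> X) (x : {malg k[G]}) : X :=
  \sum_(g <- msupp x) x@_g *: f g.

Lemma freeliftw f x (d : {fset G}) : (msupp x `<=` d)%fset ->
  freelift f x = \sum_(g <- d) x@_g *: f g.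
Proof.
move=> le_xd; rewrite /freelift (big_fset_incl _ le_xd) //= => g _ /mcoeff_outdom ->.
by rewrite scale0r.
Qed.

Fact freelift_linear f : linear (freelift f).
Proof.
move=> a x y; pose d := (msupp (a *: x + y) `|` (msupp x `|` msupp y))%fset.
rewrite !(@freeliftw _ _ d) ?fsubsetUl //; last first.
- by apply: fsubset_trans (fsubsetUl _ _) (fsubsetUr _ _).
- by apply: fsubset_trans (fsubsetUr _ _) (fsubsetUr _ _).
rewrite scaler_sumr -big_split; apply: eq_bigr => g _ /=.
by rewrite mcoeffD mcoeffZ scalerDl scalerA.
Qed.
HB.instance Definition _ f := GRing.isLinear.Build k _ X _ (freelift f) (freelift_linear f).

Lemma freeliftU f g : freelift f << g >> = f g.
Proof.
by rewrite (freeliftw _ msuppU_le) big_seq_fset1 mcoeffUU scale1r.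
Qed.
End FreeModule.

Section Kernel.
Variables (k : fieldType) (V X : lmodType k) (f : {linear V -> X}).

Fact kernelD u v : f u = 0 -> f v = 0 -> f (u + v) = 0.
Proof. by move=> u0 v0; rewrite linearD u0 v0 addr0. Qed.
Fact kernelZ a u : f u = 0 -> f (a *: u) = 0.
Proof. by move=> u0; rewrite linearZ /= u0 scaler0. Qed.

Definition kernel : subspace V :=
  @Subspace k V (fun v => f v = 0) (linear0 f) kernelD kernelZ.
End Kernel.

Section Equalizer.
Variables (k : fieldType) (V X : lmodType k) (f g : {linear V -> X}).

Fact equalizer0 : f 0 = g 0. Proof. by rewrite !linear0. Qed.
Fact equalizerD u v : f u = g u -> f v = g v -> f (u + v) = g (u + v).
Proof. by rewrite !linearD => -> ->. Qed.
Fact equalizerZ a u : f u = g u -> f (a *: u) = g (a *: u).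
Proof. by rewrite !linearZ_LR => ->. Qed.

Definition equalizer : subspace V :=
  @Subspace k V (fun v => f v = g v) equalizer0 equalizerD equalizerZ.
End Equalizer.

Section Meet.
Variables (k : fieldType) (V : lmodType k) (I : Type) (U : I -> subspace V).

Fact meet0 i : U i 0. Proof. exact: smem0. Qed.
Fact meetD u v : (forall i, U i u) -> (forall i, U i v) -> forall i, U i (u + v).
Proof. by move=> Uu Uv i; apply: smemD. Qed.
Fact meetZ a u : (forall i, U i u) -> forall i, U i (a *: u).
Proof. by move=> Uu i; apply: smemZ. Qed.

Definition meet : subspace V :=
  @Subspace k V (fun v => forall i, U i v) meet0 meetD meetZ.
End Meet.

Section Bilinear.
Variables (k : fieldType) (V W X : lmodType k) (f : V -> W -> X).

Definition bilin : Prop :=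
  (forall w, linear (f^~ w)) /\ (forall v, linear (f v)).

Hypothesis fbi : bilin.
Lemma bilinDl u v w : f (u + v) w = f u w + f v w.
Proof. by have := fbi.1 w 1 u v; rewrite !scale1r. Qed.
Lemma bilinDr v w x : f v (w + x) = f v w + f v x.
Proof. by have := fbi.2 v 1 w x; rewrite !scale1r. Qed.
Lemma bilin0l w : f 0 w = 0.
Proof. by apply: (@addrI _ (f 0 w)); rewrite -bilinDl !addr0. Qed.
Lemma bilin0r v : f v 0 = 0.
Proof. by apply: (@addrI _ (f v 0)); rewrite -bilinDr !addr0. Qed.
Lemma bilinZl a v w : f (a *: v) w = a *: f v w.
Proof. by have := fbi.1 w a v 0; rewrite bilin0l !addr0. Qed.
Lemma bilinZr a v w : f v (a *: w) = a *: f v w.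
Proof. by have := fbi.2 v a w 0; rewrite bilin0r !addr0. Qed.
End Bilinear.

Section Tensor.
Variables (k : fieldType) (V W : lmodType k).

Inductive bilin_rel : {malg k[(V * W)%type]} -> Prop :=
| BilinDl u v w : bilin_rel (<< (u + v, w) >> - << (u, w) >> - << (v, w) >>)
| BilinDr v w x : bilin_rel (<< (v, w + x) >> - << (v, w) >> - << (v, x) >>)
| BilinZl a v w : bilin_rel (<< (a *: v, w) >> - a *: << (v, w) >>)
| BilinZr a v w : bilin_rel (<< (v, a *: w) >> - a *: << (v, w) >>).

Definition tensor := quotvect (span bilin_rel).
HB.instance Definition _ := GRing.Lmodule.on tensor.
End Tensor.

HB.lock Definition pure (k : fieldType) (V W : lmodType k) (v : V) (w : W) : tensor V W :=
  qclass (span (@bilin_rel k V W)) << (v, w) >>.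
Canonical pure_unlock := Unlockable pure.unlock.

(* A choice of vectors with x = \sum_(p <- terms x) pure p.1 p.2 (see termsE).
   Below, expressions summed over it are bilinear in p.1 and p.2, so that the
   choice does not matter (see sum_terms). *)
HB.lock Definition terms (k : fieldType) (V W : lmodType k) (x : tensor V W) :
    seq (V * W) :=
  [seq ((repr x)@_p *: p.1, p.2) | p <- msupp (repr x)].
Canonical terms_unlock := Unlockable terms.unlock.

Section TensorTheory.
Variables (k : fieldType) (V W : lmodType k).
Local Notation bilin_rel := (@bilin_rel k V W).
Local Notation tensor := (tensor V W).
Local Notation pure := (@pure k V W).

Lemma pure_bilin : bilin pure.
Proof.
pose q : {linear _ -> tensor} := qclass (span bilin_rel).
have pE v w : pure v w = q << (v, w) >> by rewrite pure.unlock.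
have eq0 z : bilin_rel z -> q z = 0.
  by move=> zP; apply/qclass_eq; rewrite subr0; exact: mem_span.
have D1 u v w : pure (u + v) w = pure u w + pure v w.
  have /eqP := eq0 _ (BilinDl u v w).
  by rewrite !pE 2!(linearB q) -addrA -opprD subr_eq0 => /eqP.
have D2 v w x : pure v (w + x) = pure v w + pure v x.
  have /eqP := eq0 _ (BilinDr v w x).
  by rewrite !pE 2!(linearB q) -addrA -opprD subr_eq0 => /eqP.
have Z1 a v w : pure (a *: v) w = a *: pure v w.
  have /eqP := eq0 _ (BilinZl a v w).
  by rewrite !pE (linearB q) (linearZ_LR q) subr_eq0 => /eqP.
have Z2 a v w : pure v (a *: w) = a *: pure v w.
  have /eqP := eq0 _ (BilinZr a v w).
  by rewrite !pE (linearB q) (linearZ_LR q) subr_eq0 => /eqP.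
by split=> [w a u v|v a w x]; rewrite ?D1 ?Z1 ?D2 ?Z2.
Qed.

Section Universal.
Variables (X : lmodType k) (f : V -> W -> X).
Hypothesis fbi : bilin f.
Let F : {linear _ -> X} := freelift (fun p : V * W => f p.1 p.2).

Let sum_termsE x : \sum_(p <- terms x) f p.1 p.2 = qlift F x.
Proof.
by rewrite terms.unlock big_map; apply: eq_bigr => p _; rewrite (bilinZl fbi).
Qed.

Let F_rel z : span bilin_rel z -> F z = 0.
Proof.
have FU p : F << p >> = f p.1 p.2 by rewrite /F /= freeliftU.
apply: (@span_min _ _ _ (kernel F)) => {z} _ [u v w|v w x|a v w|a v w];
  rewrite /smem/= !(linearB F) ?(linearZ_LR F) !FU /=.
- by rewrite (bilinDl fbi) addrAC addrK subrr.
- by rewrite (bilinDr fbi) addrAC addrK subrr.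
- by rewrite (bilinZl fbi) subrr.
- by rewrite (bilinZr fbi) subrr.
Qed.

Lemma sum_terms_linear : linear (fun x => \sum_(p <- terms x) f p.1 p.2).
Proof. by move=> a x y; rewrite !sum_termsE; apply: qlift_linear => z; exact: F_rel. Qed.

Lemma sum_terms_pure v w : \sum_(p <- terms (pure v w)) f p.1 p.2 = f v w.
Proof. by rewrite sum_termsE pure.unlock qlift_class => [|z]; [exact: freeliftU | exact: F_rel]. Qed.
End Universal.

Lemma termsE x : \sum_(p <- terms x) pure p.1 p.2 = x.
Proof.
pose q : {linear _ -> tensor} := qclass (span bilin_rel).
transitivity (q (repr x)); last by rewrite [LHS]qclassK.
rewrite [in RHS](monalgEw (fsubset_refl (msupp (repr x)))) (linear_sum q) /=.
rewrite terms.unlock big_map; apply: eq_bigr => p _ /=.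
have -> : << (repr x)@_p *g p >> = (repr x)@_p *: << p >>.
  by apply/malgP => p'; rewrite mcoeffZ !mcoeffU mulrnAr mulr1.
by rewrite (bilinZl pure_bilin) (linearZ_LR q) pure.unlock; case: p.
Qed.

Lemma sum_terms (X : lmodType k) (f : V -> W -> X) (s : seq (V * W)) x :
  bilin f -> x = \sum_(p <- s) pure p.1 p.2 ->
  \sum_(p <- terms x) f p.1 p.2 = \sum_(p <- s) f p.1 p.2.
Proof.
move=> fbi ->; pose L := GRing.isLinear.Build _ _ _ _ _ (sum_terms_linear fbi).
pose G : {linear tensor -> X} := HB.pack (fun x => \sum_(p <- terms x) f p.1 p.2) L.
rewrite -[LHS]/(G _) linear_sum; apply: eq_bigr => p _ /=.
exact: sum_terms_pure.
Qed.

Lemma tensor_ind (P : tensor -> Prop) :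
  (forall v w, P (pure v w)) -> (forall x y, P x -> P y -> P (x + y)) ->
  forall x, P x.
Proof.
move=> Pp PD x; rewrite -[x]termsE; elim: (terms x) => [|p s IHs].
  by rewrite big_nil -(bilin0l pure_bilin 0).
by rewrite big_cons; apply: PD.
Qed.
End TensorTheory.

Notation "u ⊗ v" := (pure u v) (at level 40, left associativity) : ring_scope.

Fact pure_linearl (k : fieldType) (V W : lmodType k) (w : W) :
  linear (fun v : V => v ⊗ w).
Proof. exact: (@pure_bilin k V W).1. Qed.
Fact pure_linearr (k : fieldType) (V W : lmodType k) (v : V) :
  linear (fun w : W => v ⊗ w).
Proof. exact: (@pure_bilin k V W).2. Qed.

Section TensorPower.
Variables (k : fieldType) (V : lmodType k) (n : nat).

Definition upd (t : {ffun 'I_n -> V}) (i : 'I_n) (v : V) : {ffun 'I_n -> V} :=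
  [ffun j => if j == i then v else t j].

Inductive multilin_rel : {malg k[{ffun 'I_n -> V}]} -> Prop :=
| MultilinD t i u v :
    multilin_rel (<< upd t i (u + v) >> - << upd t i u >> - << upd t i v >>)
| MultilinZ t i a v : multilin_rel (<< upd t i (a *: v) >> - a *: << upd t i v >>).

Definition tpow := quotvect (span multilin_rel).
HB.instance Definition _ := GRing.Lmodule.on tpow.

Definition multilin (X : lmodType k) (f : {ffun 'I_n -> V} -> X) : Prop :=
  forall t i a u v, f (upd t i (a *: u + v)) = a *: f (upd t i u) + f (upd t i v).
End TensorPower.

HB.lock Definition mpure (k : fieldType) (V : lmodType k) (n : nat)
    (t : {ffun 'I_n -> V}) : tpow V n := qclass (span (@multilin_rel k V n)) << t >>.
Canonical mpure_unlock := Unlockable mpure.unlock.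

(* The linear extension of a multilinear f (see mlift_mpure). *)
HB.lock Definition mlift (k : fieldType) (V : lmodType k) (n : nat) (X : lmodType k)
    (f : {ffun 'I_n -> V} -> X) (x : tpow V n) : X := freelift f (repr x).
Canonical mlift_unlock := Unlockable mlift.unlock.

Section TensorPowerTheory.
Variables (k : fieldType) (V : lmodType k) (n : nat).
Local Notation multilin_rel := (@multilin_rel k V n).
Local Notation mpure := (@mpure k V n).

Lemma mpure_multilin : multilin mpure.
Proof.
pose q : {linear _ -> tpow V n} := qclass (span multilin_rel).
have pE t : mpure t = q << t >> by rewrite mpure.unlock.
have eq0 z : multilin_rel z -> q z = 0.
  by move=> zP; apply/qclass_eq; rewrite subr0; exact: mem_span.
move=> t i a u v.
have -> : mpure (upd t i (a *: u + v)) = mpure (upd t i (a *: u)) + mpure (upd t i v).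
  have /eqP := eq0 _ (MultilinD t i (a *: u) v).
  by rewrite !pE 2!(linearB q) -addrA -opprD subr_eq0 => /eqP.
congr (_ + _); have /eqP := eq0 _ (MultilinZ t i a u).
by rewrite !pE (linearB q) (linearZ_LR q) subr_eq0 => /eqP.
Qed.

Section Universal.
Variables (X : lmodType k) (f : {ffun 'I_n -> V} -> X).
Hypothesis fm : multilin f.

Let f_rel z : span multilin_rel z -> freelift f z = 0.
Proof.
have f0 t i : f (upd t i 0) = 0.
  by apply: (@addrI _ (f (upd t i 0))); have := fm t i 1 0 0;
     rewrite !scale1r !addr0 => <-.
pose F : {linear _ -> X} := freelift f.
have FU t : F << t >> = f t by rewrite /F /= freeliftU.
apply: (@span_min _ _ _ (kernel F)) => {z} _ [t i u v|t i a v];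
  rewrite /smem/= !(linearB F) ?(linearZ_LR F) !FU.
- by have := fm t i 1 u v; rewrite !scale1r => ->; rewrite addrAC addrK subrr.
- by have := fm t i a v 0; rewrite addr0 f0 addr0 => ->; rewrite subrr.
Qed.

Lemma mlift_linear : linear (mlift f).
Proof. by rewrite mlift.unlock; apply: qlift_linear => z; exact: f_rel. Qed.

Lemma mlift_mpure t : mlift f (mpure t) = f t.
Proof. by rewrite mlift.unlock mpure.unlock -/(qlift _ _) qlift_class => [|z]; [exact: freeliftU | exact: f_rel]. Qed.
End Universal.
End TensorPowerTheory.

HB.mixin Record isCoalgebra (k : fieldType) C of GRing.Lmodule k C := {
  comul : {linear C -> tensor C C};
  counit : {linear C -> k^o};
  comulA : forall c : C,
    \sum_(p <- terms (comul c)) p.1 ⊗ comul p.2 =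
    \sum_(p <- terms (comul c)) \sum_(q <- terms (comul p.1)) q.1 ⊗ (q.2 ⊗ p.2);
  comul_counitl : forall c : C, \sum_(p <- terms (comul c)) counit p.1 *: p.2 = c;
  comul_counitr : forall c : C, \sum_(p <- terms (comul c)) counit p.2 *: p.1 = c
}.
#[short(type="coalgType")]
HB.structure Definition Coalgebra (k : fieldType) :=
  {C of isCoalgebra k C & GRing.Lmodule k C}.

(* The pairs (c^(1), c^(2)) of Sweedler's notation. *)
Definition sw (k : fieldType) (C : coalgType k) (c : C) : seq (C * C) :=
  terms (comul c).

(* The lists [c^(1); ...; c^(m+1)]; so c^(j) is the entry of index j-1. *)
Fixpoint sweedler (k : fieldType) (C : coalgType k) (m : nat) (c : C) : seq (seq C) :=
  if m is m'.+1 then [seq p.1 :: s | p <- sw c, s <- sweedler m' p.2]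
  else [:: [:: c]].

HB.mixin Record Coalgebra_isHopf (k : fieldType) H
    of GRing.Algebra k H & Coalgebra k H := {
  comul1 : comul (1 : H) = 1 ⊗ 1;
  comulM : forall g h : H, comul (g * h) =
    \sum_(p <- sw g) \sum_(q <- sw h) (p.1 * q.1) ⊗ (p.2 * q.2);
  counit1 : counit (1 : H) = 1;
  counitM : forall g h : H, counit (g * h) = counit g * counit h :> k;
  antipode : {linear H -> H};
  antipodel : forall h : H,
    \sum_(p <- sw h) antipode p.1 * p.2 = (counit h : k)%:A;
  antipoder : forall h : H,
    \sum_(p <- sw h) p.1 * antipode p.2 = (counit h : k)%:A
}.
#[short(type="hopfType")]
HB.structure Definition Hopf (k : fieldType) :=
  {H of Coalgebra_isHopf k H & GRing.Algebra k H & Coalgebra k H}.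

HB.mixin Record Coalgebra_isModCoalg (k : fieldType) (H : hopfType k) C
    of Coalgebra k C := {
  ract : C -> H -> C;
  ract_bilin : bilin ract;
  ract1 : forall c, ract c 1 = c;
  ractM : forall c g h, ract (ract c g) h = ract c (g * h);
  comul_ract : forall c h, comul (ract c h) =
    \sum_(p <- sw c) \sum_(q <- sw h) ract p.1 q.1 ⊗ ract p.2 q.2;
  counit_ract : forall c h, counit (ract c h) = counit c * counit h :> k
}.
#[short(type="modCoalgType")]
HB.structure Definition ModCoalg (k : fieldType) (H : hopfType k) :=
  {C of Coalgebra_isModCoalg k H C & Coalgebra k C}.

Notation "c ◁ h" := (ract c h) (at level 40, left associativity) : ring_scope.

Section Sweedler.
Variables (k : fieldType) (C : coalgType k).

Definition trilin (V1 V2 V3 X : lmodType k) (f : V1 -> V2 -> V3 -> X) : Prop :=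
  [/\ forall v w, linear (fun u => f u v w), forall u w, linear (fun v => f u v w)
    & forall u v, linear (f u v)].

Lemma sw_linear (X : lmodType k) (f : C -> C -> X) : bilin f ->
  linear (fun c => \sum_(p <- sw c) f p.1 p.2).
Proof. by move=> fbi a c d; rewrite /sw linearP sum_terms_linear. Qed.

Lemma sum_linear (V X : lmodType k) (I : Type) (s : seq I) (f : I -> V -> X) :
  (forall i, linear (f i)) -> linear (fun v => \sum_(i <- s) f i v).
Proof.
move=> fl a u v; rewrite scaler_sumr -big_split /=.
by apply: eq_bigr => i _; rewrite fl.
Qed.

Lemma sw_assoc (X : lmodType k) (f : C -> C -> C -> X) c : trilin f ->
  \sum_(p <- sw c) \sum_(q <- sw p.1) f q.1 q.2 p.2 =
  \sum_(p <- sw c) \sum_(q <- sw p.2) f p.1 q.1 q.2.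
Proof.
move=> [f1 f2 f3].
have fb u : bilin (f u) by split=> [w|v]; [exact: f2 | exact: f3].
pose g u (x : tensor C C) := \sum_(q <- terms x) f u q.1 q.2.
have gb : bilin g.
  split=> [x|u]; last exact: sum_terms_linear.
  by apply: sum_linear => q; exact: f1.
pose L := GRing.isLinear.Build _ _ _ _ _ (sum_terms_linear gb).
pose G : {linear tensor C (tensor C C) -> X} :=
  HB.pack (fun x => \sum_(p <- terms x) g p.1 p.2) L.
have GE u x : G (u ⊗ x) = g u x by exact: sum_terms_pure.
have := congr1 G (comulA c); rewrite !(linear_sum G) => h.
transitivity (\sum_(p <- sw c) G (\sum_(q <- sw p.1) q.1 ⊗ (q.2 ⊗ p.2))).
  apply: eq_bigr => p _; rewrite (linear_sum G); apply: eq_bigr => q _.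
  by rewrite GE; apply/esym/sum_terms_pure.
by rewrite -h; apply: eq_bigr => p _; rewrite GE.
Qed.
End Sweedler.

Section Coextension.
Variables (k : fieldType) (H : hopfType k) (C : modCoalgType H).

Definition coideal : subspace C :=
  span (fun v => exists c (h : H), v = c ◁ h - (counit h : k) *: c).

Definition base := quotvect coideal.
HB.instance Definition _ := GRing.Lmodule.on base.

Definition proj : {linear C -> base} := qclass coideal.

Lemma proj_ract c (h : H) : proj (c ◁ h) = (counit h : k) *: proj c.
Proof.
apply/eqP; rewrite -subr_eq0 -(linearZ_LR proj) -(linearB proj).
apply/eqP/qclass_eq; rewrite subr0; apply: mem_span.
by exists c, h.
Qed.

Section Contraction.
Variable phi : {linear base -> k^o}.

(* c |-> c^(1) phi(pi(c^(2))) and c |-> c^(2) phi(pi(c^(1))). *)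
Definition rcontr (c : C) : C := \sum_(p <- sw c) (phi (proj p.2) : k) *: p.1.
Definition lcontr (c : C) : C := \sum_(p <- sw c) (phi (proj p.1) : k) *: p.2.

Lemma rcontr_bilin : bilin (fun u v : C => (phi (proj v) : k) *: u).
Proof.
split=> [w a u v|v a w x]; first by rewrite scalerDr !scalerA mulrC.
by rewrite !linearP scalerDl scalerA.
Qed.
Lemma lcontr_bilin : bilin (fun u v : C => (phi (proj u) : k) *: v).
Proof.
split=> [w a u v|v a w x]; last by rewrite scalerDr !scalerA mulrC.
by rewrite !linearP scalerDl scalerA.
Qed.

Fact rcontr_linear : linear rcontr. Proof. exact: sw_linear rcontr_bilin. Qed.
Fact lcontr_linear : linear lcontr. Proof. exact: sw_linear lcontr_bilin. Qed.
HB.instance Definition _ := GRing.isLinear.Build k C C _ rcontr rcontr_linear.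
HB.instance Definition _ := GRing.isLinear.Build k C C _ lcontr lcontr_linear.
End Contraction.

Fact coinv0 (phi : {linear base -> k^o}) : rcontr phi 0 = lcontr phi 0.
Proof. by rewrite !linear0. Qed.
Fact coinvD u v : (forall phi, rcontr phi u = lcontr phi u) ->
  (forall phi, rcontr phi v = lcontr phi v) ->
  forall phi, rcontr phi (u + v) = lcontr phi (u + v).
Proof. by move=> hu hv phi; rewrite !linearD /= hu hv. Qed.
Fact coinvZ a u : (forall phi, rcontr phi u = lcontr phi u) ->
  forall phi, rcontr phi (a *: u) = lcontr phi (a *: u).
Proof. by move=> hu phi; rewrite !linearZ_LR /= hu. Qed.

Definition coinv : subspace C :=
  @Subspace k C (fun c => forall phi, rcontr phi c = lcontr phi c) coinv0 coinvD coinvZ.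

Definition CD := subvect coinv.
HB.instance Definition _ := GRing.Lmodule.on CD.

Lemma sw_ract (X : lmodType k) (f : C -> C -> X) c (h : H) : bilin f ->
  \sum_(p <- sw (c ◁ h)) f p.1 p.2 =
  \sum_(p <- sw c) \sum_(q <- sw h) f (p.1 ◁ q.1) (p.2 ◁ q.2).
Proof.
move=> fbi; rewrite /sw comul_ract.
rewrite (@sum_terms _ _ _ _ _ [seq (p.1 ◁ q.1, p.2 ◁ q.2) | p <- sw c, q <- sw h]) //.
  by rewrite big_allpairs_dep.
by rewrite big_allpairs_dep.
Qed.

Definition actl (h : H) (c : C) : C := c ◁ h.
Definition actr (c : C) (h : H) : C := c ◁ h.
Fact actl_linear h : linear (actl h). Proof. exact: (@ract_bilin _ _ C).1. Qed.
Fact actr_linear c : linear (actr c). Proof. exact: (@ract_bilin _ _ C).2. Qed.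
HB.instance Definition _ h := GRing.isLinear.Build k C C _ (actl h) (actl_linear h).
HB.instance Definition _ c := GRing.isLinear.Build k H C _ (actr c) (actr_linear c).

Lemma sw_counitl (D : coalgType k) (X : lmodType k) (f : {linear D -> X}) d :
  \sum_(p <- sw d) (counit p.1 : k) *: f p.2 = f d.
Proof.
rewrite -[in RHS](comul_counitl d) linear_sum.
by apply: eq_bigr => p _; rewrite linearZ_LR.
Qed.
Lemma sw_counitr (D : coalgType k) (X : lmodType k) (f : {linear D -> X}) d :
  \sum_(p <- sw d) (counit p.2 : k) *: f p.1 = f d.
Proof.
rewrite -[in RHS](comul_counitr d) linear_sum.
by apply: eq_bigr => p _; rewrite linearZ_LR.
Qed.

Lemma rcontr_ract phi c (h : H) : rcontr phi (c ◁ h) = rcontr phi c ◁ h.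
Proof.
rewrite [LHS](sw_ract _ _ (rcontr_bilin phi)) -[RHS]/(actl h _).
rewrite /rcontr linear_sum; apply: eq_bigr => p _.
rewrite linearZ_LR /= -[actl h _]/(actr p.1 h) -(sw_counitr (actr p.1)) scaler_sumr.
by apply: eq_bigr => q _; rewrite proj_ract linearZ_LR scalerA mulrC.
Qed.

Lemma lcontr_ract phi c (h : H) : lcontr phi (c ◁ h) = lcontr phi c ◁ h.
Proof.
rewrite [LHS](sw_ract _ _ (lcontr_bilin phi)) -[RHS]/(actl h _).
rewrite /lcontr linear_sum; apply: eq_bigr => p _.
rewrite linearZ_LR /= -[actl h _]/(actr p.2 h) -(sw_counitl (actr p.2)) scaler_sumr.
by apply: eq_bigr => q _; rewrite proj_ract linearZ_LR scalerA mulrC.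
Qed.

Lemma coinv_ract (c : CD) (h : H) : coinv (\val c ◁ h).
Proof. by move=> phi; rewrite rcontr_ract lcontr_ract (subvect_mem c phi). Qed.

Definition CDact (c : CD) (h : H) : CD := insubvect (coinv_ract c h).

Definition cot_l (x : tensor C C) : tensor C (tensor base C) :=
  \sum_(p <- terms x) \sum_(q <- sw p.1) q.1 ⊗ (proj q.2 ⊗ p.2).
Definition cot_r (x : tensor C C) : tensor C (tensor base C) :=
  \sum_(p <- terms x) \sum_(q <- sw p.2) p.1 ⊗ (proj q.1 ⊗ q.2).

Lemma cot_bilin_l (c : C) : bilin (fun a b : C => a ⊗ (proj b ⊗ c)).
Proof.
split=> [v|v a u w]; first exact: pure_linearl.
by rewrite linearP pure_linearl pure_linearr.
Qed.
Lemma cot_bilin_r (c : C) : bilin (fun a b : C => c ⊗ (proj a ⊗ b)).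
Proof.
split=> [v a u w|v a u w]; first by rewrite linearP pure_linearl pure_linearr.
by rewrite !pure_linearr.
Qed.

Lemma cot_l_bilin : bilin (fun a b : C => \sum_(q <- sw a) q.1 ⊗ (proj q.2 ⊗ b)).
Proof.
split=> [w|v]; first exact: sw_linear (cot_bilin_l w).
by apply: sum_linear => q a u w; rewrite !pure_linearr.
Qed.
Lemma cot_r_bilin : bilin (fun a b : C => \sum_(q <- sw b) a ⊗ (proj q.1 ⊗ q.2)).
Proof.
split=> [w|v]; last exact: sw_linear (cot_bilin_r v).
by apply: sum_linear => q; exact: pure_linearl.
Qed.
Fact cot_l_linear : linear cot_l. Proof. exact: sum_terms_linear cot_l_bilin. Qed.
Fact cot_r_linear : linear cot_r. Proof. exact: sum_terms_linear cot_r_bilin. Qed.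
HB.instance Definition _ := GRing.isLinear.Build k (tensor C C) (tensor C (tensor base C)) _ cot_l cot_l_linear.
HB.instance Definition _ := GRing.isLinear.Build k (tensor C C) (tensor C (tensor base C)) _ cot_r cot_r_linear.

Definition cotensor : subspace (tensor C C) := equalizer cot_l cot_r.

Definition beta_fun (z : tensor C H) : tensor C C :=
  \sum_(t <- terms z) \sum_(p <- sw t.1) p.1 ⊗ (p.2 ◁ t.2).

Lemma beta_bilin_sw (h : H) : bilin (fun a b : C => a ⊗ (b ◁ h)).
Proof.
split=> [b|a x b d]; first exact: pure_linearl.
by rewrite -[_ ◁ h]/(actl h _) linearP pure_linearr.
Qed.
Lemma beta_bilin : bilin (fun (c : C) (h : H) => \sum_(p <- sw c) p.1 ⊗ (p.2 ◁ h)).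
Proof.
split=> [h|c]; first exact: sw_linear (beta_bilin_sw h).
by apply: sum_linear => p a g h; rewrite -[_ ◁ _]/(actr _ _) linearP pure_linearr.
Qed.
Lemma beta_fun_pure c (h : H) :
  beta_fun (c ⊗ h) = \sum_(p <- sw c) p.1 ⊗ (p.2 ◁ h).
Proof. exact: sum_terms_pure beta_bilin c h. Qed.
Fact beta_fun_linear : linear beta_fun.
Proof. exact: sum_terms_linear beta_bilin. Qed.
HB.instance Definition _ := 
  GRing.isLinear.Build k (tensor C H) (tensor C C) _ beta_fun beta_fun_linear.

Lemma cot_l_pure a b : cot_l (a ⊗ b) = \sum_(q <- sw a) q.1 ⊗ (proj q.2 ⊗ b).
Proof. exact: sum_terms_pure cot_l_bilin a b. Qed.
Lemma cot_r_pure a b : cot_r (a ⊗ b) = \sum_(q <- sw b) a ⊗ (proj q.1 ⊗ q.2).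
Proof. exact: sum_terms_pure cot_r_bilin a b. Qed.

Lemma beta_cotensor z : cotensor (beta_fun z).
Proof.
elim/tensor_ind: z => [c h|x y xU yU]; last by rewrite linearD; apply: smemD.
suff: cot_l (beta_fun (c ⊗ h)) = cot_r (beta_fun (c ⊗ h)) by [].
rewrite beta_fun_pure. rewrite (linear_sum cot_l). rewrite (linear_sum cot_r).
transitivity (\sum_(p <- sw c) \sum_(q <- sw p.1) q.1 ⊗ (proj q.2 ⊗ (p.2 ◁ h))).
  by apply: eq_bigr => p _; exact: cot_l_pure.
have ftri : trilin (fun a b d : C => a ⊗ (proj b ⊗ (d ◁ h))).
  split=> [b d|a d x b b'|a b x d d']; first exact: pure_linearl.
    by rewrite linearP pure_linearl pure_linearr.
  by rewrite -[_ ◁ h]/(actl h _) linearP !pure_linearr.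
rewrite (sw_assoc _ ftri); apply: eq_bigr => p _; rewrite [RHS]cot_r_pure.
rewrite (sw_ract _ _ (cot_bilin_r p.1)); apply: eq_bigr => q _.
pose G (x : H) := p.1 ⊗ (proj q.1 ⊗ actr q.2 x).
have Gl : linear G by move=> a x y; rewrite /G linearP !pure_linearr.
pose L : {linear H -> _} := HB.pack G (GRing.isLinear.Build _ _ _ _ _ Gl).
rewrite -[LHS]/(L h) -sw_counitl; apply: eq_bigr => r _.
rewrite proj_ract -[LHS](linearZ_LR L) /= /G linearZ_LR.
have -> a : proj q.1 ⊗ (a *: (q.2 ◁ r.2)) = (a *: proj q.1) ⊗ (q.2 ◁ r.2).
  by rewrite (bilinZl (@pure_bilin _ _ _)) (bilinZr (@pure_bilin _ _ _)).
by [].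
Qed.

Definition beta (z : tensor C H) : subvect cotensor := insubvect (beta_cotensor z).

Fact beta_linear : linear beta.
Proof. by move=> a x y; apply/val_inj; rewrite [RHS]linearP; exact: beta_fun_linear. Qed.
HB.instance Definition _ := 
  GRing.isLinear.Build k (tensor C H) (subvect cotensor) _ beta beta_linear.

Definition hopf_galois : Prop := bijective beta.

End Coextension.

Section Kappa.
Variables (k : fieldType) (H : hopfType k) (C : modCoalgType H).
Local Notation proj := (proj C).
Local Notation cotensor := (cotensor C).

Definition coinv_rel : subspace C :=
  span (fun v => exists phi (c : C), v = rcontr phi c - lcontr phi c).
Definition C_D := quotvect coinv_rel.
HB.instance Definition _ := GRing.Lmodule.on C_D.

Definition cot_coinv_rel : subspace (subvect cotensor) :=
  span (fun y => exists phi (x : subvect cotensor), \val y =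
    \sum_(p <- terms (\val x)) (p.1 ⊗ rcontr phi p.2 - lcontr phi p.1 ⊗ p.2)).
Definition cot_D := quotvect cot_coinv_rel.
HB.instance Definition _ := GRing.Lmodule.on cot_D.

Definition counit_C_D (u : C_D) : k := counit (repr u).

(* The class of c, tensored with h, is sent to the class of beta (c ⊗ h): see
   betabar_pure. *)
Definition betabar (z : tensor C_D H) : cot_D :=
  \sum_(p <- terms z) qclass cot_coinv_rel (beta (repr p.1 ⊗ p.2)).

Lemma counit_rcontr phi (c : C) : counit (rcontr phi c) = phi (proj c).
Proof.
rewrite linear_sum -[RHS]/((phi \o proj) c) -sw_counitl.
by apply: eq_bigr => p _; rewrite linearZ_LR /= -[LHS]/(_ * _) mulrC.
Qed.
Lemma counit_lcontr phi (c : C) : counit (lcontr phi c) = phi (proj c).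
Proof.
rewrite linear_sum -[RHS]/((phi \o proj) c) -sw_counitr.
by apply: eq_bigr => p _; rewrite linearZ_LR /= -[LHS]/(_ * _) mulrC.
Qed.

Lemma counit_C_D_class c : counit_C_D (qclass coinv_rel c) = counit c.
Proof.
rewrite -[LHS]/(qlift (@counit k C) _) qlift_class // => u.
apply: (@span_min _ _ _ (kernel (@counit k C))) => {u} _ [phi [c' ->]].
suff: counit (rcontr phi c' - lcontr phi c') = 0 by [].
by rewrite linearB /= counit_rcontr counit_lcontr subrr.
Qed.

Lemma cot_rel_bilin phi :
  bilin (fun a b : C => a ⊗ rcontr phi b - lcontr phi a ⊗ b).
Proof.
split=> [c|c] a u v.
  by rewrite linearP !pure_linearl opprD scalerBr addrACA.
by rewrite linearP !pure_linearr opprD scalerBr addrACA.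
Qed.

Lemma beta_rcontr phi (c : C) (h : H) :
  beta_fun (rcontr phi c ⊗ h) = \sum_(p <- sw c) p.1 ⊗ rcontr phi (p.2 ◁ h).
Proof.
pose L : {linear C -> tensor C C} := HB.pack (fun c : C => beta_fun (c ⊗ h))
  (GRing.isLinear.Build k C _ _ _
    (fun a x y => etrans (congr1 _ (pure_linearl h a x y)) (linearP (@beta_fun _ _ C) _ _ _))).
have LE x : L x = \sum_(p <- sw x) p.1 ⊗ (p.2 ◁ h) by exact: beta_fun_pure.
have ftri : trilin (fun a b d : C => (phi (proj d) : k) *: (a ⊗ (b ◁ h))).
  split=> [b d a u v|a d x b b'|a b x d d'].
  - by rewrite pure_linearl scalerDr !scalerA mulrC.
  - by rewrite -[_ ◁ h]/(actl h _) linearP pure_linearr scalerDr !scalerA mulrC.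
  - by rewrite !linearP scalerDl scalerA.
rewrite -[LHS]/(L _) linear_sum.
transitivity (\sum_(p <- sw c) \sum_(q <- sw p.1)
    (phi (proj p.2) : k) *: (q.1 ⊗ (q.2 ◁ h))).
  by apply: eq_bigr => p _; rewrite linearZ_LR LE scaler_sumr.
rewrite (sw_assoc _ ftri); apply: eq_bigr => p _.
rewrite rcontr_ract -[_ ◁ h]/(actl h _) /rcontr !linear_sum.
pose M : {linear C -> tensor C C} := HB.pack (fun x : C => p.1 ⊗ x)
  (GRing.isLinear.Build k C _ _ _ (@pure_linearr k C C p.1)).
rewrite -[RHS]/(M _) linear_sum; apply: eq_bigr => q _.
by rewrite linearZ_LR [RHS]linearZ_LR.
Qed.

Lemma beta_lcontr phi (c : C) (h : H) :
  beta_fun (lcontr phi c ⊗ h) = \sum_(p <- sw c) lcontr phi p.1 ⊗ (p.2 ◁ h).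
Proof.
pose L : {linear C -> tensor C C} := HB.pack (fun c : C => beta_fun (c ⊗ h))
  (GRing.isLinear.Build k C _ _ _
    (fun a x y => etrans (congr1 _ (pure_linearl h a x y)) (linearP (@beta_fun _ _ C) _ _ _))).
have LE x : L x = \sum_(p <- sw x) p.1 ⊗ (p.2 ◁ h) by exact: beta_fun_pure.
have ftri : trilin (fun a b d : C => (phi (proj a) : k) *: (b ⊗ (d ◁ h))).
  split=> [b d a u v|a d x b b'|a b x d d'].
  - by rewrite !linearP scalerDl scalerA.
  - by rewrite pure_linearl scalerDr !scalerA mulrC.
  - by rewrite -[_ ◁ h]/(actl h _) linearP pure_linearr scalerDr !scalerA mulrC.
rewrite -[LHS]/(L _) linear_sum.
transitivity (\sum_(p <- sw c) \sum_(q <- sw p.2)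
    (phi (proj p.1) : k) *: (q.1 ⊗ (q.2 ◁ h))).
  by apply: eq_bigr => p _; rewrite linearZ_LR LE scaler_sumr.
rewrite -(sw_assoc _ ftri); apply: eq_bigr => p _; rewrite /lcontr.
pose M : {linear C -> tensor C C} := HB.pack (fun x : C => x ⊗ (p.2 ◁ h))
  (GRing.isLinear.Build k C _ _ _ (@pure_linearl k C C (p.2 ◁ h))).
rewrite -[RHS]/(M _) linear_sum; apply: eq_bigr => q _.
by rewrite linearZ_LR.
Qed.

Lemma beta_coinv_rel u (h : H) : coinv_rel u -> cot_coinv_rel (beta (u ⊗ h)).
Proof.
pose B (c : C) : subvect cotensor := beta (c ⊗ h).
have Bl : linear B by move=> a x y; rewrite /B pure_linearl linearP.
pose L : {linear C -> subvect cotensor} := HB.pack B (GRing.isLinear.Build k C _ _ _ Bl).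
move=> [s sP ->]; rewrite -/(B _) -[B _]/(L _) linear_sum.
rewrite big_seq; elim/big_ind: _ => [||p /sP [phi [c pE]]].
- exact: smem0.
- exact: smemD.
rewrite linearZ_LR; apply: smemZ; apply: mem_span; exists phi, (B c).
rewrite pE (linearB L) linearB.
suff: beta_fun (rcontr phi c ⊗ h) - beta_fun (lcontr phi c ⊗ h) =
  \sum_(q <- terms (beta_fun (c ⊗ h))) (q.1 ⊗ rcontr phi q.2 - lcontr phi q.1 ⊗ q.2) by [].
rewrite (beta_fun_pure c).
rewrite (sum_terms (s := [seq (q.1, q.2 ◁ h) | q <- sw c]) (cot_rel_bilin phi)) ?big_map //.
by rewrite big_split /= sumrN -beta_lcontr -beta_rcontr.
Qed.

Fact class_beta_E c (h : H) :
  qclass cot_coinv_rel (beta (repr (qclass coinv_rel c) ⊗ h)) =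
  qclass cot_coinv_rel (beta (c ⊗ h)).
Proof.
apply/qclass_eq; rewrite -linearB.
have -> : repr (qclass coinv_rel c) ⊗ h - c ⊗ h =
    (repr (qclass coinv_rel c) - c) ⊗ h.
  by rewrite -[in RHS]scaleN1r (bilinDl (@pure_bilin _ _ _))
    (bilinZl (@pure_bilin _ _ _)) scaleN1r.
by apply: beta_coinv_rel; apply/qclass_eq; rewrite qclassK.
Qed.

Fact class_beta_bilin :
  bilin (fun (u : C_D) (h : H) => qclass cot_coinv_rel (beta (repr u ⊗ h))).
Proof.
split=> [x a u v|u a x y]; last by rewrite pure_linearr !linearP.
rewrite -[u]qclassK -[v]qclassK -(linearP (qclass coinv_rel)) !class_beta_E.
by rewrite pure_linearl !linearP.
Qed.

Lemma betabar_pure c (h : H) :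
  betabar (qclass coinv_rel c ⊗ h) = qclass cot_coinv_rel (beta (c ⊗ h)).
Proof. by rewrite /betabar (sum_terms_pure class_beta_bilin) class_beta_E. Qed.

Fact betabar_linear : linear betabar.
Proof. exact: sum_terms_linear class_beta_bilin. Qed.
HB.instance Definition _ :=
  GRing.isLinear.Build k (tensor C_D H) cot_D _ betabar betabar_linear.

(* (ε ⊗ Id) \o betabar^-1; only used when betabar is bijective. *)
Definition kappa (y : cot_D) : H :=
  \sum_(p <- terms (xget 0 [set z | betabar z = y])) counit_C_D p.1 *: p.2.

(* c^(3) □ c^(1) ⊗ c^(2), as an element of (C □_D C) ⊗ C: for c in C^D, this is
   the unique z whose image in C ⊗ C ⊗ C is c^(3) ⊗ c^(1) ⊗ c^(2). *)
Definition cot312 (c : C) : tensor (subvect cotensor) C :=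
  xget 0 [set z | \sum_(w <- terms z) \sum_(p <- terms (\val w.1)) p.1 ⊗ (p.2 ⊗ w.2) =
                  \sum_(s <- sweedler 2 c) s`_2 ⊗ (s`_0 ⊗ s`_1)].

(* The coaction c |-> kappa (class (c^(3) □ c^(1))) ⊗ c^(2) of H on C^D: its
   values, a priori in H ⊗ C, come from a unique element of H ⊗ C^D.  (This is
   true of c^(3) □ c^(1) ⊗ c^(2) itself only modulo cot_coinv_rel.) *)
Definition coaction (c : CD C) : tensor H (CD C) :=
  xget 0 [set y | \sum_(p <- terms y) p.1 ⊗ \val p.2 =
    \sum_(w <- terms (cot312 (\val c))) kappa (qclass cot_coinv_rel w.1) ⊗ w.2].
End Kappa.

Section CotensorPowers.
Variables (k : fieldType) (H : hopfType k) (C : modCoalgType H) (n : nat).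
Implicit Types t : {ffun 'I_n.+1 -> C}.

(* The D-coactions on the i-th factor of C ⊗ ... ⊗ C; the factor D which they
   create is moved to the front. *)
Definition lco (i : 'I_n.+1) t : tensor (base C) (tpow C n.+1) :=
  \sum_(q <- sw (t i)) proj C q.1 ⊗ mpure (upd t i q.2).
Definition rco (i : 'I_n.+1) t : tensor (base C) (tpow C n.+1) :=
  \sum_(q <- sw (t i)) proj C q.2 ⊗ mpure (upd t i q.1).

Lemma upd_eq t i v : upd t i v i = v.
Proof. by rewrite ffunE eqxx. Qed.
Lemma upd_neq t i j v : i != j -> upd t j v i = t i.
Proof. by rewrite ffunE => /negbTE->. Qed.
Lemma updK t i v w : upd (upd t i v) i w = upd t i w.
Proof. by apply/ffunP => j; rewrite !ffunE; case: eqP. Qed.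
Lemma updC t i j v w : i != j -> upd (upd t i v) j w = upd (upd t j w) i v.
Proof.
by move=> ij; apply/ffunP => l; rewrite !ffunE; have [->|//] := eqVneq l j;
  rewrite eq_sym (negbTE ij).
Qed.

Lemma lco_multilin i : multilin (lco i).
Proof.
move=> t j a u v; rewrite /lco; have [<-|ij] := eqVneq i j.
  pose f (a b : C) := proj C a ⊗ mpure (upd t i b).
  have fbi : bilin f.
    split=> [w b x y|w b x y]; rewrite /f; first by rewrite linearP pure_linearl.
    by rewrite mpure_multilin pure_linearr.
  have E y x : \sum_(q <- sw x) proj C q.1 ⊗ mpure (upd (upd t i y) i q.2) =
      \sum_(q <- sw x) f q.1 q.2.
    by apply: eq_bigr => q _; rewrite updK.
  rewrite !upd_eq !E; exact: (sw_linear fbi).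
rewrite !upd_neq // scaler_sumr -big_split /=; apply: eq_bigr => q _.
by rewrite ![upd (upd t j _) i _]updC 1?eq_sym // mpure_multilin pure_linearr.
Qed.

Lemma rco_multilin i : multilin (rco i).
Proof.
move=> t j a u v; rewrite /rco; have [<-|ij] := eqVneq i j.
  pose f (a b : C) := proj C b ⊗ mpure (upd t i a).
  have fbi : bilin f.
    split=> [w b x y|w b x y]; rewrite /f; last by rewrite linearP pure_linearl.
    by rewrite mpure_multilin pure_linearr.
  have E y x : \sum_(q <- sw x) proj C q.2 ⊗ mpure (upd (upd t i y) i q.1) =
      \sum_(q <- sw x) f q.1 q.2.
    by apply: eq_bigr => q _; rewrite updK.
  rewrite !upd_eq !E; exact: (sw_linear fbi).
rewrite !upd_neq // scaler_sumr -big_split /=; apply: eq_bigr => q _.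
by rewrite ![upd (upd t j _) i _]updC 1?eq_sym // mpure_multilin pure_linearr.
Qed.

Definition lcoact i (x : tpow C n.+1) := mlift (lco i) x.
Definition rcoact i (x : tpow C n.+1) := mlift (rco i) x.
HB.instance Definition _ i := GRing.isLinear.Build k (tpow C n.+1) _ _
  (lcoact i) (mlift_linear (lco_multilin i)).
HB.instance Definition _ i := GRing.isLinear.Build k (tpow C n.+1) _ _
  (rcoact i) (mlift_linear (rco_multilin i)).

(* C □_D ... □_D C, with n+1 factors: over a field, the subspace of the tensor
   power where the D-coactions agree at each □_D. *)
Definition cotensor_pow : subspace (tpow C n.+1) :=
  meet (fun i : 'I_n =>
    equalizer (rcoact (widen_ord (leqnSn n) i)) (lcoact (lift ord0 i))).

Definition cyc_cotensor : subspace (tpow C n.+1) :=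
  meet (fun b : bool =>
    if b then cotensor_pow else equalizer (lcoact ord0) (rcoact ord_max)).
End CotensorPowers.

Section Cocyclic.
Variable k : fieldType.

(* The operators are indexed by natural numbers; only those in the range of the
   axioms are meaningful: coface n i for i <= n.+1 and codeg n i for i <= n. *)
Record cocyclic (X : nat -> lmodType k) := Cocyclic {
  coface : forall n, nat -> {linear X n -> X n.+1};
  codeg : forall n, nat -> {linear X n.+1 -> X n};
  cyc : forall n, {linear X n -> X n};
  coface_coface : forall n i j x, (i < j <= n.+2)%N ->
    coface n.+1 j (coface n i x) = coface n.+1 i (coface n j.-1 x);
  codeg_codeg : forall n i j x, (i <= j <= n)%N ->
    codeg n j (codeg n.+1 i x) = codeg n i (codeg n.+1 j.+1 x);
  codeg_coface_lt : forall n i j x, (i < j <= n.+1)%N ->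
    codeg n.+1 j (coface n.+1 i x) = coface n i (codeg n j.-1 x);
  codeg_coface_id : forall n i j x, (j <= n)%N -> (i == j) || (i == j.+1) ->
    codeg n j (coface n i x) = x;
  codeg_coface_gt : forall n i j x, (j.+1 < i <= n.+2)%N ->
    codeg n.+1 j (coface n.+1 i x) = coface n i.-1 (codeg n j x);
  cyc_coface : forall n i x, (0 < i <= n.+1)%N ->
    cyc n.+1 (coface n i x) = coface n i.-1 (cyc n x);
  cyc_coface0 : forall n x, cyc n.+1 (coface n 0%N x) = coface n n.+1 x;
  cyc_codeg : forall n i x, (0 < i <= n)%N ->
    cyc n (codeg n i x) = codeg n i.-1 (cyc n.+1 x);
  cyc_codeg0 : forall n x,
    cyc n (codeg n 0%N x) = codeg n n (cyc n.+1 (cyc n.+1 x));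
  cyc_order : forall n x, iter n.+1 (cyc n) x = x
}.

Section CyclicCohomology.
Variables (X : nat -> lmodType k) (A : cocyclic X).

(* Cyclic cohomology, as the cohomology of Connes' complex of cyclic cochains
   (k is to contain the rational numbers). *)
Definition hochschild n (x : X n) : X n.+1 :=
  \sum_(i < n.+2) (-1) ^+ i *: coface A n i x.
Fact hochschild_linear n : linear (@hochschild n).
Proof. by apply: sum_linear => i a x y; rewrite linearP scalerDr !scalerA mulrC. Qed.
HB.instance Definition _ n :=
  GRing.isLinear.Build k (X n) (X n.+1) _ (@hochschild n) (@hochschild_linear n).

Definition signed_cyc n (x : X n) : X n := (-1) ^+ n *: cyc A n x.
Fact signed_cyc_linear n : linear (@signed_cyc n).
Proof. by move=> a x y; rewrite /signed_cyc linearP scalerDr !scalerA mulrC. Qed.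
HB.instance Definition _ n :=
  GRing.isLinear.Build k (X n) (X n) _ (@signed_cyc n) (@signed_cyc_linear n).

Definition cyclic_cochain n : subspace (X n) := equalizer (@signed_cyc n) idfun.

Definition cyclic_cocycle n : subspace (X n) :=
  meet (fun b : bool => if b then cyclic_cochain n else kernel (@hochschild n)).

Definition is_cobound n : X n -> Prop :=
  match n with
  | 0 => fun x => x = 0
  | m.+1 => fun x => exists2 y, cyclic_cochain m y & x = hochschild y
  end.

Fact is_cobound0 n : is_cobound (\val (0 : subvect (cyclic_cocycle n))).
Proof. by case: n => [//|n]; exists 0; rewrite ?linear0 //; exact: (smem0 (cyclic_cochain n)). Qed.
Fact is_coboundD n (u v : subvect (cyclic_cocycle n)) :
  is_cobound (\val u) -> is_cobound (\val v) -> is_cobound (\val (u + v)).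
Proof.
case: n u v => [|n] u v /=; first by move=> -> ->; rewrite addr0.
move=> [y yc uE] [z zc vE]; exists (y + z); first exact: (@smemD _ _ (cyclic_cochain n)).
by rewrite linearD [LHS](congr2 +%R uE vE).
Qed.
Fact is_coboundZ n a (u : subvect (cyclic_cocycle n)) :
  is_cobound (\val u) -> is_cobound (\val (a *: u)).
Proof.
case: n u => [|n] u /=; first by move=> ->; rewrite scaler0.
move=> [y yc uE]; exists (a *: y); first exact: (@smemZ _ _ (cyclic_cochain n)).
by rewrite linearZ_LR [LHS](congr1 ( *:%R a) uE).
Qed.

Definition cyclic_cobound n : subspace (subvect (cyclic_cocycle n)) :=
  @Subspace k (subvect (cyclic_cocycle n)) (fun u => is_cobound (\val u))
    (@is_cobound0 n) (@is_coboundD n) (@is_coboundZ n).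

Definition HC n : lmodType k := quotvect (cyclic_cobound n).
End CyclicCohomology.

Definition cocyclic_iso (X Y : nat -> lmodType k) (A : cocyclic X) (B : cocyclic Y)
    (f : forall n, {linear X n -> Y n}) : Prop :=
  [/\ forall n, bijective (f n),
      forall n i x, (i <= n.+1)%N -> f n.+1 (coface A n i x) = coface B n i (f n x),
      forall n i x, (i <= n)%N -> f n (codeg A n i x) = codeg B n i (f n.+1 x)
    & forall n x, f n (cyc A n x) = cyc B n (f n x)].

Definition lin_iso (V W : lmodType k) : Prop :=
  exists f : {linear V -> W}, bijective f.
End Cocyclic.

Section HopfCyclic.
Variables (k : fieldType) (H : hopfType k) (C : modCoalgType H).

Definition hopf_space (n : nat) : lmodType k := tensor (tpow H n) (CD C).
Definition rel_space (n : nat) : lmodType k := subvect (cyc_cotensor C n).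

(* The ways of picking one entry from each member of ss. *)
Definition choices (T : Type) (ss : seq (seq T)) : seq (seq T) :=
  foldr (fun s acc => [seq x :: y | x <- s, y <- acc]) [:: [::]] ss.

(* Simultaneous Sweedler decompositions of h_1, ..., h_n, that of h_(i+1) into
   (m i).+1 factors: for w \in sweedlers m h, the factor h_(i+1)^(j+1) is w i j. *)
Definition sweedlers n (m : nat -> nat) (h : {ffun 'I_n -> H}) :
    seq (nat -> nat -> H) :=
  [seq (fun i j => (nth [::] w i)`_j)
     | w <- choices [seq sweedler (m i) (h i) | i : 'I_n <- enum 'I_n]].

(* In the following specifications, which are on pure tensors, h i stands for
   h_(i+1). *)
Definition is_hopf_cocyclic (A : cocyclic hopf_space) : Prop :=
  [/\ [/\
    forall n i (h : {ffun 'I_n -> H}) c, (i <= n)%N ->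
      coface A n i (mpure h ⊗ c) =
      mpure [ffun j : 'I_n.+1 => oapp h (1 : H) (unlift (inord i) j)] ⊗ c
  & forall n (h : {ffun 'I_n -> H}) c,
      coface A n n.+1 (mpure h ⊗ c) =
      \sum_(w <- sweedlers (fun=> 1%N) h) \sum_(p <- terms (coaction c))
        mpure [ffun j : 'I_n.+1 =>
                 if (j < n)%N then w j 0%N
                 else antipode (\prod_(i < n) w i 1%N) * p.1] ⊗ p.2],
  [/\
    forall n i (h : {ffun 'I_n.+1 -> H}) c, (i < n)%N ->
      codeg A n i (mpure h ⊗ c) =
      mpure [ffun j : 'I_n =>
               if (j < i)%N then h (inord j)
               else if (j == i :> nat)%N then h (inord i) * h (inord i.+1)
               else h (inord j.+1)] ⊗ c
  & forall n (h : {ffun 'I_n.+1 -> H}) c,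
      codeg A n n (mpure h ⊗ c) =
      (counit (h ord_max) : k) *:
        (mpure [ffun j : 'I_n => h (widen_ord (leqnSn n) j)] ⊗ c)]
& [/\
    forall x, cyc A 0%N x = x
  & forall n (h : {ffun 'I_n.+1 -> H}) c,
      cyc A n.+1 (mpure h ⊗ c) =
      \sum_(w <- sweedlers (fun=> 1%N) h) \sum_(p <- terms (coaction c))
        mpure [ffun j : 'I_n.+1 =>
                 if (j < n)%N then w j.+1 0%N
                 else antipode (\prod_(i < n.+1) w i 1%N) * p.1]
        ⊗ CDact p.2 (w 0%N 0%N)]].

(* Here c i is the factor of index i, for 0 <= i <= n. *)
Definition is_rel_cocyclic (A : cocyclic rel_space) : Prop :=
  [/\ forall n i x, (i <= n)%N ->
        \val (coface A n i x) =
        mlift (fun c : {ffun 'I_n.+1 -> C} => \sum_(q <- sw (c (inord i)))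
          mpure [ffun j : 'I_n.+2 =>
                   if (j < i)%N then c (inord j)
                   else if (j == i :> nat)%N then q.1
                   else if (j == i.+1 :> nat)%N then q.2
                   else c (inord j.-1)]) (\val x),
      forall n x,
        \val (coface A n n.+1 x) =
        mlift (fun c : {ffun 'I_n.+1 -> C} => \sum_(q <- sw (c ord0))
          mpure [ffun j : 'I_n.+2 =>
                   if (j == 0 :> nat)%N then q.2
                   else if (j == n.+1 :> nat)%N then q.1
                   else c (inord j)]) (\val x),
      forall n i x, (i <= n)%N ->
        \val (codeg A n i x) =
        mlift (fun c : {ffun 'I_n.+2 -> C} =>
          (counit (c (inord i.+1)) : k) *:
            mpure [ffun j : 'I_n.+1 => c (lift (inord i.+1) j)]) (\val x)
    & forall n x,
        \val (cyc A n x) =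
        mlift (fun c : {ffun 'I_n.+1 -> C} => mpure [ffun j => c (ordS j)]) (\val x)].

(* The factor of index j is
   c^(j+1) ◁ h_1^(j) h_2^(j-1) ... h_j^(1), for 0 <= j <= n. *)
Definition is_psi (psi : forall n, {linear hopf_space n -> rel_space n}) : Prop :=
  forall n (h : {ffun 'I_n -> H}) (c : CD C),
    \val (psi n (mpure h ⊗ c)) =
    \sum_(s <- sweedler n (\val c)) \sum_(w <- sweedlers (fun i => (n - i).-1%N) h)
      mpure [ffun j : 'I_n.+1 => s`_j ◁ \prod_(i < j) w i (j - i).-1%N].
End HopfCyclic.

(* Main.v *)
Require Import Defs.
From HB Require Import structures.
From mathcomp Require Import all_boot all_order all_algebra.
From mathcomp Require Import reals complex.
From mathcomp Require Import finmap boolp classical_sets.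
From mathcomp.multinomials Require Import monalg.
From mathcomp Require Import zify.

Set Implicit Arguments.
Unset Strict Implicit.
Unset Printing Implicit Defensive.

Import GRing.Theory.
Local Open Scope ring_scope.

(**
The map psi is the iterated Galois map. Its recursive form Psi splits c into
c^(1), which becomes the first factor, and c^(2), on which h_1 acts before the
other h_i are treated in the same way (Psi_cons). It is defined on all of
H^(⊗ n) ⊗ C, with values in the cotensor power (Psi_cotensor), and it is
bijective onto it: the inverse Gam peels off one factor at a time with an
inverse of beta (GamK, PsiK). Contracting the first or the last factor of Psi z
with a functional on the base contracts the factor C of z on the left or on the
right (ap_Psi_l, ap_Psi_r). Hence the cyclic condition on Psi z says that z is
invariant, so Psi restricts to a bijection psi from H^(⊗ n) ⊗ C^D onto the cyclic
cotensor product (psi_bij).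

The operators of the relative module are those of the coalgebra C on its full
tensor powers, where the cocyclic identities are checked on families of vectors;
they preserve the cyclic cotensor product. Transport along psi then gives a
cocyclic structure on the Hopf side which is isomorphic to the relative one, and
what remains is that it has the prescribed operators. For cofaces and
codegeneracies in the middle this follows the recursion of Psi. For the rotation
and the last coface, two facts are combined. The first one is that the coaction
of C^D is characterized by beta (c_<0> ⊗ c_<-1>) = c^(2) ⊗ c^(1)
(beta_coact_pre, coaction_val). The second one is that the antipode cancels the
action on the last factor, so that the last entry S(h_1^(2) ... h_n^(2)) x
produces just c^(n+1) ◁ x (Psi_antipode).

Linear algebra over a field enters through a single consequence of Zorn's lemma,
the existence of a retraction onto any subspace (retraction_ex). It provides
enough linear functionals for the slices (chi ⊗ id) x of a tensor x to determine
it (slice_sep), and membership in cotensor products and in images of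
subspaces is tested on slices. In this form the conditions over the base D
become equalities between endomorphisms of C applied to neighbouring factors
(cotensor_powP, cyc_cotensorP).
*)

(** * Linear maps and retractions *)

Section LinearMaps.
Variable k : fieldType.

Definition mklin (V W : lmodType k) (f : V -> W) (fl : linear f) : {linear V -> W} :=
  HB.pack f (GRing.isLinear.Build k V W _ f fl).

Lemma mklinE (V W : lmodType k) (f : V -> W) (fl : linear f) v :
  mklin fl v = f v.
Proof. by []. Qed.

Lemma lin_id (V : lmodType k) : linear (fun v : V => v).
Proof. by []. Qed.
Lemma lin_comp (U V W : lmodType k) (f : {linear V -> W}) (g : U -> V) :
  linear g -> linear (fun u => f (g u)).
Proof. by move=> gl a u v; rewrite gl linearP. Qed.
Lemma lin_bil1 (U V W X : lmodType k) (b : V -> W -> X) (g : U -> V) w :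
  bilin b -> linear g -> linear (fun u => b (g u) w).
Proof. by move=> [bl _] gl a u v; rewrite gl bl. Qed.
Lemma lin_bil2 (U V W X : lmodType k) (b : W -> V -> X) (g : U -> V) w :
  bilin b -> linear g -> linear (fun u => b w (g u)).
Proof. by move=> [_ br] gl a u v; rewrite gl br. Qed.
Lemma lin_scale2 (U V : lmodType k) (g : U -> V) a :
  linear g -> linear (fun u => a *: g u).
Proof. by move=> gl b x y; rewrite gl scalerDr !scalerA mulrC. Qed.
End LinearMaps.

Section Retraction.
Variables (k : fieldType) (V : lmodType k) (U : subspace V).

Local Open Scope classical_set_scope.
Let closed (A : set V) := forall (a : k) u v, A u -> A v -> A (a *: u + v).

(** By Zorn's lemma: if a maximal subspace M meeting U trivially left a vector
outside of U + M, then adding this vector to M would still give a subspace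
meeting U trivially. *)
Lemma complement_ex : exists M : subspace V,
  (forall v, U v -> M v -> v = 0) /\
  (forall v, exists2 u, U u & M (v - u)).
Proof.
(* P does not ask for 0 in A, so that it holds for the union of the empty chain. *)
pose P (A : set V) := closed A /\ forall v, U v -> A v -> v = 0.
have [F FP Ftot|A [[Ac AU] Amax]] := @Zorn_bigcup V P.
  split=> [a u v [X FX Xu] [Y FY Yv]|v Uv [X FX Xv]]; last exact: (FP _ FX).2 Xv.
  have [XY|YX] := Ftot _ _ FX FY.
    by exists Y => //; apply: (FP _ FY).1 => //; exact: XY.
  by exists X => //; apply: (FP _ FX).1 => //; exact: YX.
have A0 : A 0.
  apply: contrapT => nA0; apply: (Amax [set 0]); last first.
    split=> [a u v /= -> ->|v _ //]; by rewrite scaler0 addr0.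
  split=> [v Av|S0A]; last by apply/nA0/S0A.
  by case: nA0; have := Ac (-1) v v Av Av; rewrite scaleN1r addNr.
have AD u v : A u -> A v -> A (u + v) by move=> Au Av; rewrite -[u]scale1r; exact: Ac.
have AZ a u : A u -> A (a *: u) by move=> Au; rewrite -[_ *: _]addr0; exact: Ac.
exists (Subspace A0 AD AZ); split=> [v|w]; first exact: AU.
apply: contrapT => nw.
have wA : ~ A w by move=> Aw; apply: nw; exists 0; [exact: smem0 | rewrite subr0].
pose B : set V := [set v | exists a, A (v - a *: w)].
have AB : A `<=` B by move=> v Av; exists 0; rewrite scale0r subr0.
apply: (Amax B).
  split=> // BA; apply/wA/BA; exists 1.
  by rewrite scale1r subrr.
split=> [a u v [b Ab] [c Ac']|v Uv [a Aa]].
  exists (a * b + c); rewrite scalerDl opprD addrACA -scalerA -scalerBr; exact: Ac.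
have [a0|a0] := eqVneq a 0; first by apply: AU => //; rewrite a0 scale0r subr0 in Aa.
case: nw; exists (a^-1 *: v); first exact: smemZ.
have -> : w - a^-1 *: v = - a^-1 *: (v - a *: w); last exact: AZ.
by rewrite scalerBr !scalerA mulNr mulVf // scaleN1r opprK scaleNr addrC.
Qed.

(** The projection along a complement; over a field, it stands in for flatness. *)
Lemma retraction_ex : exists p : {linear V -> subvect U}, forall u, p (\val u) = u.
Proof.
have [M [MU VMU]] := complement_ex.
have ex v : exists u : subvect U, M (v - \val u).
  by have [u Uu Mu] := VMU v; exists (insubvect Uu).
pose p v := projT1 (cid (ex v)).
have pM v : M (v - \val (p v)) by rewrite /p; case: cid.
have pE v (u : subvect U) : M (v - \val u) -> p v = u.
  move=> Mu; apply/val_inj/eqP; rewrite -subr_eq0; apply/eqP/MU.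
    by apply: smemD (subvect_mem _) _; apply: smemN (subvect_mem _).
  have -> : \val (p v) - \val u = (v - \val u) - (v - \val (p v)).
    by rewrite opprB [RHS]addrC subrKA.
  by apply: smemD => //; apply: smemN.
have pl : linear p.
  move=> a u v; apply: pE.
  have -> : a *: u + v - \val (a *: p u + p v) =
     a *: (u - \val (p u)) + (v - \val (p v)).
    by rewrite [\val _]linearP opprD addrACA scalerBr.
  by apply: smemD => //; apply: smemZ.
exists (mklin pl) => u; apply: pE; rewrite subrr; exact: smem0.
Qed.

End Retraction.

Section Functional.
Variables (k : fieldType) (V : lmodType k).

Lemma functional_neq0_ex (v : V) : v != 0 -> exists f : {linear V -> k^o}, f v = 1.
Proof.
move=> v0; pose L : subspace V := Defs.span (fun u => u = v).
have LE u : L u -> exists a, u = a *: v.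
  move=> [s sP ->]; exists (\sum_(p <- s) p.1).
  by rewrite scaler_suml big_seq [RHS]big_seq; apply: eq_bigr => p /sP ->.
have [p pK] := retraction_ex L.
have Lv : L v by exact: mem_span.
have cex u : exists a, \val (p u) = a *: v by apply: LE; exact: subvect_mem.
pose c u := projT1 (cid (cex u)).
have cE u : \val (p u) = c u *: v by rewrite /c; case: cid.
have inj a b : a *: v = b *: v -> a = b.
  by move/eqP; rewrite -subr_eq0 -scalerBl scaler_eq0 subr_eq0 (negbTE v0) orbF => /eqP.
have cl : linear (c : V -> k^o).
  by move=> a x y; apply: inj; rewrite -cE (linearP p) (linearP \val); rewrite /= !cE scalerDl scalerA.
exists (mklin cl); apply: inj; rewrite mklinE -cE scale1r.
by rewrite -[v]/(\val (insubvect Lv)) pK.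
Qed.

(** The part of v along a complement of U is nonzero. *)
Lemma functional_ex (U : subspace V) v : ~ U v ->
  exists f : {linear V -> k^o}, (forall u, U u -> f u = 0) /\ f v = 1.
Proof.
move=> nUv; have [p pK] := retraction_ex U.
pose q u := u - \val (p u).
have ql : linear q.
  by move=> a x y; rewrite /q linearP [\val _]linearP opprD addrACA scalerBr.
have [|g gq] := @functional_neq0_ex (q v).
  rewrite subr_eq0; apply/eqP => E; apply: nUv; rewrite E; exact: subvect_mem.
exists (mklin (lin_comp g ql)); split=> // u Uu; rewrite mklinE /q.
by rewrite -[u in p u]/(\val (insubvect Uu)) pK subrr linear0.
Qed.
End Functional.

(** * Sums over tensors *)

(** The linear extension of a bilinear expression; applied to a coproduct it is
a sum in Sweedler's notation. *)
Definition tsum (k : fieldType) (V W X : lmodType k) (x : tensor V W)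
  (f : V -> W -> X) : X := \sum_(p <- terms x) f p.1 p.2.

Notation "\tsum_ ( a , b <- x ) E" := (tsum x (fun a b => E))
  (at level 41, E at level 41, a name, b name, x at level 50,
   format "'[' \tsum_ ( a , b  <-  x ) '/  '  E ']'") : ring_scope.

Section TensorSum.
Variable k : fieldType.
Implicit Types U V W X Y : lmodType k.

Lemma tsum_lin V W X Y (f : V -> W -> X) (g : Y -> tensor V W) :
  bilin f -> linear g -> linear (fun y => tsum (g y) f).
Proof. by move=> fb gl a u v; rewrite gl; exact: sum_terms_linear. Qed.

Lemma tsum_lin_body V W X Y (f : Y -> V -> W -> X) (x : tensor V W) :
  (forall v w, linear (fun y => f y v w)) -> linear (fun y => tsum x (f y)).
Proof. by move=> fl; apply: (@sum_linear _ _ _ _ _ (fun p y => f y p.1 p.2)). Qed.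

Lemma tsumE V W X (f : V -> W -> X) v w : bilin f -> tsum (v ⊗ w) f = f v w.
Proof. by move=> fb; exact: sum_terms_pure. Qed.

Lemma eq_tsum V W X (f g : V -> W -> X) x :
  (forall v w, f v w = g v w) -> tsum x f = tsum x g.
Proof. by move=> fg; apply: eq_bigr => p _. Qed.

Lemma tsum_pure V W (x : tensor V W) : \tsum_(a, b <- x) a ⊗ b = x.
Proof. exact: termsE. Qed.

Lemma linear_tsum V W X Y (F : {linear X -> Y}) (f : V -> W -> X) x :
  F (tsum x f) = \tsum_(a, b <- x) F (f a b).
Proof. by rewrite /tsum linear_sum. Qed.

Lemma lin_tsum V W X Y (F : X -> Y) (f : V -> W -> X) x : linear F ->
  F (tsum x f) = \tsum_(a, b <- x) F (f a b).
Proof. by move=> Fl; exact: (linear_tsum (mklin Fl)). Qed.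

Lemma tsum_sum V W X (I : Type) (s : seq I) (F : I -> V -> W -> X) (x : tensor V W) :
  \tsum_(a, b <- x) (\sum_(i <- s) F i a b) = \sum_(i <- s) \tsum_(a, b <- x) F i a b.
Proof. by rewrite /tsum exchange_big. Qed.

Lemma exchange_tsum V W V' W' X (x : tensor V W) (y : tensor V' W')
    (f : V -> W -> V' -> W' -> X) :
  \tsum_(a, b <- x) \tsum_(c, d <- y) f a b c d =
  \tsum_(c, d <- y) \tsum_(a, b <- x) f a b c d.
Proof. by rewrite /tsum exchange_big. Qed.

Lemma linD V W (F : V -> W) u v : linear F -> F (u + v) = F u + F v.
Proof. by move=> Fl; exact: (linearD (mklin Fl)). Qed.
Lemma linZ V W (F : V -> W) a v : linear F -> F (a *: v) = a *: F v.
Proof. by move=> Fl; exact: (linearZ_LR (mklin Fl)). Qed.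

Lemma tensor_ext V W X (F G : tensor V W -> X) : linear F -> linear G ->
  (forall v w, F (v ⊗ w) = G (v ⊗ w)) -> forall x, F x = G x.
Proof.
move=> Fl Gl FG; elim/tensor_ind => [//|x y Fx Fy].
by rewrite !linD // Fx Fy.
Qed.

Lemma lin_comp_fun U V W (f : V -> W) (g : U -> V) :
  linear f -> linear g -> linear (fun u => f (g u)).
Proof. by move=> fl gl a u v; rewrite gl fl. Qed.

Lemma mul_bilin (A : algType k) : bilin (fun x y : A => x * y).
Proof.
split=> [w a u v|w a u v]; first by rewrite mulrDl scalerAl.
by rewrite mulrDr scalerAr.
Qed.

Lemma scale_bilin V : bilin (fun (a : k^o) (v : V) => (a : k) *: v).
Proof.
split=> [w a u v|w a u v]; first by rewrite scalerDl scalerA.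
by rewrite scalerDr !scalerA mulrC.
Qed.

Lemma lin_add U V (f g : U -> V) : linear f -> linear g -> linear (fun u => f u + g u).
Proof. by move=> fl gl a u v; rewrite fl gl scalerDr addrACA. Qed.
Lemma lin_sub U V (f g : U -> V) : linear f -> linear g -> linear (fun u => f u - g u).
Proof. by move=> fl gl a u v; rewrite fl gl scalerBr opprD addrACA. Qed.
End TensorSum.

(** Extended below to further multilinear constructions. *)
Ltac lin_hook := fail.

(** Linearity or bilinearity of an expression, by following its structure. *)
Ltac lin :=
  cbv beta;
  match goal with
  | |- @bilin _ _ _ _ _ => first
      [ exact: pure_bilin | exact: mul_bilin | exact: ract_bilin
      | split=> ?; lin ]
  | |- @GRing.linear_for _ _ _ _ ?f => first
    [ exact: lin_id | assumption | exact: linearP | lin_hook |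
    lazymatch f with
    | (fun x => pure (@?A x) (@?B x)) => first
       [ apply: (@lin_bil1 _ _ _ _ _ _ A _ (@pure_bilin _ _ _)) | apply: (@lin_bil2 _ _ _ _ _ _ B _ (@pure_bilin _ _ _)) ]; lin
    | (fun x => ract (@?A x) (@?B x)) => first
       [ apply: (@lin_bil1 _ _ _ _ _ _ A _ (@ract_bilin _ _ _)) | apply: (@lin_bil2 _ _ _ _ _ _ B _ (@ract_bilin _ _ _)) ]; lin
    | (fun x => GRing.mul (@?A x) (@?B x)) => first
       [ apply: (@lin_bil1 _ _ _ _ _ _ A _ (@mul_bilin _ _)) | apply: (@lin_bil2 _ _ _ _ _ _ B _ (@mul_bilin _ _)) ]; lin
    | (fun x => tsum (@?A x) (@?B x)) => first
       [ apply: (@tsum_lin _ _ _ _ _ _ A); lin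
       | apply: (@tsum_lin_body _ _ _ _ _ B _) => ? ?; lin ]
    | (fun x => GRing.scale (@?A x) (@?B x)) => first
       [ apply: (@lin_scale2 _ _ _ B _)
       | apply: (@lin_bil1 _ _ _ _ _ _ A _ (@scale_bilin _ _)) ]; lin
    | (fun x => GRing.add (@?A x) (GRing.opp (@?B x))) => apply: (@lin_sub _ _ _ A B); lin
    | (fun x => GRing.add (@?A x) (@?B x)) => apply: (@lin_add _ _ _ A B); lin
    | (fun x => ?F (@?A x)) => apply: (@lin_comp_fun _ _ _ _ F A); [first [exact: linearP | assumption] | lin]
    | (fun x => _) => fail
    | _ => change (linear (fun x => f x)); lin
    end ]
  | |- forall _, _ => move=> ?; lin
  | _ => idtac
  end.

Section Slices.
Variable k : fieldType.
Implicit Types U V W X Y : lmodType k.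

Definition tmap V W V' W' (f : {linear V -> V'}) (g : {linear W -> W'})
  (x : tensor V W) : tensor V' W' := \tsum_(a, b <- x) f a ⊗ g b.

Lemma tmap_linear V W V' W' (f : {linear V -> V'}) (g : {linear W -> W'}) :
  linear (tmap f g).
Proof. by rewrite /tmap; lin. Qed.
HB.instance Definition _ V W V' W' (f : {linear V -> V'}) (g : {linear W -> W'}) :=
  GRing.isLinear.Build k (tensor V W) (tensor V' W') _ (tmap f g) (tmap_linear f g).

Lemma tmapE V W V' W' (f : {linear V -> V'}) (g : {linear W -> W'}) v w :
  tmap f g (v ⊗ w) = f v ⊗ g w.
Proof. by rewrite /tmap tsumE //; lin. Qed.

Definition slice V W (chi : {linear V -> k^o}) (x : tensor V W) : W :=
  \tsum_(a, b <- x) (chi a : k) *: b.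

Lemma slice_linear V W (chi : {linear V -> k^o}) : linear (@slice V W chi).
Proof. by rewrite /slice; lin. Qed.
HB.instance Definition _ V W (chi : {linear V -> k^o}) :=
  GRing.isLinear.Build k (tensor V W) W _ (slice chi) (@slice_linear V W chi).

Lemma sliceE V W (chi : {linear V -> k^o}) v w :
  @slice V W chi (v ⊗ w) = (chi v : k) *: w.
Proof. by rewrite /slice tsumE //; lin. Qed.

Lemma slice_map V W W' (chi : {linear V -> k^o}) (f : {linear W -> W'}) x :
  slice chi (tmap idfun f x) = f (slice chi x).
Proof.
move: x; apply: tensor_ext; [by lin|by lin|] => v w.
by rewrite tmapE !sliceE linearZ.
Qed.

(** By induction on the length of an expression of the tensor as a sum of pure
tensors: either the last left factor depends linearly on the others, and the
expression can be shortened, or some functional is 1 on it and 0 on the others,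
so that the last right factor is 0. *)
Lemma slice_sep0 V W (x : tensor V W) : (forall chi, slice chi x = 0) -> x = 0.
Proof.
have sepn n (v : 'I_n -> V) (w : 'I_n -> W) :
    (forall chi, slice chi (\sum_i v i ⊗ w i) = 0) -> \sum_i v i ⊗ w i = 0.
  elim: n v w => [|n IHn] v w chi0; first by rewrite big_ord0.
  pose comb (u : V) := exists a : 'I_n -> k, u = \sum_i a i *: v (widen_ord (leqnSn n) i).
  have comb0 : comb 0.
    by exists (fun=> 0); rewrite big1 // => i _; rewrite scale0r.
  have combD u u' : comb u -> comb u' -> comb (u + u').
    move=> [a ->] [b ->]; exists (fun i => a i + b i).
    by rewrite -big_split; apply: eq_bigr => i _; rewrite scalerDl.
  have combZ b u : comb u -> comb (b *: u).
    move=> [a ->]; exists (fun i => b * a i).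
    by rewrite scaler_sumr; apply: eq_bigr => i _; rewrite scalerA.
  pose U := Subspace comb0 combD combZ.
  have [[a vE]|nU] := pselect (U (v ord_max)).
    pose w' i := w (widen_ord (leqnSn n) i) + a i *: w ord_max.
    have E : \sum_i v i ⊗ w i = \sum_i v (widen_ord (leqnSn n) i) ⊗ w' i.
      rewrite big_ord_recr /= vE.
      have -> : (\sum_i a i *: v (widen_ord (leqnSn n) i)) ⊗ w ord_max =
          \sum_i (a i *: v (widen_ord (leqnSn n) i)) ⊗ w ord_max.
        exact: (linear_sum (mklin (pure_linearl (w ord_max)))).
      rewrite -big_split; apply: eq_bigr => i _ /=.
      by rewrite (bilinDr (@pure_bilin _ _ _)) (bilinZr (@pure_bilin _ _ _))
        (bilinZl (@pure_bilin _ _ _)).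
    by rewrite E; apply: IHn => chi; rewrite -E.
  have [chi [chiU chi1]] := functional_ex nU.
  have w0 : w ord_max = 0.
    have := chi0 chi; rewrite big_ord_recr linearD linear_sum big1 /= => [|i _].
      by rewrite add0r sliceE chi1 scale1r.
    rewrite sliceE chiU ?scale0r //; exists (fun j => (j == i)%:R).
    rewrite (bigD1 i) //= eqxx scale1r big1 ?addr0 // => j /negbTE->.
    by rewrite scale0r.
  have p0 : v ord_max ⊗ w ord_max = 0 by rewrite w0 (bilin0r (@pure_bilin _ _ _)).
  move: chi0; rewrite big_ord_recr /= p0 addr0; exact: IHn.
rewrite -[x]termsE (big_nth (0, 0)) big_mkord; exact: sepn.
Qed.

Lemma slice_sep V W (x y : tensor V W) :
  (forall chi, slice chi x = slice chi y) -> x = y.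
Proof.
move=> E; apply/eqP; rewrite -subr_eq0; apply/eqP/slice_sep0 => chi.
by rewrite linearB /= E subrr.
Qed.

(** Slices separate tensors, and p fixes each slice of x. *)
Lemma slice_sub V W (U : subspace W) (p : {linear W -> subvect U}) (x : tensor V W) :
  (forall u, p (\val u) = u) -> (forall chi, U (slice chi x)) ->
  tmap idfun \val (tmap idfun p x) = x.
Proof.
move=> pK xU; apply: slice_sep => chi; rewrite !slice_map.
by have := pK (insubvect (xU chi)) => /= ->.
Qed.
End Slices.

(** * Tensor powers *)

Section TensorPowers.
Variables (k : fieldType) (V : lmodType k).

(** Families indexed by all natural numbers, of which a tensor power only sees
an initial segment, make shifts and insertions free of casts between ordinals. *)
Definition mp n (f : nat -> V) : tpow V n := mpure [ffun j : 'I_n => f j].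

Definition ext n (t : {ffun 'I_n -> V}) (j : nat) : V := oapp t 0 (insub j).

Lemma ext_ord n (t : {ffun 'I_n -> V}) (i : 'I_n) : ext t i = t i.
Proof. by rewrite /ext valK. Qed.

Lemma mpureE n (t : {ffun 'I_n -> V}) : mpure t = mp n (ext t).
Proof. by congr mpure; apply/ffunP => i; rewrite ffunE ext_ord. Qed.

Lemma eq_mp n (f g : nat -> V) : (forall j, (j < n)%N -> f j = g j) -> mp n f = mp n g.
Proof. by move=> fg; congr mpure; apply/ffunP => i; rewrite !ffunE fg. Qed.

Definition setf (f : nat -> V) i v (j : nat) := if j == i then v else f j.

Lemma mp_lin (U : lmodType k) n i (F : U -> nat -> V) : (i < n)%N ->
  linear (fun u => F u i) ->
  (forall u u' j, (j < n)%N -> j != i -> F u j = F u' j) ->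
  linear (fun u => mp n (F u)).
Proof.
move=> ltin Fl Fc; pose t := [ffun j : 'I_n => F 0 j]; pose o := Ordinal ltin.
have E u : mp n (F u) = mpure (upd t o (F u i)).
  congr mpure; apply/ffunP => j; rewrite !ffunE; case: eqVneq => [->//|ji].
  by apply: Fc => //; apply: contra ji => /eqP ji; apply/eqP/val_inj.
by move=> a u v; rewrite !E Fl; exact: mpure_multilin.
Qed.

Lemma tpow_ext (X : lmodType k) n (F G : tpow V n -> X) : linear F -> linear G ->
  (forall f, F (mp n f) = G (mp n f)) -> forall x, F x = G x.
Proof.
move=> Fl Gl FG x; pose q : {linear _ -> tpow V n} := qclass (Defs.span (@multilin_rel k V n)).
have xE : x = \sum_(t <- msupp (repr x)) (repr x)@_t *: mpure t.
  transitivity (q (repr x)); first by rewrite [RHS]qclassK.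
  rewrite [in LHS](monalgEw (fsubset_refl (msupp (repr x)))).
  rewrite (linear_sum q) /=; apply: eq_bigr => t _.
  rewrite mpure.unlock -[RHS](linearZ_LR q); congr (q _).
  by apply/malgP => t'; rewrite mcoeffZ !mcoeffU mulrnAr mulr1.
have S (H : tpow V n -> X) (Hl : linear H) :
    H x = \sum_(t <- msupp (repr x)) (repr x)@_t *: H (mpure t).
  rewrite {1}xE -[LHS]/(mklin Hl _) linear_sum; apply: eq_bigr => t _.
  by rewrite linearZ_LR.
by rewrite !S //; apply: eq_bigr => t _; rewrite mpureE FG.
Qed.

(** The hypothesis under which g extends to the tensor power. As g takes infinite
families, it includes that only the first n vectors matter. *)
Definition mlin (X : lmodType k) n (g : (nat -> V) -> X) :=
  (forall f f', (forall j, (j < n)%N -> f j = f' j) -> g f = g f') /\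
  (forall f i, (i < n)%N -> linear (fun v => g (setf f i v))).

Definition nlift (X : lmodType k) n (g : (nat -> V) -> X) (x : tpow V n) : X :=
  mlift (fun t => g (ext t)) x.

Lemma mlin_multilin (X : lmodType k) n (g : (nat -> V) -> X) :
  mlin n g -> multilin (fun t : {ffun 'I_n -> V} => g (ext t)).
Proof.
move=> [_ gl] t i a u v.
have E w : ext (upd t i w) = setf (ext t) i w.
  apply/funext => j; rewrite /setf; have [ji|] := eqVneq j i.
    by rewrite ji ext_ord ffunE eqxx.
  move=> ji; rewrite /ext; case: insubP => //= l _ lj; rewrite ffunE.
  by case: eqVneq => // li; move: ji; rewrite -lj li eqxx.
by rewrite !E gl.
Qed.

Lemma nlift_linear (X : lmodType k) n (g : (nat -> V) -> X) :
  mlin n g -> linear (@nlift X n g).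
Proof. by move=> gm; apply/mlift_linear/mlin_multilin. Qed.

Lemma nliftE (X : lmodType k) n (g : (nat -> V) -> X) f :
  mlin n g -> @nlift X n g (mp n f) = g f.
Proof.
move=> gm; rewrite /nlift mlift_mpure; last exact: mlin_multilin.
apply: gm.1 => j jn; rewrite -[j]/(val (Ordinal jn)).
by rewrite ext_ord ffunE.
Qed.

(** Multilinearity of g comes for free, g being the composite of F with mpure. *)
Lemma mlift_eq (X : lmodType k) n (F : {linear tpow V n -> X}) g x :
  (forall t, g t = F (mpure t)) -> mlift g x = F x.
Proof.
move=> gF; rewrite (_ : g = fun t => F (mpure t)); last exact/funext.
have m : multilin (fun t => F (mpure t)).
  by move=> t i a u v; rewrite mpure_multilin linearP.
have ml := mlift_linear m.
move: x; apply: tpow_ext; [exact: ml | by lin | by move=> f; rewrite mlift_mpure].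
Qed.

Definition consf (v : V) (f : nat -> V) (j : nat) : V := if j is j'.+1 then f j' else v.

Lemma tcons_mlin n v : mlin n (fun f => mp n.+1 (consf v f)).
Proof.
split=> [f f' ff|f i ltin]; first by apply: eq_mp => -[|j] //= /ff.
apply: (@mp_lin _ _ i.+1) => //= [|u u' [|j] //= _ ji].
  by rewrite /setf eqxx; exact: lin_id.
by rewrite /setf; have -> : (j == i) = false by lia.
Qed.

(** With its inverse uncons, this identifies a tensor power with V ⊗ the previous
one; recursions on tensor powers go through it. *)
Definition tcons n (v : V) : tpow V n -> tpow V n.+1 :=
  nlift (fun f => mp n.+1 (consf v f)).

Lemma tcons_mp n v f : tcons v (mp n f) = mp n.+1 (consf v f).
Proof. exact/nliftE/tcons_mlin. Qed.

Lemma tcons_linear n v : linear (@tcons n v).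
Proof. exact/nlift_linear/tcons_mlin. Qed.
HB.instance Definition _ n v :=
  GRing.isLinear.Build k (tpow V n) _ _ (@tcons n v) (@tcons_linear n v).

Lemma tcons_bilin n : bilin (@tcons n).
Proof.
split=> [x|v]; last exact: tcons_linear.
move=> a u v; move: x; apply: tpow_ext; [by lin | by lin | move=> f].
rewrite !tcons_mp; move: a u v.
by apply: (@mp_lin _ _ 0) => //= u u' [].
Qed.

Lemma uncons_mlin n : mlin n.+1 (fun f => f 0%N ⊗ mp n (fun j => f j.+1)).
Proof.
split=> [f f' ff|f [|i] ltin].
- by rewrite ff //; congr (_ ⊗ _); apply: eq_mp => j ltj; exact: ff.
- by rewrite /setf /=; lin.
- rewrite /setf /=; apply: (lin_bil2 _ (@pure_bilin _ _ _)).
  apply: (@mp_lin _ _ i) => // [|u u' j _ ji]; first by rewrite eqxx; exact: lin_id.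
  by have -> : (j.+1 == i.+1) = false by lia.
Qed.

Definition uncons n : tpow V n.+1 -> tensor V (tpow V n) :=
  nlift (fun f => f 0%N ⊗ mp n (fun j => f j.+1)).

Lemma uncons_mp n f : uncons (mp n.+1 f) = f 0%N ⊗ mp n (fun j => f j.+1).
Proof. exact/nliftE/uncons_mlin. Qed.

Lemma uncons_linear n : linear (@uncons n).
Proof. exact/nlift_linear/uncons_mlin. Qed.
HB.instance Definition _ n :=
  GRing.isLinear.Build k (tpow V n.+1) _ _ (@uncons n) (@uncons_linear n).

Lemma uncons_tcons n v (x : tpow V n) : uncons (tcons v x) = v ⊗ x.
Proof.
by move: x; apply: tpow_ext; [by lin | by lin | move=> f]; rewrite tcons_mp uncons_mp.
Qed.

End TensorPowers.

Ltac lin_hook ::=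
  match goal with
  | |- @bilin _ _ _ _ _ => exact: tcons_bilin
  | |- @GRing.linear_for _ _ _ _ (fun x => tcons (@?A x) (@?B x)) => first
       [ apply: (@lin_bil1 _ _ _ _ _ _ A _ (@tcons_bilin _ _ _))
       | apply: (@lin_bil2 _ _ _ _ _ _ B _ (@tcons_bilin _ _ _)) ]; lin
  end.

Section TensorPowers2.
Variables (k : fieldType) (V : lmodType k).

Lemma mp_cons n (f : nat -> V) : mp n.+1 f = tcons (f 0%N) (mp n (fun j => f j.+1)).
Proof. by rewrite tcons_mp; apply: eq_mp => -[]. Qed.

Lemma tcons_uncons n (x : tpow V n.+1) : \tsum_(v, y <- uncons x) tcons v y = x.
Proof.
move: x; apply: tpow_ext; [by lin | by lin | move=> f].
by rewrite uncons_mp tsumE ?mp_cons //; lin.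
Qed.

Lemma tpow_cons_ext (X : lmodType k) n (F G : tpow V n.+1 -> X) : linear F -> linear G ->
  (forall v x, F (tcons v x) = G (tcons v x)) -> forall x, F x = G x.
Proof.
by move=> Fl Gl FG; apply: tpow_ext => // f; rewrite mp_cons FG.
Qed.
End TensorPowers2.

(** * The cocyclic operators of a coalgebra on all tensor powers *)

(** Case analysis on comparisons of indices; the cases that are impossible or
equate entries of equal index are closed by arithmetic. *)
Ltac ifs :=
  repeat match goal with
  | |- context [if ?b then _ else _] =>
      lazymatch b with
      | context [if _ then _ else _] => fail
      | _ => let E := fresh "E" in destruct b eqn:E
      end
  end;
  try first [ reflexivity | exfalso; lia | congr (_ _); lia
            | do 2 apply: congr1; lia ].

Section Sweedler.
Variables (k : fieldType) (C : coalgType k).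
Implicit Types X : lmodType k.

Lemma tsum_coassoc X (f : C -> C -> C -> X) c : trilin f ->
  \tsum_(a, b <- comul c) \tsum_(x, y <- comul a) f x y b =
  \tsum_(a, b <- comul c) \tsum_(x, y <- comul b) f a x y.
Proof. exact: sw_assoc. Qed.

Lemma tsum_counitl X (F : C -> X) c : linear F ->
  \tsum_(a, b <- comul c) (counit a : k) *: F b = F c.
Proof.
by move=> Fl; rewrite -[in RHS](comul_counitl c) -[RHS]/(mklin Fl _) linear_sum;
  apply: eq_bigr => p _; rewrite linearZ_LR.
Qed.

Lemma tsum_counitr X (F : C -> X) c : linear F ->
  \tsum_(a, b <- comul c) (counit b : k) *: F a = F c.
Proof.
by move=> Fl; rewrite -[in RHS](comul_counitr c) -[RHS]/(mklin Fl _) linear_sum;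
  apply: eq_bigr => p _; rewrite linearZ_LR.
Qed.
End Sweedler.

Section CoalgebraCocyclic.
Variables (k : fieldType) (C : coalgType k).
Implicit Types (f : nat -> C) (n i j : nat).

Definition ins2 i (a b : C) f j : C :=
  if (j < i)%N then f j else if j == i then a else if j == i.+1 then b else f j.-1.
Definition rmf i f j : C := if (j < i)%N then f j else f j.+1.
Definition rotf n f j : C := if (j < n)%N then f j.+1 else f 0%N.
Definition apf i (F : C -> C) f j : C := if j == i then F (f j) else f j.

Lemma ins2_bilin n i f : (i < n)%N -> bilin (fun a b => mp n.+1 (ins2 i a b f)).
Proof.
move=> ltin; split=> [b|a].
  apply: (@mp_lin _ _ _ _ i); [lia| |move=> u v j _ ji; rewrite /ins2; ifs].
  by rewrite /ins2 ltnn eqxx; lin.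
apply: (@mp_lin _ _ _ _ i.+1); [lia| |move=> u v j _ ji; rewrite /ins2; ifs].
by rewrite /ins2 ltnNge leqnSn eqxx /=; have -> : (i.+1 == i) = false by lia; lin.
Qed.

Lemma setf_slot n (G : C -> nat -> C) i : (i < n)%N ->
  linear (fun u => G u i) ->
  (forall u j, (j < n)%N -> j != i -> G u j = G 0 j) -> linear (fun u => mp n (G u)).
Proof.
move=> ltin Gl Gc; apply: (mp_lin ltin Gl) => u v j ltj ji.
by rewrite Gc // [RHS]Gc.
Qed.

Lemma face_mlin n i : (i < n)%N ->
  mlin n (fun f => \tsum_(a, b <- comul (f i)) mp n.+1 (ins2 i a b f)).
Proof.
move=> ltin; split=> [f f' ff|f l ltl].
  rewrite ff //; apply: eq_tsum => a b; apply: eq_mp => j ltj.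
  by rewrite /ins2; case: ltnP => ji; [|case: eqP => // ?; case: eqP => // ?];
    apply: ff; lia.
have [<-{i ltin}|li] := eqVneq l i.
  rewrite (_ : (fun v => _) = fun v => \tsum_(a, b <- comul v) mp n.+1 (ins2 l a b f)).
    by apply: tsum_lin; [exact: ins2_bilin | lin].
  apply/funext => v; rewrite /setf eqxx; apply: eq_tsum => a b; apply: eq_mp => j _.
  by rewrite /ins2; ifs.
rewrite (_ : (fun v => _) = fun v => \tsum_(a, b <- comul (f i))
    mp n.+1 (ins2 i a b (setf f l v))); last first.
  by apply/funext => v; rewrite {1}/setf eq_sym (negbTE li).
apply: tsum_lin_body => a b.
apply: (@setf_slot _ _ (if (l < i)%N then l else l.+1)); rewrite /ins2 /setf.
- by ifs; lia.
- by case: (ltnP l i) => il; ifs; try lia; lin.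
- by move=> u j; ifs; move=> *; ifs.
Qed.

(** The value 0 out of range keeps the operator linear, and stabilizing subspaces,
for all i. *)
Definition face n i (x : tpow C n.+1) : tpow C n.+2 :=
  if (i <= n)%N then
    nlift (fun f => \tsum_(a, b <- comul (f i)) mp n.+2 (ins2 i a b f)) x
  else 0.

Fact face_linear n i : linear (@face n i).
Proof.
rewrite /face; case: leqP => ni; first exact/nlift_linear/face_mlin.
by move=> a u v; rewrite scaler0 addr0.
Qed.
HB.instance Definition _ n i :=
  GRing.isLinear.Build k (tpow C n.+1) _ _ (@face n i) (@face_linear n i).

Lemma face_mp n i f : (i <= n)%N ->
  face i (mp n.+1 f) = \tsum_(a, b <- comul (f i)) mp n.+2 (ins2 i a b f).
Proof. by move=> ni; rewrite /face ni nliftE //; exact: face_mlin. Qed.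

Lemma degen_mlin n i : (i < n.+1)%N ->
  mlin n.+1 (fun f => (counit (f i) : k) *: mp n (rmf i f)).
Proof.
move=> ltin; split=> [f f' ff|f l ltl].
  rewrite ff //; congr (_ *: _); apply: eq_mp => j ltj.
  by rewrite /rmf; case: ltnP => _; apply: ff; lia.
have [<-{i ltin}|li] := eqVneq l i.
  rewrite (_ : (fun v => _) = fun v => (counit v : k) *: mp n (rmf l f)).
    by lin.
  apply/funext => v; rewrite /setf eqxx; congr (_ *: _); apply: eq_mp => j _.
  by rewrite /rmf; ifs.
rewrite (_ : (fun v => _) = fun v => (counit (f i) : k) *: mp n (rmf i (setf f l v))); last first.
  by apply/funext => v; rewrite {1}/setf eq_sym (negbTE li).
apply: lin_scale2.
apply: (@setf_slot _ _ (if (l < i)%N then l else l.-1)); rewrite /rmf /setf.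
- by ifs; lia.
- by case: (ltnP l i) => il; ifs; try lia; lin.
- by move=> u j; ifs; move=> *; ifs.
Qed.

(** The operator s_i removes the factor of index i+1. *)
Definition degen n i (x : tpow C n.+2) : tpow C n.+1 :=
  if (i <= n)%N then
    nlift (fun f => (counit (f i.+1) : k) *: mp n.+1 (rmf i.+1 f)) x
  else 0.

Fact degen_linear n i : linear (@degen n i).
Proof.
rewrite /degen; case: leqP => ni; first exact/nlift_linear/degen_mlin.
by move=> a u v; rewrite scaler0 addr0.
Qed.
HB.instance Definition _ n i :=
  GRing.isLinear.Build k (tpow C n.+2) _ _ (@degen n i) (@degen_linear n i).

Lemma degen_mp n i f : (i <= n)%N ->
  degen i (mp n.+2 f) = (counit (f i.+1) : k) *: mp n.+1 (rmf i.+1 f).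
Proof. by move=> ni; rewrite /degen ni nliftE //; exact: degen_mlin. Qed.

Lemma rot_mlin n : mlin n.+1 (fun f => mp n.+1 (rotf n f)).
Proof.
split=> [f f' ff|f l ltl].
  by apply: eq_mp => j ltj; rewrite /rotf; case: ltnP => jn; apply: ff.
apply: (@setf_slot _ _ (if l == 0%N then n else l.-1)); rewrite /rotf /setf.
- by ifs; lia.
- by ifs; try lia; lin.
- by move=> u j; ifs; move=> *; ifs.
Qed.

Definition tcyc n : tpow C n.+1 -> tpow C n.+1 :=
  nlift (fun f => mp n.+1 (rotf n f)).

Fact tcyc_linear n : linear (@tcyc n).
Proof. exact/nlift_linear/rot_mlin. Qed.
HB.instance Definition _ n :=
  GRing.isLinear.Build k (tpow C n.+1) _ _ (@tcyc n) (@tcyc_linear n).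

Lemma tcyc_mp n f : tcyc (mp n.+1 f) = mp n.+1 (rotf n f).
Proof. exact/nliftE/rot_mlin. Qed.

Lemma apf_mlin n i (F : {linear C -> C}) : mlin n (fun f => mp n (apf i F f)).
Proof.
split=> [f f' ff|f l ltl].
  by apply: eq_mp => j ltj; rewrite /apf ff.
apply: (@setf_slot _ _ l) => //; rewrite /apf /setf.
- by rewrite eqxx; ifs; lin.
- by move=> u j; ifs.
Qed.

Definition ap n i (F : {linear C -> C}) : tpow C n -> tpow C n :=
  nlift (fun f => mp n (apf i F f)).

Fact ap_linear n i F : linear (@ap n i F).
Proof. exact/nlift_linear/apf_mlin. Qed.
HB.instance Definition _ n i F :=
  GRing.isLinear.Build k (tpow C n) _ _ (@ap n i F) (@ap_linear n i F).

Lemma ap_mp n i F f : ap i F (mp n f) = mp n (apf i F f).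
Proof. exact/nliftE/apf_mlin. Qed.

End CoalgebraCocyclic.

Section CoalgebraIdentities.
Variables (k : fieldType) (C : coalgType k).
Implicit Types (f : nat -> C) (n i j : nat).

Ltac fam := apply: eq_mp => ? ?; rewrite /ins2 /rmf /rotf /apf /=; ifs.
Ltac on_mp f := apply: tpow_ext; [by lin | by lin | move=> f].

(** The entry of index i of the inner family is hidden by the outer one; c is put
there as an arbitrary value. *)
Lemma ins3_trilin n i f : (i <= n)%N ->
  trilin (fun a b c => mp n.+3 (ins2 i a b (ins2 i c c f))).
Proof.
move=> ltin; split=> [b c|a c|a b].
- apply: (@setf_slot _ _ _ _ i); rewrite /ins2; [lia| |by move=> u j *; ifs].
  by ifs; try lia; lin.
- apply: (@setf_slot _ _ _ _ i.+1); rewrite /ins2; [lia| |by move=> u j *; ifs].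
  by ifs; try lia; lin.
- apply: (@setf_slot _ _ _ _ i.+2); rewrite /ins2; [lia| |by move=> u j *; ifs].
  by ifs; try lia; lin.
Qed.

(** Coassociativity if j = i + 1; otherwise the two coproducts are those of
different factors. *)
Lemma face_face n i j (x : tpow C n.+1) : (i < j <= n.+1)%N ->
  face j (face i x) = face i (face j.-1 x).
Proof.
move=> ij; move: x; on_mp f.
rewrite !face_mp ?linear_tsum; try lia.
have [->|ji] := eqVneq j i.+1.
  transitivity (\tsum_(a, b <- comul (f i)) \tsum_(x, y <- comul b)
      mp n.+3 (ins2 i a x (ins2 i y y f))).
    apply: eq_tsum => a b /=; rewrite face_mp; last by lia.
    have -> : ins2 i a b f i.+1 = b by rewrite /ins2; ifs.
    by apply: eq_tsum => x y; fam.
  rewrite -tsum_coassoc; last by apply: ins3_trilin; lia.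
  apply: eq_tsum => a b /=; rewrite face_mp; last by lia.
  have -> : ins2 i a b f i = a by rewrite /ins2 ltnn eqxx.
  by apply: eq_tsum => x y; fam.
transitivity (\tsum_(a, b <- comul (f i)) \tsum_(x, y <- comul (f j.-1))
    mp n.+3 (ins2 j x y (ins2 i a b f))).
  apply: eq_tsum => a b /=; rewrite face_mp; last by lia.
  have -> : ins2 i a b f j = f j.-1 by rewrite /ins2; ifs.
  by [].
rewrite exchange_tsum; apply: eq_tsum => x y /=; rewrite face_mp; last by lia.
have -> : ins2 j.-1 x y f i = f i by rewrite /ins2; ifs.
by apply: eq_tsum => a b; fam.
Qed.

Lemma degen_degen n i j (x : tpow C n.+3) : (i <= j <= n)%N ->
  degen j (degen i x) = degen i (degen j.+1 x).
Proof.
move=> ij; move: x; on_mp f.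
rewrite !degen_mp ?linearZ_LR /= ?degen_mp ?scalerA; try lia.
rewrite mulrC; congr (_ * _ *: _); last by fam.
- by rewrite /rmf; ifs.
- by rewrite /rmf; ifs.
Qed.

Lemma degen_face_lt n i j (x : tpow C n.+2) : (i < j <= n.+1)%N ->
  degen j (face i x) = face i (degen j.-1 x).
Proof.
move=> ij; move: x; on_mp f.
rewrite face_mp ?degen_mp ?linear_tsum ?linearZ_LR /= ?face_mp; try lia.
rewrite [RHS](linear_tsum (mklin (lin_scale2 (counit (f j.-1.+1) : k) (@lin_id _ _)))) /=.
have -> : rmf j.-1.+1 f i = f i by rewrite /rmf; ifs.
apply: eq_tsum => a b /=; rewrite degen_mp ?mklinE; try lia.
by congr (_ *: _); [rewrite /ins2; ifs | fam].
Qed.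

Lemma degen_face_id n i j (x : tpow C n.+1) : (i <= n)%N -> (j <= n)%N ->
  (i == j) || (i == j.+1) -> degen j (face i x) = x.
Proof.
move=> lti ltj ij; move: x; on_mp f.
rewrite face_mp ?linear_tsum; try lia.
case/orP: ij => /eqP ij.
  transitivity (\tsum_(a, b <- comul (f i)) (counit b : k) *: mp n.+1 (setf f i a)).
    apply: eq_tsum => a b /=; rewrite degen_mp; try lia.
    by congr (_ *: _); [rewrite /ins2; ifs | rewrite /setf; fam].
  rewrite (@tsum_counitr _ _ _ (fun a => mp n.+1 (setf f i a))).
    by rewrite /setf; fam.
  by apply: (@setf_slot _ _ _ _ i); rewrite /setf // ?eqxx; [lin | move=> u l *; ifs].
transitivity (\tsum_(a, b <- comul (f i)) (counit a : k) *: mp n.+1 (setf f i b)).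
  apply: eq_tsum => a b /=; rewrite degen_mp; try lia.
  by congr (_ *: _); [rewrite /ins2; ifs | rewrite /setf; fam].
rewrite (@tsum_counitl _ _ _ (fun a => mp n.+1 (setf f i a))).
  by rewrite /setf; fam.
by apply: (@setf_slot _ _ _ _ i); rewrite /setf // ?eqxx; [lin | move=> u l *; ifs].
Qed.

Lemma degen_face_gt n i j (x : tpow C n.+2) : (j.+1 < i <= n.+1)%N ->
  degen j (face i x) = face i.-1 (degen j x).
Proof.
move=> ij; move: x; on_mp f.
rewrite face_mp ?degen_mp ?linear_tsum ?linearZ_LR /= ?face_mp; try lia.
rewrite [RHS](linear_tsum (mklin (lin_scale2 (counit (f j.+1) : k) (@lin_id _ _)))) /=.
have -> : rmf j.+1 f i.-1 = f i by rewrite /rmf; ifs.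
apply: eq_tsum => a b /=; rewrite degen_mp ?mklinE; try lia.
by congr (_ *: _); [rewrite /ins2; ifs | fam].
Qed.

Lemma tcyc_face n i (x : tpow C n.+1) : (0 < i <= n)%N ->
  tcyc (face i x) = face i.-1 (tcyc x).
Proof.
move=> ij; move: x; on_mp f.
rewrite tcyc_mp !face_mp ?linear_tsum; try lia.
have -> : rotf n f i.-1 = f i by rewrite /rotf; ifs.
by apply: eq_tsum => a b /=; rewrite tcyc_mp; fam.
Qed.

Lemma tcyc2_face0 n (x : tpow C n.+1) :
  tcyc (tcyc (face 0 x)) = face n (tcyc x).
Proof.
move: x; on_mp f.
rewrite tcyc_mp !face_mp // !linear_tsum.
have -> : rotf n f n = f 0%N by rewrite /rotf ltnn.
by apply: eq_tsum => a b /=; rewrite !tcyc_mp; fam.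
Qed.

Lemma tcyc_degen n i (x : tpow C n.+2) : (0 < i <= n)%N ->
  tcyc (degen i x) = degen i.-1 (tcyc x).
Proof.
move=> ij; move: x; on_mp f.
rewrite tcyc_mp !degen_mp ?linearZ_LR /= ?tcyc_mp; try lia.
by congr (_ *: _); [rewrite /rotf; ifs | fam].
Qed.

Lemma tcyc_degen0 n (x : tpow C n.+2) :
  tcyc (degen 0 x) = degen n (tcyc (tcyc x)).
Proof.
move: x; on_mp f.
rewrite !tcyc_mp !degen_mp // linearZ_LR /= tcyc_mp.
by congr (_ *: _); [rewrite /rotf; ifs | fam].
Qed.

Lemma degen_last n (x : tpow C n.+1) : degen n (tcyc (face 0 x)) = x.
Proof.
move: x; on_mp f.
rewrite !face_mp // !linear_tsum.
transitivity (\tsum_(a, b <- comul (f 0%N)) (counit a : k) *: mp n.+1 (setf f 0 b)).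
  apply: eq_tsum => a b /=; rewrite tcyc_mp degen_mp //.
  by congr (_ *: _); [rewrite /rotf /ins2; ifs | rewrite /setf; fam].
rewrite (@tsum_counitl _ _ _ (fun a => mp n.+1 (setf f 0 a))).
  by rewrite /setf; fam.
by apply: (@setf_slot _ _ _ _ 0); rewrite /setf // => u l *; ifs.
Qed.

Lemma tcyc_order n (x : tpow C n.+1) : iter n.+1 (@tcyc k C n) x = x.
Proof.
have il m : linear (iter m (@tcyc k C n)).
  by elim: m => [|m IHm]; [exact: lin_id | exact: lin_comp IHm].
move: x; apply: tpow_ext; [exact: (il n.+1) | by lin | move=> f].
have S m : (m <= n.+1)%N -> iter m (@tcyc k C n) (mp n.+1 f) =
    mp n.+1 (fun j => if (j + m <= n)%N then f (j + m)%N else f (j + m - n.+1)%N).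
  elim: m => [_|m IHm ltm]; first by apply: eq_mp => j ltj; rewrite addn0 -ltnS ltj.
  by rewrite iterS IHm ?tcyc_mp; [fam | lia].
by rewrite S //; fam.
Qed.

(** Membership in cotensor products will be expressed by endomorphisms of single
factors; the following rules move them across the operators. *)

Lemma ap_tcyc n i F (x : tpow C n.+1) : (i < n)%N ->
  ap i F (tcyc x) = tcyc (ap i.+1 F x).
Proof.
by move=> ltin; move: x; on_mp f; rewrite tcyc_mp !ap_mp tcyc_mp; fam.
Qed.

Lemma ap_tcyc_last n F (x : tpow C n.+1) : ap n F (tcyc x) = tcyc (ap 0 F x).
Proof. by move: x; on_mp f; rewrite tcyc_mp !ap_mp tcyc_mp; fam. Qed.

Lemma ap_face_lt n i j F (x : tpow C n.+1) : (j < i <= n)%N ->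
  ap j F (face i x) = face i (ap j F x).
Proof.
move=> ij; move: x; on_mp f; rewrite ap_mp !face_mp ?linear_tsum; try lia.
rewrite /apf; have -> : (i == j) = false by lia.
by apply: eq_tsum => a b /=; rewrite ap_mp; fam.
Qed.

Lemma ap_face_gt n i j F (x : tpow C n.+1) : (i <= n)%N -> (i.+1 < j)%N ->
  ap j F (face i x) = face i (ap j.-1 F x).
Proof.
move=> lti ij; move: x; on_mp f; rewrite ap_mp !face_mp ?linear_tsum; try lia.
rewrite /apf; have -> : (i == j.-1) = false by lia.
by apply: eq_tsum => a b /=; rewrite ap_mp; fam.
Qed.

Lemma ap_degen_le n i j F (x : tpow C n.+2) : (j <= i <= n)%N ->
  ap j F (degen i x) = degen i (ap j F x).
Proof.
move=> ij; move: x; on_mp f; rewrite ap_mp !degen_mp ?linearZ_LR /= ?ap_mp; try lia.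
by congr (_ *: _); [rewrite /apf; ifs | fam].
Qed.

Lemma ap_degen_gt n i j F (x : tpow C n.+2) : (i < j)%N -> (i <= n)%N ->
  ap j F (degen i x) = degen i (ap j.+1 F x).
Proof.
move=> ij lti; move: x; on_mp f; rewrite ap_mp !degen_mp ?linearZ_LR /= ?ap_mp; try lia.
by congr (_ *: _); [rewrite /apf; ifs | fam].
Qed.

Lemma degen_ap_eq n i (F G : {linear C -> C}) (x : tpow C n.+2) : (i <= n)%N ->
  (forall c, counit (F c) = counit (G c)) ->
  degen i (ap i.+1 F x) = degen i (ap i.+1 G x).
Proof.
move=> lti FG; move: x; on_mp f; rewrite !ap_mp !degen_mp //.
by congr (_ *: _); [rewrite /apf eqxx FG | fam].
Qed.

End CoalgebraIdentities.

Section Restriction.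
Variables (k : fieldType) (V W : lmodType k) (U : subspace V) (U' : subspace W).
Variables (F : {linear V -> W}) (FU : forall x, U x -> U' (F x)).

Definition restrict_fun (x : subvect U) : subvect U' := insubvect (FU (subvect_mem x)).
Fact restrict_linear : linear restrict_fun.
Proof. by move=> a u v; apply/val_inj; rewrite /= !linearP. Qed.
Definition restrict : {linear subvect U -> subvect U'} := mklin restrict_linear.
Lemma val_restrict x : \val (restrict x) = F (\val x). Proof. by []. Qed.
End Restriction.

(** * The relative cocyclic module *)

Section Relative.
Variables (k : fieldType) (H : hopfType k) (C : modCoalgType H).
Implicit Types (n i j : nat) (phi : {linear base C -> k^o}).

Lemma mpure_upd n (t : {ffun 'I_n -> C}) (i : 'I_n) v :
  mpure (upd t i v) = mp n (setf (ext t) i v).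
Proof.
congr mpure; apply/ffunP => j; rewrite !ffunE /setf.
by rewrite -(inj_eq val_inj) /= ext_ord.
Qed.

Lemma setf_lin n i (f : nat -> C) : (i < n)%N -> linear (fun v => mp n (setf f i v)).
Proof.
move=> ltin; apply: (@setf_slot _ _ _ _ i) => //; rewrite /setf.
  by rewrite eqxx; lin.
by move=> u j *; ifs.
Qed.

Lemma slice_lcoact phi n (i : 'I_n.+1) (x : tpow C n.+1) :
  slice phi (lcoact i x) = ap i (lcontr phi) x.
Proof.
move: x; apply: tpow_ext; [by lin | by lin | move=> f].
rewrite ap_mp /lcoact mlift_mpure; last exact: lco_multilin.
rewrite /lco (linear_sum (slice phi)) ffunE.
pose L := mklin (setf_lin f (ltn_ord i)).
transitivity (L (lcontr phi (f i))); last by apply: eq_mp => j _; rewrite /apf /setf; ifs.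
rewrite /lcontr linear_sum; apply: eq_bigr => q _.
rewrite [RHS]linearZ_LR /= sliceE mpure_upd; congr (_ *: _).
apply: eq_mp => j ltj; rewrite /setf; case: eqP => // _.
by rewrite -[j]/(val (Ordinal ltj)) ext_ord ffunE.
Qed.

Lemma slice_rcoact phi n (i : 'I_n.+1) (x : tpow C n.+1) :
  slice phi (rcoact i x) = ap i (rcontr phi) x.
Proof.
move: x; apply: tpow_ext; [by lin | by lin | move=> f].
rewrite ap_mp /rcoact mlift_mpure; last exact: rco_multilin.
rewrite /rco (linear_sum (slice phi)) ffunE.
pose L := mklin (setf_lin f (ltn_ord i)).
transitivity (L (rcontr phi (f i))); last by apply: eq_mp => j _; rewrite /apf /setf; ifs.
rewrite /rcontr linear_sum; apply: eq_bigr => q _.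
rewrite [RHS]linearZ_LR /= sliceE mpure_upd; congr (_ *: _).
apply: eq_mp => j ltj; rewrite /setf; case: eqP => // _.
by rewrite -[j]/(val (Ordinal ltj)) ext_ord ffunE.
Qed.

(** Functionals on the base turn the comparison of coactions into that of
endomorphisms of neighbouring factors. *)
Lemma cotensor_powP n (x : tpow C n.+1) :
  cotensor_pow C n x <->
  forall phi i, (i < n)%N -> ap i (rcontr phi) x = ap i.+1 (lcontr phi) x.
Proof.
split=> [xP phi i lti|xP i].
  have := congr1 (slice phi) (xP (Ordinal lti)); rewrite slice_rcoact slice_lcoact.
  by rewrite lift0.
apply: slice_sep => phi; rewrite slice_rcoact slice_lcoact lift0.
by have := xP phi i (ltn_ord i).
Qed.

Lemma cyc_cotensorP n (x : tpow C n.+1) :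
  cyc_cotensor C n x <->
  cotensor_pow C n x /\ forall phi, ap 0 (lcontr phi) x = ap n (rcontr phi) x.
Proof.
split=> [xP|[xP xC]].
  split; first exact: (xP true).
  move=> phi; have := congr1 (slice phi) (xP false).
  by rewrite slice_rcoact slice_lcoact.
move=> []; first exact: xP.
apply: slice_sep => phi; rewrite slice_rcoact slice_lcoact; exact: xC.
Qed.

Lemma tcyc_cyc n (x : tpow C n.+1) : cyc_cotensor C n x -> cyc_cotensor C n (tcyc x).
Proof.
move=> /cyc_cotensorP[/cotensor_powP xP xC]; apply/cyc_cotensorP; split.
  apply/cotensor_powP => phi i lti; rewrite ap_tcyc //.
  have [ltin|ltin] := ltnP i.+1 n; first by rewrite ap_tcyc // xP.
  have E : n = i.+1 by lia.
  by subst n; rewrite ap_tcyc_last xC.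
move=> phi; case: n => [|n] in x xP xC *; first by rewrite !ap_tcyc_last xC.
by rewrite ap_tcyc_last ap_tcyc // xP.
Qed.

(** This and the next two lemmas are coassociativity with one of the three factors
contracted. *)
Lemma comul_lcontr phi (c : C) :
  comul (lcontr phi c) = \tsum_(a, b <- comul c) lcontr phi a ⊗ b.
Proof.
transitivity (\tsum_(a, b <- comul c) \tsum_(x, y <- comul b)
    (phi (proj C a) : k) *: (x ⊗ y)).
  rewrite /lcontr linear_sum; apply: eq_bigr => p _.
  by rewrite linearZ_LR -lin_tsum ?tsum_pure //; lin.
rewrite -(tsum_coassoc (f := fun x y z => (phi (proj C x) : k) *: (y ⊗ z))); last by split=> ? ?; lin.
apply: eq_tsum => a b; rewrite -[RHS]/(mklin (pure_linearl b) (lcontr phi a)).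
by rewrite /lcontr linear_sum; apply: eq_bigr => p _; rewrite linearZ_LR.
Qed.

Lemma comul_rcontr phi (c : C) :
  comul (rcontr phi c) = \tsum_(a, b <- comul c) a ⊗ rcontr phi b.
Proof.
transitivity (\tsum_(a, b <- comul c) \tsum_(x, y <- comul a)
    (phi (proj C b) : k) *: (x ⊗ y)).
  rewrite /rcontr linear_sum; apply: eq_bigr => p _.
  by rewrite linearZ_LR -lin_tsum ?tsum_pure //; lin.
rewrite (tsum_coassoc (f := fun x y b => (phi (proj C b) : k) *: (x ⊗ y))); last by split=> ? ?; lin.
apply: eq_tsum => a b; rewrite -[RHS]/(mklin (pure_linearr a) (rcontr phi b)).
by rewrite /rcontr linear_sum; apply: eq_bigr => p _; rewrite linearZ_LR.
Qed.

Lemma rcontr_lcontr phi (c : C) :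
  \tsum_(a, b <- comul c) rcontr phi a ⊗ b = \tsum_(a, b <- comul c) a ⊗ lcontr phi b.
Proof.
transitivity (\tsum_(a, b <- comul c) \tsum_(x, y <- comul a)
    (phi (proj C y) : k) *: (x ⊗ b)).
  apply: eq_tsum => a b; rewrite -[LHS]/(mklin (pure_linearl b) (rcontr phi a)).
  by rewrite /rcontr linear_sum; apply: eq_bigr => p _; rewrite linearZ_LR.
rewrite (tsum_coassoc (f := fun x y b => (phi (proj C y) : k) *: (x ⊗ b))); last by split=> ? ?; lin.
apply: eq_tsum => a b; rewrite -[RHS]/(mklin (pure_linearr a) (lcontr phi b)).
by rewrite /lcontr linear_sum; apply: eq_bigr => p _; rewrite linearZ_LR.
Qed.

(** With the doubling of a factor written as a linear function of its coproduct,
coassociativity can be applied inside of the tensor power. *)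
Definition put2 n i (f : nat -> C) (x : tensor C C) : tpow C n.+1 :=
  \tsum_(a, b <- x) mp n.+1 (ins2 i a b f).

Lemma put2_linear n i f : (i < n)%N -> linear (@put2 n i f).
Proof. by move=> ltin; apply: tsum_lin; [exact: ins2_bilin | lin]. Qed.

Lemma put2E n i f a b : (i < n)%N -> @put2 n i f (a ⊗ b) = mp n.+1 (ins2 i a b f).
Proof. by move=> ltin; apply: tsumE; exact: ins2_bilin. Qed.

Lemma put2_apf n i F f x : @put2 n i (apf i F f) x = put2 n i f x.
Proof. by apply: eq_tsum => a b; apply: eq_mp => j _; rewrite /apf /ins2; ifs. Qed.

Lemma put2_tsum n i f (F G : {linear C -> C}) c : (i < n)%N ->
  @put2 n i f (\tsum_(a, b <- comul c) F a ⊗ G b) =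
  \tsum_(a, b <- comul c) mp n.+1 (ins2 i (F a) (G b) f).
Proof.
move=> ltin; rewrite (lin_tsum _ _ (put2_linear f ltin)).
by apply: eq_tsum => a b; rewrite put2E.
Qed.

Lemma ap_face_l n i phi (x : tpow C n.+1) : (i <= n)%N ->
  ap i (lcontr phi) (face i x) = face i (ap i (lcontr phi) x).
Proof.
move=> lti; move: x; apply: tpow_ext; [by lin | by lin | move=> f].
rewrite ap_mp !face_mp // linear_tsum -[RHS]/(put2 _ _ _ _) put2_apf.
rewrite /apf eqxx comul_lcontr (@put2_tsum _ _ _ _ idfun) //.
by apply: eq_tsum => a b /=; rewrite ap_mp; apply: eq_mp => j _; rewrite /apf /ins2; ifs.
Qed.

Lemma ap_face_r n i phi (x : tpow C n.+1) : (i <= n)%N ->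
  ap i.+1 (rcontr phi) (face i x) = face i (ap i (rcontr phi) x).
Proof.
move=> lti; move: x; apply: tpow_ext; [by lin | by lin | move=> f].
rewrite ap_mp !face_mp // linear_tsum -[RHS]/(put2 _ _ _ _) put2_apf.
rewrite /apf eqxx comul_rcontr (@put2_tsum _ _ _ idfun) //.
by apply: eq_tsum => a b /=; rewrite ap_mp; apply: eq_mp => j _; rewrite /apf /ins2; ifs.
Qed.

Lemma ap_face_mid n i phi (x : tpow C n.+1) : (i <= n)%N ->
  ap i (rcontr phi) (face i x) = ap i.+1 (lcontr phi) (face i x).
Proof.
move=> lti; move: x; apply: tpow_ext; [by lin | by lin | move=> f].
rewrite !face_mp // !linear_tsum.
transitivity (put2 n.+1 i f (\tsum_(a, b <- comul (f i)) rcontr phi a ⊗ b)).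
  rewrite (@put2_tsum _ _ _ _ idfun) //.
  by apply: eq_tsum => a b /=; rewrite ap_mp; apply: eq_mp => j _; rewrite /apf /ins2; ifs.
rewrite rcontr_lcontr (@put2_tsum _ _ _ idfun) //.
by apply: eq_tsum => a b /=; rewrite ap_mp; apply: eq_mp => j _; rewrite /apf /ins2; ifs.
Qed.

Lemma cyc0 n : cyc_cotensor C n 0.
Proof. exact: (smem0 (cyc_cotensor C n)). Qed.

(** Between the two halves of the doubled factor the condition is coassociativity
(ap_face_mid); elsewhere it is inherited. *)
Lemma face_cyc n i (x : tpow C n.+1) :
  cyc_cotensor C n x -> cyc_cotensor C n.+1 (face i x).
Proof.
have [lti|] := leqP i n; last by move=> ni _; rewrite /face leqNgt ni; exact: cyc0.
move=> /cyc_cotensorP[/cotensor_powP xP xC]; apply/cyc_cotensorP; split.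
  apply/cotensor_powP => phi j ltj.
  have [ji|ij] := ltnP j i.
    have [ji'|ij'] := ltnP j.+1 i; first by rewrite !ap_face_lt ?xP //; lia.
    by have E : i = j.+1 by [lia]; subst i; rewrite ap_face_lt ?ap_face_l ?xP //; lia.
  have [E|ji] := eqVneq j i; first by subst j; exact: ap_face_mid.
  have [E|ji'] := eqVneq j i.+1.
    by subst j; rewrite ap_face_r // ap_face_gt // xP.
  rewrite !ap_face_gt; try lia.
  by rewrite xP ?prednK //=; lia.
move=> phi; rewrite (_ : ap 0 _ _ = face i (ap 0 (lcontr phi) x)); last first.
  by case: i lti => [|i] lti; [rewrite ap_face_l | rewrite ap_face_lt].
rewrite xC; have [E|ni] := eqVneq i n; first by subst i; rewrite ap_face_r.
by rewrite ap_face_gt //; lia.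
Qed.

(** Between the neighbours of the removed factor, the condition is obtained by
passing through this factor: the counit does not see on which side it was
contracted. *)
Lemma degen_cyc n i (x : tpow C n.+2) :
  cyc_cotensor C n.+1 x -> cyc_cotensor C n (degen i x).
Proof.
have [lti|] := leqP i n; last by move=> ni _; rewrite /degen leqNgt ni; exact: cyc0.
move=> /cyc_cotensorP[/cotensor_powP xP xC]; apply/cyc_cotensorP; split.
  apply/cotensor_powP => phi j ltj.
  have [ji|ij] := ltnP j i; first by rewrite !ap_degen_le ?xP //; lia.
  have [E|ji] := eqVneq j i; last by rewrite !ap_degen_gt ?xP //; lia.
  subst j; rewrite ap_degen_le ?leqnn // ap_degen_gt // xP; last by lia.
  rewrite -[in RHS]xP; last by lia.
  by apply: degen_ap_eq => // c; rewrite counit_lcontr counit_rcontr.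
move=> phi; rewrite ap_degen_le ?lti // xC.
have [E|ni] := eqVneq i n; last by rewrite ap_degen_gt //; lia.
subst i; rewrite ap_degen_le ?leqnn // [in RHS]xP //.
by apply: degen_ap_eq => // c; rewrite counit_lcontr counit_rcontr.
Qed.

(** As tau delta_0 is the last coface, this makes its identities consequences of
those of face 0 and tcyc. *)
Definition last_face n (x : tpow C n.+1) : tpow C n.+2 := tcyc (face 0 x).
Fact last_face_linear n : linear (@last_face n).
Proof. by rewrite /last_face; lin. Qed.

Lemma last_face_cyc n x : cyc_cotensor C n x -> cyc_cotensor C n.+1 (mklin (@last_face_linear n) x).
Proof. by move=> xC; apply/tcyc_cyc/face_cyc. Qed.

Definition rel_coface n i : {linear rel_space C n -> rel_space C n.+1} :=
  if (i <= n)%N then restrict (@face_cyc n i) else restrict (@last_face_cyc n).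
Definition rel_codeg n i : {linear rel_space C n.+1 -> rel_space C n} :=
  restrict (@degen_cyc n i).
Definition rel_cyc n : {linear rel_space C n -> rel_space C n} := restrict (@tcyc_cyc n).

Lemma val_coface n i x : (i <= n)%N -> \val (rel_coface n i x) = face i (\val x).
Proof. by rewrite /rel_coface => ->. Qed.
Lemma val_coface_last n x : \val (rel_coface n n.+1 x) = tcyc (face 0 (\val x)).
Proof. by rewrite /rel_coface ltnn. Qed.
Lemma val_codeg n i x : \val (rel_codeg n i x) = degen i (\val x).
Proof. by []. Qed.
Lemma val_cyc n x : \val (rel_cyc n x) = tcyc (\val x).
Proof. by []. Qed.

Lemma rel_coface_coface n i j x : (i < j <= n.+2)%N ->
  rel_coface n.+1 j (rel_coface n i x) = rel_coface n.+1 i (rel_coface n j.-1 x).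
Proof.
move=> ij; apply/val_inj; have i1 : (i <= n.+1)%N by lia.
rewrite (@val_coface n.+1 i _ i1).
have [ltj|] := leqP j n.+1.
  have i0 : (i <= n)%N by lia.
  have j0 : (j.-1 <= n)%N by lia.
  rewrite (@val_coface n.+1 j _ ltj) (@val_coface n i _ i0) (@val_coface n j.-1 _ j0).
  by apply: face_face; lia.
move=> ltj; have {ltj} E : j = n.+2 by [lia]; subst j.
rewrite (@val_coface_last n.+1) (@val_coface_last n).
have [lti|ltn] := leqP i n.
  rewrite (@val_coface n i _ lti).
  rewrite -(@face_face _ _ _ 0 i.+1); last by lia.
  by apply: tcyc_face; lia.
have {ltn i1} E : i = n.+1 by [lia]; subst i.
rewrite (@val_coface_last n) -tcyc2_face0; congr tcyc.
rewrite -[in RHS](@face_face _ _ _ 0 1); last by lia.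
by apply/esym/tcyc_face.
Qed.

Lemma rel_codeg_codeg n i j x : (i <= j <= n)%N ->
  rel_codeg n j (rel_codeg n.+1 i x) = rel_codeg n i (rel_codeg n.+1 j.+1 x).
Proof. by move=> ij; apply/val_inj; rewrite !val_codeg; exact: degen_degen. Qed.

Lemma rel_codeg_coface_lt n i j x : (i < j <= n.+1)%N ->
  rel_codeg n.+1 j (rel_coface n.+1 i x) = rel_coface n i (rel_codeg n j.-1 x).
Proof.
move=> ij; apply/val_inj; have i1 : (i <= n.+1)%N by lia.
have i0 : (i <= n)%N by lia.
rewrite val_codeg (@val_coface n.+1 i _ i1) (@val_coface n i _ i0) val_codeg.
exact: degen_face_lt.
Qed.

Lemma rel_codeg_coface_id n i j x : (j <= n)%N -> (i == j) || (i == j.+1) ->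
  rel_codeg n j (rel_coface n i x) = x.
Proof.
move=> ltj ij; apply/val_inj; rewrite val_codeg.
have [lti|ltn] := leqP i n.
  by rewrite (@val_coface n i _ lti); exact: degen_face_id.
have [-> ->] : i = n.+1 /\ j = n by lia.
by rewrite val_coface_last; exact: degen_last.
Qed.

Lemma rel_codeg_coface_gt n i j x : (j.+1 < i <= n.+2)%N ->
  rel_codeg n.+1 j (rel_coface n.+1 i x) = rel_coface n i.-1 (rel_codeg n j x).
Proof.
move=> ij; apply/val_inj; rewrite val_codeg.
have [lti|] := leqP i n.+1.
  have i0 : (i.-1 <= n)%N by lia.
  rewrite (@val_coface n.+1 i _ lti) (@val_coface n i.-1 _ i0) val_codeg.
  by apply: degen_face_gt; lia.
move=> lti; have {lti} E : i = n.+2 by [lia]; subst i.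
rewrite (@val_coface_last n.+1) (@val_coface_last n) val_codeg.
rewrite -(@degen_face_lt _ _ _ 0 j.+1); last by lia.
by symmetry; apply: tcyc_degen; lia.
Qed.

Lemma rel_cyc_coface n i x : (0 < i <= n.+1)%N ->
  rel_cyc n.+1 (rel_coface n i x) = rel_coface n i.-1 (rel_cyc n x).
Proof.
move=> ij; apply/val_inj; rewrite val_cyc.
have i0 : (i.-1 <= n)%N by lia.
rewrite (@val_coface n i.-1 _ i0) val_cyc.
have [lti|lti] := leqP i n.
  by rewrite (@val_coface n i _ lti); apply: tcyc_face; lia.
have {lti i0} E : i = n.+1 by [lia]; subst i.
by rewrite (@val_coface_last n); exact: tcyc2_face0.
Qed.

Lemma rel_cyc_coface0 n x : rel_cyc n.+1 (rel_coface n 0 x) = rel_coface n n.+1 x.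
Proof.
by apply/val_inj; rewrite val_cyc (@val_coface_last n) (@val_coface n 0 _ (leq0n n)).
Qed.

Lemma rel_cyc_codeg n i x : (0 < i <= n)%N ->
  rel_cyc n (rel_codeg n i x) = rel_codeg n i.-1 (rel_cyc n.+1 x).
Proof.
by move=> ij; apply/val_inj; rewrite val_cyc !val_codeg; exact: tcyc_degen.
Qed.

Lemma rel_cyc_codeg0 n x :
  rel_cyc n (rel_codeg n 0 x) = rel_codeg n n (rel_cyc n.+1 (rel_cyc n.+1 x)).
Proof.
by apply/val_inj; rewrite val_cyc !val_codeg !val_cyc; exact: tcyc_degen0.
Qed.

Lemma rel_cyc_order n x : iter n.+1 (rel_cyc n) x = x.
Proof.
have S m : \val (iter m (rel_cyc n) x) = iter m (@tcyc k C n) (\val x).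
  by elim: m => // m IHm; rewrite !iterS val_cyc IHm.
by apply/val_inj; rewrite S; exact: tcyc_order.
Qed.

Definition rel_cocyclic : cocyclic (rel_space C) :=
  Cocyclic rel_coface_coface rel_codeg_codeg rel_codeg_coface_lt
    rel_codeg_coface_id rel_codeg_coface_gt rel_cyc_coface rel_cyc_coface0
    rel_cyc_codeg rel_cyc_codeg0 rel_cyc_order.

End Relative.

Section RelativeFormulas.
Variables (k : fieldType) (H : hopfType k) (C : modCoalgType H).

Lemma ext_inord (V : lmodType k) n (t : {ffun 'I_n.+1 -> V}) j :
  (j < n.+1)%N -> ext t j = t (inord j).
Proof. by move=> ltj; rewrite -[in LHS](inordK ltj) ext_ord. Qed.

Lemma rel_cocyclicP : is_rel_cocyclic (rel_cocyclic C).
Proof.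
split=> [n i x lti|n x|n i x lti|n x].
- rewrite [LHS]val_coface //; apply/esym/mlift_eq => t /=.
  rewrite (mpureE t) face_mp // ext_inord //; apply: eq_bigr => q _.
  congr mpure; apply/ffunP => j; rewrite !ffunE /ins2.
  by have := ltn_ord j => ltj; ifs; rewrite ext_inord //; lia.
- rewrite [LHS]val_coface_last; apply/esym/(mlift_eq (F := mklin (@last_face_linear _ _ C n))) => t.
  rewrite mklinE /last_face (mpureE t) face_mp // linear_tsum ext_inord //.
  rewrite (_ : inord 0 = ord0); last exact/val_inj/inordK.
  apply: eq_bigr => q _ /=; rewrite tcyc_mp.
  congr mpure; apply/ffunP => j; rewrite !ffunE /rotf /ins2.
  by have := ltn_ord j => ltj; ifs; rewrite ext_inord //; lia.
- rewrite [LHS]val_codeg; apply/esym/mlift_eq => t /=.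
  rewrite (mpureE t) (degen_mp _ lti) (@ext_inord _ _ t i.+1 lti); congr (_ *: _).
  congr mpure; apply/ffunP => j; rewrite !ffunE /rmf -ext_ord /= /bump inordK //.
  by have := ltn_ord j => ltj; ifs; congr (ext _ _); lia.
- rewrite [LHS]val_cyc; apply/esym/mlift_eq => t /=.
  rewrite (mpureE t) tcyc_mp; congr mpure; apply/ffunP => j; rewrite !ffunE /rotf.
  rewrite -ext_ord /=; have ltj := ltn_ord j; case: ltnP => jn.
    by rewrite modn_small.
  by have -> : nat_of_ord j = n by [lia]; rewrite modnn.
Qed.

End RelativeFormulas.

(** * The iterated Galois map *)

Section Psi.
Variables (k : fieldType) (H : hopfType k) (C : modCoalgType H).
Implicit Types (n i j : nat) (phi : {linear base C -> k^o}).

(** The identification of the zeroth tensor power with the field. *)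
Definition tpow0 (V : lmodType k) : tpow V 0 -> k^o := nlift (fun _ => 1).
Lemma tpow0_mlin (V : lmodType k) : @mlin k V k^o 0 (fun _ => 1).
Proof. by []. Qed.
Fact tpow0_linear V : linear (@tpow0 V).
Proof. exact/nlift_linear/tpow0_mlin. Qed.
HB.instance Definition _ V :=
  GRing.isLinear.Build k (tpow V 0) k^o _ (@tpow0 V) (@tpow0_linear V).
Lemma tpow0E (V : lmodType k) (f : nat -> V) : tpow0 (mp 0 f) = 1.
Proof. exact/nliftE/tpow0_mlin. Qed.

Definition Psi0 (z : tensor (tpow H 0) C) : tpow C 1 :=
  \tsum_(x, c <- z) (tpow0 x : k) *: mp 1 (fun=> c).

Lemma mp1_linear (V : lmodType k) : linear (fun v : V => mp 1 (fun=> v)).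
Proof. by apply: (@mp_lin _ _ _ _ 0) => // u u' []. Qed.

Lemma Psi0_bilin : bilin (fun (x : tpow H 0) (c : C) => (tpow0 x : k) *: mp 1 (fun=> c)).
Proof. by split=> ?; [lin | apply/lin_scale2/mp1_linear]. Qed.

Fact Psi0_linear : linear Psi0.
Proof. by apply: tsum_lin; [exact: Psi0_bilin | lin]. Qed.

Section Step.
Variables (n : nat) (P : {linear tensor (tpow H n) C -> tpow C n.+1}).
(** The recursion behind psi: c^(1) becomes the first factor, and h_1 acts on
c^(2) before the next step. *)
Definition PsiS (z : tensor (tpow H n.+1) C) : tpow C n.+2 :=
  \tsum_(x, c <- z) \tsum_(h, y <- uncons x) \tsum_(a, b <- comul c)
    tcons a (P (y ⊗ (b ◁ h))).
Lemma PsiS_bilin : bilin (fun (x : tpow H n.+1) c => \tsum_(h, y <- uncons x) \tsum_(a, b <- comul c)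
    tcons a (P (y ⊗ (b ◁ h)))).
Proof. by lin. Qed.
Fact PsiS_linear : linear PsiS.
Proof. by apply: tsum_lin; [exact: PsiS_bilin | lin]. Qed.
Lemma PsiSE h y c : PsiS (tcons h y ⊗ c) =
  \tsum_(a, b <- comul c) tcons a (P (y ⊗ (b ◁ h))).
Proof. by rewrite /PsiS tsumE ?uncons_tcons ?tsumE //; lin. Qed.
End Step.

Fixpoint Psi n : {linear tensor (tpow H n) C -> tpow C n.+1} :=
  if n is m.+1 then mklin (PsiS_linear (Psi m)) else mklin Psi0_linear.

Lemma Psi_nil f c : Psi 0 (mp 0 f ⊗ c) = mp 1 (fun=> c).
Proof.
by rewrite mklinE /Psi0 (tsumE _ _ Psi0_bilin) tpow0E scale1r.
Qed.

Lemma Psi_cons n h (y : tpow H n) c :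
  Psi n.+1 (tcons h y ⊗ c) = \tsum_(a, b <- comul c) tcons a (Psi n (y ⊗ (b ◁ h))).
Proof. exact: (PsiSE (Psi n)). Qed.

Lemma mp1_cons (V : lmodType k) (v : V) : mp 1 (fun=> v) = tcons v (mp 0 (fun=> 0)).
Proof. by rewrite tcons_mp; apply: eq_mp => -[]. Qed.

Lemma mp0 (V : lmodType k) (f g : nat -> V) : mp 0 f = mp 0 g.
Proof. exact: eq_mp. Qed.

(** Equality of linear maps on the source of Psi is checked on the tensors
from which its values are defined. *)
Lemma src_ext0 (V : lmodType k) (F G : tensor (tpow H 0) C -> V) : linear F -> linear G ->
  (forall f c, F (mp 0 f ⊗ c) = G (mp 0 f ⊗ c)) -> forall z, F z = G z.
Proof.
move=> Fl Gl FG; apply: tensor_ext => // x c; move: x; apply: tpow_ext => //.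
- by apply: lin_comp_fun => //; lin.
- by apply: lin_comp_fun => //; lin.
Qed.
Lemma src_extS (V : lmodType k) n (F G : tensor (tpow H n.+1) C -> V) :
  linear F -> linear G ->
  (forall h y c, F (tcons h y ⊗ c) = G (tcons h y ⊗ c)) -> forall z, F z = G z.
Proof.
move=> Fl Gl FG; apply: tensor_ext => // x c; move: x; apply: tpow_cons_ext => //.
- by apply: lin_comp_fun => //; lin.
- by apply: lin_comp_fun => //; lin.
Qed.

Lemma ap_tcons0 n F c (x : tpow C n) : ap 0 F (tcons c x) = tcons (F c) x.
Proof.
move: x; apply: tpow_ext; [by lin | by lin | move=> f].
by rewrite !tcons_mp ap_mp; apply: eq_mp => -[].
Qed.
Lemma ap_tconsS n i F c (x : tpow C n) : ap i.+1 F (tcons c x) = tcons c (ap i F x).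
Proof.
move: x; apply: tpow_ext; [by lin | by lin | move=> f].
by rewrite tcons_mp !ap_mp tcons_mp; apply: eq_mp => -[].
Qed.

Lemma ap_Psi_l phi n z : ap 0 (lcontr phi) (Psi n z) = Psi n (tmap idfun (lcontr phi) z).
Proof.
case: n z => [|n].
  apply: src_ext0; [by lin | by lin | move=> f c].
  by rewrite tmapE !Psi_nil !mp1_cons ap_tcons0.
apply: src_extS; [by lin | by lin | move=> h y c].
rewrite tmapE !Psi_cons linear_tsum /= comul_lcontr.
rewrite (lin_tsum (F := fun x => \tsum_(a, b <- x) tcons a (Psi n (y ⊗ (b ◁ h))))); last by lin.
by apply: eq_tsum => a b; rewrite /= tsumE ?ap_tcons0 //; lin.
Qed.

(** The last factor carries the action of all the h_i, which a right contraction
commutes with. *)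
Lemma ap_Psi_r phi n z : ap n (rcontr phi) (Psi n z) = Psi n (tmap idfun (rcontr phi) z).
Proof.
elim: n z => [|n IHn].
  apply: src_ext0; [by lin | by lin | move=> f c].
  by rewrite tmapE !Psi_nil !mp1_cons ap_tcons0.
apply: src_extS; [by lin | by lin | move=> h y c].
rewrite tmapE !Psi_cons linear_tsum /= comul_rcontr.
rewrite (lin_tsum (F := fun x => \tsum_(a, b <- x) tcons a (Psi n (y ⊗ (b ◁ h))))); last by lin.
apply: eq_tsum => a b; rewrite /= tsumE; last by lin.
by rewrite ap_tconsS IHn tmapE /= rcontr_ract.
Qed.

(** By induction on n: at the first position this is coassociativity for c, in the
form of rcontr_lcontr. *)
Lemma ap_Psi_mid phi n i z : (i < n)%N ->
  ap i (rcontr phi) (Psi n z) = ap i.+1 (lcontr phi) (Psi n z).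
Proof.
elim: n i z => // n IHn i z lti; move: z.
apply: src_extS; [by lin | by lin | move=> h y c].
rewrite !Psi_cons !linear_tsum /=.
case: i lti => [|i] lti; last first.
  by apply: eq_tsum => a b; rewrite !ap_tconsS IHn.
pose F x := \tsum_(a, b <- x) tcons a (Psi n (y ⊗ (b ◁ h))).
have Fl : linear F by rewrite /F; lin.
have FE a b : F (a ⊗ b) = tcons a (Psi n (y ⊗ (b ◁ h))) by rewrite /F tsumE //; lin.
transitivity (F (\tsum_(a, b <- comul c) rcontr phi a ⊗ b)).
  by rewrite (lin_tsum _ _ Fl); apply: eq_tsum => a b; rewrite ap_tcons0 FE.
rewrite rcontr_lcontr (lin_tsum _ _ Fl); apply: eq_tsum => a b.
by rewrite FE ap_tconsS ap_Psi_l tmapE /= lcontr_ract.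
Qed.

Lemma Psi_cotensor n z : cotensor_pow C n (Psi n z).
Proof. by apply/cotensor_powP => phi i; exact: ap_Psi_mid. Qed.

End Psi.

(** * The inverse of the iterated Galois map *)

Section Maps.
Variable k : fieldType.
Implicit Types U V W X Y : lmodType k.

Lemma tmap_comp V V' V'' W W' W'' (f : {linear V -> V'}) (f' : {linear V' -> V''})
    (g : {linear W -> W'}) (g' : {linear W' -> W''}) (f'' : {linear V -> V''})
    (g'' : {linear W -> W''}) x :
  (forall v, f' (f v) = f'' v) -> (forall w, g' (g w) = g'' w) ->
  tmap f' g' (tmap f g x) = tmap f'' g'' x.
Proof.
move=> fE gE; move: x; apply: tensor_ext; [by lin | by lin | move=> v w].
by rewrite !tmapE fE gE.
Qed.

Lemma tmapEr V W W' (g : {linear W -> W'}) (v : V) w : tmap idfun g (v ⊗ w) = v ⊗ g w.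
Proof. exact: tmapE. Qed.

Definition swap12 U V W (x : tensor U (tensor V W)) : tensor V (tensor U W) :=
  \tsum_(u, y <- x) \tsum_(v, w <- y) v ⊗ (u ⊗ w).
Fact swap12_linear U V W : linear (@swap12 U V W).
Proof. by rewrite /swap12; lin. Qed.
HB.instance Definition _ U V W := GRing.isLinear.Build k (tensor U (tensor V W))
  (tensor V (tensor U W)) _ (@swap12 U V W) (@swap12_linear U V W).
Lemma swap12E U V W (u : U) (v : V) (w : W) : swap12 (u ⊗ (v ⊗ w)) = v ⊗ (u ⊗ w).
Proof. by rewrite /swap12 !tsumE //; lin. Qed.

Lemma tensor_ext3 U V W X (F G : tensor U (tensor V W) -> X) : linear F -> linear G ->
  (forall u v w, F (u ⊗ (v ⊗ w)) = G (u ⊗ (v ⊗ w))) -> forall x, F x = G x.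
Proof.
move=> Fl Gl FG; apply: tensor_ext => // u y; move: y; apply: tensor_ext => //.
- by apply: lin_comp_fun => //; lin.
- by apply: lin_comp_fun => //; lin.
Qed.
End Maps.

Section Inverse.
Variables (k : fieldType) (H : hopfType k) (C : modCoalgType H).
Implicit Types (n i j : nat) (phi : {linear base C -> k^o}).

Lemma beta_funE c (h : H) : beta_fun (c ⊗ h) = \tsum_(a, b <- comul c) a ⊗ (b ◁ h) :> tensor C C.
Proof. exact: beta_fun_pure. Qed.

Lemma slice_cot_l (chi : {linear C -> k^o}) phi (x : tensor C C) :
  slice phi (slice chi (cot_l x)) = slice chi (tmap (rcontr phi) idfun x).
Proof.
move: x; apply: tensor_ext; [by lin | by lin | move=> a b].
rewrite cot_l_pure tmapE sliceE (linear_sum (slice chi)) (linear_sum (slice phi)).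
rewrite /rcontr linear_sum scaler_suml; apply: eq_bigr => p _.
by rewrite linearZ_LR /= !sliceE linearZ_LR /= sliceE scalerA mulrC.
Qed.

Lemma slice_cot_r (chi : {linear C -> k^o}) phi (x : tensor C C) :
  slice phi (slice chi (cot_r x)) = slice chi (tmap idfun (lcontr phi) x).
Proof.
move: x; apply: tensor_ext; [by lin | by lin | move=> a b].
rewrite cot_r_pure tmapE sliceE (linear_sum (slice chi)) (linear_sum (slice phi)).
rewrite /lcontr scaler_sumr; apply: eq_bigr => p _.
by rewrite /= sliceE linearZ_LR /= sliceE.
Qed.

(** Functionals on C and on the base together separate triple tensors. *)
Lemma cotensorP (x : tensor C C) : cotensor C x <->
  forall phi, tmap (rcontr phi) idfun x = tmap idfun (lcontr phi) x.
Proof.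
split=> [xP phi|xP].
  apply: slice_sep => chi; rewrite -slice_cot_l -slice_cot_r.
  by congr (slice _ (slice _ _)).
apply: slice_sep => chi; apply: slice_sep => phi.
by rewrite slice_cot_l slice_cot_r xP.
Qed.

(** A left inverse of beta_fun on all of the tensor square, which exists since
the cotensor product is a direct summand of it. *)
Definition galois_inverse (gam : {linear tensor C C -> tensor C H}) :=
  (forall z, gam (beta_fun z) = z) /\
  (forall x, cotensor C x -> beta_fun (gam x) = x).

Lemma galois_inverse_ex : hopf_galois C -> exists gam, galois_inverse gam.
Proof.
move=> [b bK Kb]; have [p pK] := retraction_ex (cotensor C).
have bl : linear b.
  by move=> a u v; apply: (can_inj bK); rewrite Kb (linearP (@beta _ _ C)) /= !Kb.
exists (mklin (lin_comp (mklin bl) (fun a u v => linearP p a u v))).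
split=> [z|x xP]; rewrite !mklinE.
  by have := pK (beta z) => ->; rewrite bK.
have := congr1 \val (Kb (p x)) => /= ->.
by have := pK (insubvect xP) => /= ->.
Qed.

Variable gam : {linear tensor C C -> tensor C H}.
Hypothesis gamP : galois_inverse gam.

Definition Gam0 (x : tpow C 1) : tensor (tpow H 0) C :=
  \tsum_(c, y <- uncons x) (tpow0 y : k) *: (mp 0 (fun=> 0) ⊗ c).
Fact Gam0_linear : linear Gam0.
Proof. by rewrite /Gam0; lin. Qed.

Section Step.
Variables (n : nat) (G : {linear tpow C n.+1 -> tensor (tpow H n) C}).
(** The first factor c and the element b that the recursion returns for the other
factors form an element of the image of beta, from which gam recovers
the argument of Psi and h_1. *)
Definition GamS (x : tpow C n.+2) : tensor (tpow H n.+1) C :=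
  \tsum_(c, y <- uncons x) \tsum_(g, b <- G y) \tsum_(a, h <- gam (c ⊗ b))
    tcons h g ⊗ a.
Fact GamS_linear : linear GamS.
Proof. by rewrite /GamS; lin. Qed.
Lemma GamSE c y : GamS (tcons c y) =
  \tsum_(g, b <- G y) \tsum_(a, h <- gam (c ⊗ b)) tcons h g ⊗ a.
Proof. by rewrite /GamS uncons_tcons tsumE //; lin. Qed.
End Step.

Fixpoint Gam n : {linear tpow C n.+1 -> tensor (tpow H n) C} :=
  if n is m.+1 then mklin (GamS_linear (Gam m)) else mklin Gam0_linear.

Lemma Gam_cons n c (y : tpow C n.+1) : Gam n.+1 (tcons c y) =
  \tsum_(g, b <- Gam n y) \tsum_(a, h <- gam (c ⊗ b)) tcons h g ⊗ a.
Proof. exact: (GamSE (Gam n)). Qed.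

Lemma Gam_nil (c : C) y : Gam 0 (tcons c y) = (tpow0 y : k) *: (mp 0 (fun=> 0) ⊗ c).
Proof. by rewrite mklinE /Gam0 uncons_tcons tsumE //; lin. Qed.

Lemma Gam_single (c : C) : Gam 0 (mp 1 (fun=> c)) = mp 0 (fun=> 0) ⊗ c.
Proof. by rewrite mp1_cons Gam_nil tpow0E scale1r. Qed.

Lemma GamK n z : Gam n (Psi C n z) = z.
Proof.
elim: n z => [|n IHn].
  apply: src_ext0; [by lin | by lin | move=> f c].
  by rewrite Psi_nil Gam_single (mp0 f (fun=> 0)).
apply: src_extS; [by lin | by lin | move=> h y c].
rewrite Psi_cons linear_tsum.
pose K x := \tsum_(a, h <- gam x) tcons h y ⊗ a.
have Kl : linear K by rewrite /K; lin.
transitivity (K (beta_fun (c ⊗ h))).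
  rewrite beta_funE (lin_tsum _ _ Kl); apply: eq_tsum => a b.
  by rewrite Gam_cons IHn tsumE //; lin.
by rewrite /K gamP.1 tsumE //; lin.
Qed.

Lemma uncons_ap0 n F (x : tpow C n.+1) : uncons (ap 0 F x) = tmap F idfun (uncons x).
Proof.
move: x; apply: tpow_cons_ext; [by lin | by lin | move=> c x].
by rewrite ap_tcons0 !uncons_tcons tmapE.
Qed.
Lemma uncons_apS n i F (x : tpow C n.+1) :
  uncons (ap i.+1 F x) = tmap idfun (ap i F) (uncons x).
Proof.
move: x; apply: tpow_cons_ext; [by lin | by lin | move=> c x].
by rewrite ap_tconsS !uncons_tcons tmapE.
Qed.

Definition cons_Psi n (x : tensor (tpow H n) (tensor C C)) : tpow C n.+2 :=
  \tsum_(g, w <- x) \tsum_(c, b <- w) tcons c (Psi C n (g ⊗ b)).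
Fact cons_Psi_linear n : linear (@cons_Psi n).
Proof. by rewrite /cons_Psi; lin. Qed.
Lemma cons_PsiE n g w : @cons_Psi n (g ⊗ w) = \tsum_(c, b <- w) tcons c (Psi C n (g ⊗ b)).
Proof. by rewrite /cons_Psi tsumE //; lin. Qed.

(** In the composite, beta_fun after gam is applied to the pair formed by the first
factor and the element of C that Gam n returns for the other ones. *)
Lemma Psi_GamE n (x : tpow C n.+2) :
  Psi C n.+1 (Gam n.+1 x) =
  cons_Psi (tmap idfun (@beta_fun _ _ C) (tmap idfun gam
    (swap12 (tmap idfun (Gam n) (uncons x))))).
Proof.
have cPl := @cons_Psi_linear n.
move: x; apply: tpow_cons_ext; [by lin | by lin | move=> c x].
rewrite Gam_cons uncons_tcons tmapEr; move: (Gam n x) => {x}.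
apply: tensor_ext; [by lin | by lin | move=> g b].
rewrite tsumE; last by lin.
rewrite swap12E !tmapEr cons_PsiE.
change (Psi C n.+1 (\tsum_(a, h <- gam (c ⊗ b)) tcons h g ⊗ a) =
  \tsum_(u, v <- beta_fun (gam (c ⊗ b))) tcons u (Psi C n (g ⊗ v))).
move: (gam (c ⊗ b)) => {b c}.
apply: tensor_ext; [by lin | by lin | move=> a h].
rewrite tsumE; last by lin.
rewrite Psi_cons beta_funE.
rewrite (lin_tsum (F := fun x => \tsum_(u, v <- x) tcons u (Psi C n (g ⊗ v)))); last by lin.
by apply: eq_tsum => u v; rewrite tsumE //; lin.
Qed.

Lemma cons_Psi_swap n (y : tensor C (tensor (tpow H n) C)) :
  cons_Psi (swap12 y) = \tsum_(c, w <- tmap idfun (Psi C n) y) tcons c w.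
Proof.
have cPl := @cons_Psi_linear n.
move: y; apply: tensor_ext3; [by lin | by lin | move=> c g b].
rewrite swap12E cons_PsiE tsumE; last by lin.
by rewrite tmapE tsumE //; lin.
Qed.

(** The slices of x along its first factor satisfy the conditions on the other
ones, where the induction hypothesis applies. The condition between the first two
factors, pulled back along the injective Psi, says that gam is applied inside of
the cotensor product, where beta_fun inverts it. *)
Lemma PsiK n x : cotensor_pow C n x -> Psi C n (Gam n x) = x.
Proof.
elim: n x => [|n IHn] x.
  move=> _; move: x; apply: tpow_cons_ext; [by lin | by lin | move=> c x].
  rewrite Gam_nil linearZ_LR Psi_nil mp1_cons -(linearZ_LR (mklin (@tcons_linear _ C 0 c))).
  congr (tcons c _); move: x; apply: tpow_ext; [by lin | by lin | move=> f].
  by rewrite tpow0E scale1r; exact: mp0.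
move=> /cotensor_powP xP; set u := uncons x; set y := tmap idfun (Gam n) u.
have uE : tmap idfun (Psi C n) y = u.
  apply: slice_sep => chi; rewrite !slice_map IHn //.
  apply/cotensor_powP => phi i lti.
  rewrite -(slice_map _ (ap i (rcontr phi))) -(slice_map _ (ap i.+1 (lcontr phi))).
  rewrite -!uncons_apS.
  by rewrite xP.
have yE phi : tmap (rcontr phi) idfun y = tmap idfun (tmap idfun (lcontr phi)) y.
  have inj v : tmap idfun (Gam n) (tmap idfun (Psi C n) v) = v.
    by apply: slice_sep => chi; rewrite !slice_map GamK.
  rewrite -[LHS]inj -[RHS]inj; congr (tmap _ _ _).
  transitivity (tmap (rcontr phi) idfun (tmap idfun (Psi C n) y)).
    by rewrite !(tmap_comp (f'' := rcontr phi) (g'' := Psi C n)).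
  rewrite uE -uncons_ap0 xP // uncons_apS -/u -uE.
  by apply: slice_sep => chi; rewrite !slice_map /= ap_Psi_l.
rewrite Psi_GamE -/u -/y.
have -> : tmap idfun (@beta_fun _ _ C) (tmap idfun gam (swap12 y)) = swap12 y.
  apply: slice_sep => chi; rewrite !slice_map; apply: gamP.2.
  apply/cotensorP => phi.
  rewrite -(slice_map _ (tmap (rcontr phi) idfun)) -(slice_map _ (tmap idfun (lcontr phi))).
  congr (slice chi _).
  transitivity (swap12 (tmap (rcontr phi) idfun y)).
    move: (y); apply: tensor_ext3; [by lin | by lin | move=> c g b].
    by rewrite swap12E !tmapE /= ?tmapE /= swap12E.
  rewrite yE; move: (y); apply: tensor_ext3; [by lin | by lin | move=> c g b].
  by rewrite swap12E !tmapE /= ?tmapE /= swap12E.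
by rewrite cons_Psi_swap uE tcons_uncons.
Qed.

End Inverse.

(** * The bijection psi *)

Section PsiMap.
Variables (k : fieldType) (H : hopfType k) (C : modCoalgType H).
Implicit Types (n i j : nat) (phi : {linear base C -> k^o}).

Definition valCD : {linear CD C -> C} := \val.
Definition incl n : {linear tensor (tpow H n) (CD C) -> tensor (tpow H n) C} :=
  tmap idfun valCD.

Lemma incl_pure n (x : tpow H n) (c : CD C) : incl n (x ⊗ c) = x ⊗ \val c.
Proof. exact: tmapEr. Qed.

Lemma psi_in_cyc n (z : hopf_space C n) : cyc_cotensor C n (Psi C n (incl n z)).
Proof.
apply/cyc_cotensorP; split; first exact: Psi_cotensor.
move=> phi; rewrite ap_Psi_l ap_Psi_r; congr (Psi C n _); move: z.
apply: tensor_ext; [by lin | by lin | move=> x c].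
rewrite incl_pure !tmapEr; congr (_ ⊗ _).
exact/esym/(subvect_mem c).
Qed.

Definition psi_fun n (z : hopf_space C n) : rel_space C n := insubvect (psi_in_cyc z).
Fact psi_linear n : linear (@psi_fun n).
Proof. by move=> a u v; apply/val_inj; rewrite [RHS]linearP /= !linearP. Qed.
Definition psi n : {linear hopf_space C n -> rel_space C n} := mklin (@psi_linear n).

Lemma val_psi n z : \val (psi n z) = Psi C n (incl n z).
Proof. by []. Qed.

(** By PsiK, an element of the cyclic cotensor product is Psi z for some z. As Psi
is injective, the cyclic condition says that the left and right contractions of z
agree, so that the slices of z lie in C^D. *)
Lemma psi_bij (gam : {linear tensor C C -> tensor C H}) n : galois_inverse gam -> bijective (psi n).
Proof.
move=> gamP; have [r rK] := retraction_ex (coinv C).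
pose r' : {linear C -> CD C} := r.
exists (fun x => tmap idfun r' (Gam gam n (\val x))) => [z|x].
  rewrite val_psi (GamK gamP); move: z; apply: tensor_ext; [by lin | by lin | move=> x c].
  by rewrite incl_pure tmapEr; congr (_ ⊗ _); exact: rK.
have /cyc_cotensorP[xP xC] := subvect_mem x.
apply/val_inj; rewrite val_psi -[RHS](PsiK gamP xP); congr (Psi C n _).
apply: (@slice_sub _ _ _ (coinv C) r) => // chi phi.
rewrite -(slice_map _ (rcontr phi)) -(slice_map _ (lcontr phi)); congr (slice chi _).
rewrite -[LHS](GamK gamP) -[RHS](GamK gamP); congr (Gam gam n _).
by rewrite -ap_Psi_l -ap_Psi_r (PsiK gamP xP) xC.
Qed.

(** ** Iterated Sweedler sums *)

Lemma sweedlerS (A : coalgType k) (X : lmodType k) n (F : seq A -> X) c :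
  \sum_(s <- sweedler n.+1 c) F s =
  \tsum_(a, b <- comul c) \sum_(s <- sweedler n b) F (a :: s).
Proof. by rewrite /= big_allpairs_dep. Qed.

Fixpoint multilin_seq (X : lmodType k) n (F : seq C -> X) : Prop :=
  if n is m.+1 then (forall s, linear (fun c => F (c :: s))) /\
                    (forall c, multilin_seq m (fun s => F (c :: s)))
  else linear (fun c => F [:: c]).

Lemma sweedler_linear (X : lmodType k) n (F : seq C -> X) : multilin_seq n F ->
  linear (fun c => \sum_(s <- sweedler n c) F s).
Proof.
elim: n F => [|n IHn] F Fm.
  by rewrite (_ : (fun c => _) = fun c => F [:: c]) //; apply/funext => c; rewrite big_seq1.
rewrite (_ : (fun c => _) = fun c => tsum (comul c) (fun a b => \sum_(s <- sweedler n b) F (a :: s))).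
  apply: tsum_lin; last by lin.
  split=> [b|a]; last exact/IHn/Fm.2.
  by apply: sum_linear => s; exact: Fm.1.
by apply/funext => c; rewrite sweedlerS.
Qed.

Fixpoint act_seq (s : seq C) (u : seq H) : seq C :=
  if s is c :: s' then if u is h :: u' then (c ◁ h) :: act_seq s' u' else [::] else [::].

Lemma ract0l (h : H) : (0 : C) ◁ h = 0.
Proof. exact: (bilin0l (@ract_bilin _ _ C)). Qed.
Lemma ract0r (c : C) : c ◁ (0 : H) = 0.
Proof. exact: (bilin0r (@ract_bilin _ _ C)). Qed.

Lemma nth_act_seq s u j : (act_seq s u)`_j = s`_j ◁ u`_j.
Proof.
elim: s u j => [|c s IHs] [|h u] [|j] //=; rewrite ?nth_nil ?ract0l ?ract0r //.
Qed.

Lemma tsum_ract (X : lmodType k) (f : C -> C -> X) c (h : H) : bilin f ->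
  \tsum_(a, b <- comul (c ◁ h)) f a b =
  \tsum_(a, b <- comul c) \tsum_(x, y <- comul h) f (a ◁ x) (b ◁ y).
Proof. exact: sw_ract. Qed.

Lemma sweedler_ract (X : lmodType k) n (F : seq C -> X) c (h : H) : multilin_seq n F ->
  \sum_(s <- sweedler n (c ◁ h)) F s =
  \sum_(s <- sweedler n c) \sum_(u <- sweedler n h) F (act_seq s u).
Proof.
elim: n F c h => [|n IHn] F c h Fm; first by rewrite !big_seq1.
rewrite !sweedlerS tsum_ract; last first.
  split=> [b|a]; last exact/sweedler_linear/Fm.2.
  by apply: sum_linear => s; exact: Fm.1.
apply: eq_tsum => a b; transitivity (\tsum_(x, y <- comul h)
    \sum_(s <- sweedler n b) \sum_(u <- sweedler n y) F (a ◁ x :: act_seq s u)).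
  by apply: eq_tsum => x y; rewrite IHn //; exact: Fm.2.
rewrite tsum_sum; apply: eq_bigr => s _.
by rewrite sweedlerS.
Qed.

Definition consw (s : seq H) (w : nat -> nat -> H) (i j : nat) : H :=
  if i is i'.+1 then w i' j else s`_j.

Definition tailf (V : lmodType k) n (h : {ffun 'I_n.+1 -> V}) : {ffun 'I_n -> V} :=
  [ffun i => h (lift ord0 i)].

Lemma mpure_cons (V : lmodType k) n (h : {ffun 'I_n.+1 -> V}) :
  mpure h = tcons (h ord0) (mpure (tailf h)).
Proof.
rewrite !mpureE mp_cons -[0%N]/(val (@ord0 n)) ext_ord; congr tcons.
apply: eq_mp => j ltj; rewrite -[j in RHS]/(val (Ordinal ltj)) ext_ord ffunE.
by rewrite -ext_ord lift0.
Qed.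

Lemma sweedlersS (X : lmodType k) n m (h : {ffun 'I_n.+1 -> H}) (F : (nat -> nat -> H) -> X) :
  \sum_(w <- sweedlers m h) F w =
  \sum_(s <- sweedler (m 0%N) (h ord0))
    \sum_(w <- sweedlers (fun i => m i.+1) (tailf h)) F (consw s w).
Proof.
rewrite /sweedlers enum_ordSl /= big_map big_allpairs_dep.
apply: eq_bigr => s _; rewrite big_map -map_comp.
rewrite (_ : [seq sweedler (m (nat_of_ord l).+1) (tailf h l) | l <- enum 'I_n] =
  [seq ((fun l : 'I_n.+1 => sweedler (m l) (h l)) \o lift ord0) l | l <- enum 'I_n]).
  apply: eq_bigr => w _; congr F; apply/funext => -[|i]; apply/funext => j //=.
by apply: eq_map => l /=; rewrite ffunE.
Qed.

Lemma sweedlers0 (X : lmodType k) m (h : {ffun 'I_0 -> H}) (F : (nat -> nat -> H) -> X) :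
  \sum_(w <- sweedlers m h) F w = F (fun i j => 0).
Proof.
rewrite /sweedlers (_ : enum 'I_0 = [::]); last by apply/size0nil; rewrite size_enum_ord.
rewrite /= big_seq1; congr F; apply/funext => i; apply/funext => j.
by rewrite nth_nil nth_nil.
Qed.

(** The recursion of Psi is unrolled; sweedler_ract distributes the action of h_1
over the factors of c other than the first. *)
Lemma Psi_sweedler n (h : {ffun 'I_n -> H}) (c : C) :
  Psi C n (mpure h ⊗ c) =
  \sum_(s <- sweedler n c) \sum_(w <- sweedlers (fun i => (n - i).-1%N) h)
    mp n.+1 (fun j => s`_j ◁ \prod_(i < j) w i (j - i).-1%N).
Proof.
elim: n h c => [|n IHn] h c.
  rewrite big_seq1 sweedlers0 (mpureE h) Psi_nil; apply: eq_mp => -[|] // _.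
  by rewrite big_ord0 ract1.
rewrite mpure_cons Psi_cons sweedlerS; apply: eq_tsum => a b.
rewrite IHn sweedler_ract; last first.
  (* Multilinearity is easier to check one entry at a time, through set_nth. *)
  pose m0 q (F : seq C -> tpow C n.+1) :=
    forall s j, (j <= q)%N -> linear (fun c => F (set_nth 0 s j c)).
  have m0S q F : m0 q F -> multilin_seq q F.
    elim: q F => [|q IHq] F Fm /=; first exact: (Fm [::] 0%N).
    split=> [s|c0]; first exact: (Fm (0 :: s) 0%N).
    by apply: IHq => s j ltj; exact: (Fm (c0 :: s) j.+1).
  apply: (m0S) => s j ltj; apply: sum_linear => w.
  apply: (@mp_lin _ _ _ _ j) => // [|u v i _ ij].
    rewrite (_ : (fun u => _) = fun u => u ◁ \prod_(i < j) w i (j - i).-1%N); first by lin.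
    by apply/funext => u; rewrite nth_set_nth /= eqxx.
  by rewrite !nth_set_nth /= (negbTE ij).
rewrite (linear_sum (@tcons _ _ _ a)); apply: eq_bigr => s _.
rewrite (linear_sum (@tcons _ _ _ a)) sweedlersS subn0; apply: eq_bigr => u _.
rewrite (linear_sum (@tcons _ _ _ a)); apply: eq_bigr => w _ /=.
rewrite tcons_mp; apply: eq_mp => -[|j] _ /=; first by rewrite big_ord0 ract1.
by rewrite nth_act_seq ractM big_ord_recl subn0 /=; congr (_ ◁ (_ * _)).
Qed.

Lemma psiP : is_psi psi.
Proof.
move=> n h c; rewrite val_psi incl_pure Psi_sweedler.
by apply: eq_bigr => s _; apply: eq_bigr => w _.
Qed.

End PsiMap.

(** * The coaction on C^D *)

Section Coaction.
Variables (k : fieldType) (H : hopfType k) (C : modCoalgType H).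
Implicit Types (n i j : nat) (phi : {linear base C -> k^o}).
Variable gam : {linear tensor C C -> tensor C H}.
Hypothesis gamP : galois_inverse gam.

Definition flip (V W : lmodType k) (x : tensor V W) : tensor W V :=
  \tsum_(a, b <- x) b ⊗ a.
Fact flip_linear V W : linear (@flip V W).
Proof. by rewrite /flip; lin. Qed.
HB.instance Definition _ V W := GRing.isLinear.Build k (tensor V W) (tensor W V) _
  (@flip V W) (@flip_linear V W).
Lemma flipE (V W : lmodType k) (v : V) (w : W) : flip (v ⊗ w) = w ⊗ v.
Proof. by rewrite /flip tsumE //; lin. Qed.
Lemma flip_map (V W V' W' : lmodType k) (f : {linear V -> V'}) (g : {linear W -> W'}) x :
  flip (tmap f g x) = tmap g f (flip x).
Proof.
move: x; apply: tensor_ext; [by lin | by lin | move=> v w].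
by rewrite tmapE !flipE tmapE.
Qed.
Lemma flip_comul (V : lmodType k) (f : C -> C -> V) (c : C) : bilin f ->
  tsum (flip (comul c)) f = \tsum_(a, b <- comul c) f b a.
Proof.
move=> fb; rewrite /flip (lin_tsum (F := fun x => tsum x f)).
  by apply: eq_tsum => a b; rewrite tsumE.
by apply: tsum_lin => //; lin.
Qed.

Lemma tmap_comul_l phi (c : C) :
  tmap (lcontr phi) idfun (comul c) = comul (lcontr phi c).
Proof. by rewrite comul_lcontr. Qed.
Lemma tmap_comul_r phi (c : C) :
  tmap idfun (rcontr phi) (comul c) = comul (rcontr phi c).
Proof. by rewrite comul_rcontr. Qed.
Lemma tmap_comul_mid phi (c : C) :
  tmap (rcontr phi) idfun (comul c) = tmap idfun (lcontr phi) (comul c).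
Proof. exact: rcontr_lcontr. Qed.

(** The coproduct commutes with contractions from outside, and the action of H with
right contractions; the same holds for the next lemma. *)
Lemma beta_tmap_l phi (z : tensor C H) :
  beta_fun (tmap (lcontr phi) idfun z) = tmap (lcontr phi) idfun (beta_fun z).
Proof.
move: z; apply: tensor_ext; [by lin | by lin | move=> c h].
rewrite tmapE !beta_funE linear_tsum /= comul_lcontr.
rewrite (lin_tsum (F := fun x => \tsum_(a, b <- x) a ⊗ (b ◁ h))); last by lin.
by apply: eq_tsum => a b; rewrite /= tmapE tsumE //; lin.
Qed.
Lemma beta_tmap_r phi (z : tensor C H) :
  beta_fun (tmap (rcontr phi) idfun z) = tmap idfun (rcontr phi) (beta_fun z).
Proof.
move: z; apply: tensor_ext; [by lin | by lin | move=> c h].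
rewrite tmapE !beta_funE linear_tsum /= comul_rcontr.
rewrite (lin_tsum (F := fun x => \tsum_(a, b <- x) a ⊗ (b ◁ h))); last by lin.
by apply: eq_tsum => a b; rewrite /= tmapEr /= rcontr_ract tsumE //; lin.
Qed.

(** ** The map kappa *)

Definition eps_id (z : tensor C H) : H := \tsum_(a, h <- z) (counit a : k) *: h.
Fact eps_id_linear : linear eps_id.
Proof. by rewrite /eps_id; lin. Qed.
HB.instance Definition _ := GRing.isLinear.Build k (tensor C H) H _ eps_id eps_id_linear.

(** This is kappa before the passage to coinvariants (kappaE). *)
Definition eps_gam_fun (y : subvect (cotensor C)) : H := eps_id (gam (\val y)).
Fact eps_gam_linear : linear eps_gam_fun.
Proof. by move=> a u v; rewrite /eps_gam_fun !linearP. Qed.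
Definition eps_gam := mklin eps_gam_linear.

Lemma eps_id_contr phi z :
  eps_id (tmap (rcontr phi) idfun z) = eps_id (tmap (lcontr phi) idfun z).
Proof.
move: z; apply: tensor_ext; [by lin | by lin | move=> c h].
rewrite !tmapE /eps_id !tsumE; try by lin.
by rewrite counit_rcontr counit_lcontr.
Qed.

(** On a generator, the two contractions move from the image of beta to its source,
where the counit turns them both into phi \o proj. *)
Lemma eps_gam0 y : cot_coinv_rel C y -> eps_gam y = 0.
Proof.
apply: (@span_min _ _ _ (kernel eps_gam)) => {y} y [phi [x yE]].
have xE : \val x = beta_fun (gam (\val x)) by rewrite gamP.2 //; exact: subvect_mem.
suff E : \val y = beta_fun (tmap (rcontr phi) idfun (gam (\val x))
                         - tmap (lcontr phi) idfun (gam (\val x))).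
  suff : eps_gam_fun y = 0 by [].
  by rewrite /eps_gam_fun E gamP.1 linearB /= eps_id_contr subrr.
rewrite linearB /= beta_tmap_l beta_tmap_r -xE yE.
by rewrite big_split sumrN.
Qed.

Lemma counit_C_D_linear : linear (@counit_C_D _ _ C : C_D C -> k^o).
Proof.
apply: (qlift_linear (f := @counit k C)) => u.
apply: (@span_min _ _ _ (kernel (@counit k C))) => {u} _ [phi [c' ->]].
suff: counit (rcontr phi c' - lcontr phi c') = 0 by [].
by rewrite linearB /= counit_rcontr counit_lcontr subrr.
Qed.

(** By eps_gam0 the map eps_gam factors through coinvariants, and its composite with
betabar is counit ⊗ id. Hence the latter has the same value at all preimages under
betabar of the class of y, in particular at the chosen one. *)
Lemma kappaE (y : subvect (cotensor C)) :
  kappa (qclass (cot_coinv_rel C) y) = eps_gam y.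
Proof.
pose E := qlift eps_gam (U := cot_coinv_rel C).
have El : linear E by apply: qlift_linear => u; exact: eps_gam0.
have EE u : E (qclass (cot_coinv_rel C) u) = eps_gam u.
  by apply: qlift_class => v; exact: eps_gam0.
have cl := counit_C_D_linear.
have EB z : E (betabar z) = \tsum_(u, h <- z) (counit_C_D u : k) *: h.
  move: z; apply: tensor_ext; [by lin | | move=> u h].
    apply: tsum_lin; last by lin.
    split=> [w a u v|u]; last by lin.
    by have := cl a u v => /= ->; rewrite scalerDl scalerA.
  rewrite -[u]qclassK betabar_pure EE tsumE; last first.
    split=> [w a u' v|u']; last by lin.
    by have := cl a u' v => /= ->; rewrite scalerDl scalerA.
  rewrite counit_C_D_class; suff : eps_gam_fun (beta (repr u ⊗ h)) = counit (repr u) *: h by [].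
  by rewrite /eps_gam_fun gamP.1 /eps_id tsumE //; lin.
rewrite /kappa; set S : set _ := [set z | _]%classic.
have Sx : S (xget 0 S)%classic.
  apply: (xgetPex 0); exists (\tsum_(a, h <- gam (\val y)) qclass (coinv_rel C) a ⊗ h).
  rewrite /S /= linear_tsum; transitivity (qclass (cot_coinv_rel C) (beta (gam (\val y)))).
    rewrite -[in RHS](tsum_pure (gam (\val y))) (linear_tsum (@beta _ _ C)).
    rewrite (linear_tsum (qclass (cot_coinv_rel C))).
    by apply: eq_tsum => a h; rewrite /= betabar_pure.
  by congr (qclass _ _); apply/val_inj/gamP.2; exact: subvect_mem.
by transitivity (E (betabar (xget 0 S))); [exact: esym (EB _) | rewrite Sx EE].
Qed.

(** ** The coaction *)

(** c^(3) ⊗ (c^(1) ⊗ c^(2)) determines its preimage since the inclusion of the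
cotensor product is split. *)
Definition spread (Z : tensor (subvect (cotensor C)) C) : tensor C (tensor C C) :=
  \tsum_(w, x <- Z) \tsum_(p, q <- \val w) p ⊗ (q ⊗ x).
Definition unspread (p : {linear tensor C C -> subvect (cotensor C)})
    (Z : tensor C (tensor C C)) : tensor (subvect (cotensor C)) C :=
  \tsum_(u, y <- Z) \tsum_(v, x <- y) p (u ⊗ v) ⊗ x.

Lemma unspreadK (p : {linear tensor C C -> subvect (cotensor C)}) :
  (forall u, p (\val u) = u) -> forall Z, unspread p (spread Z) = Z.
Proof.
move=> pK; have ul : linear (unspread p) by rewrite /unspread; lin.
have sl : linear spread by rewrite /spread; lin.
apply: tensor_ext; [by lin | by lin | move=> w x].
rewrite /spread tsumE; last by lin.
rewrite (lin_tsum _ _ ul); transitivity (p (\val w) ⊗ x); last by rewrite pK.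
rewrite -[in RHS](tsum_pure (\val w)) (lin_tsum (F := fun v => p v ⊗ x)); last by lin.
by apply: eq_tsum => u v; rewrite /unspread !tsumE //; lin.
Qed.

(** For c in C^D, this is c_<0> ⊗ c_<-1>, the preimage of c^(2) ⊗ c^(1) under beta. *)
Definition coact_pre (c : C) : tensor C H := gam (flip (comul c)).

Lemma beta_coact_pre (c : CD C) : beta_fun (coact_pre (\val c)) = flip (comul (\val c)).
Proof.
apply/gamP.2/cotensorP => phi; rewrite -!flip_map tmap_comul_l tmap_comul_r.
by rewrite (subvect_mem c phi).
Qed.

(** After beta, the two sides are those of rcontr_lcontr for the flipped coproduct. *)
Lemma coact_pre_CD (c : CD C) phi :
  tmap (rcontr phi) idfun (coact_pre (\val c)) =
  tmap (lcontr phi) idfun (coact_pre (\val c)).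
Proof.
rewrite -[LHS]gamP.1 -[RHS]gamP.1 beta_tmap_l beta_tmap_r beta_coact_pre.
by rewrite -!flip_map tmap_comul_mid.
Qed.

(** The coproduct of the first factor is taken on both sides of beta_coact_pre. *)
Lemma cot312E (c : CD C) : cot312 (\val c) =
  \tsum_(a, h <- coact_pre (\val c)) \tsum_(x, y <- comul a) beta (y ⊗ h) ⊗ x.
Proof.
have [p pK] := retraction_ex (cotensor C).
set Z := RHS.
have ZE : spread Z = \sum_(s <- sweedler 2 (\val c)) s`_2 ⊗ (s`_0 ⊗ s`_1).
  have sl : linear spread by rewrite /spread; lin.
  pose G (x : tensor C C) := \tsum_(p, q <- x) \tsum_(u, v <- comul p) v ⊗ (q ⊗ u).
  have Gl : linear G by rewrite /G; lin.
  transitivity (G (flip (comul (\val c)))).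
    rewrite -beta_coact_pre /Z (lin_tsum _ _ sl).
    rewrite -[in RHS](tsum_pure (coact_pre _)).
    rewrite (linear_tsum (@beta_fun _ _ C)) (lin_tsum _ _ Gl).
    apply: eq_tsum => a h; rewrite /= beta_funE (lin_tsum _ _ sl) (lin_tsum _ _ Gl).
    transitivity (\tsum_(x, y <- comul a) \tsum_(u, v <- comul y) u ⊗ ((v ◁ h) ⊗ x)).
      apply: eq_tsum => x y; rewrite /spread tsumE; last by lin.
      rewrite [\val _]beta_funE.
      rewrite (lin_tsum (F := fun t => \tsum_(p, q <- t) p ⊗ (q ⊗ x))); last by lin.
      by apply: eq_tsum => u v; rewrite tsumE //; lin.
    rewrite -(tsum_coassoc (f := fun x u v => u ⊗ ((v ◁ h) ⊗ x))); last by split=> ? ?; lin.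
    by apply: eq_tsum => x y; rewrite /G tsumE //; lin.
  rewrite sweedlerS /G flip_comul; last by lin.
  apply: eq_tsum => a b; rewrite sweedlerS; apply: eq_tsum => u v.
  by rewrite big_seq1.
apply: xget_unique => [|Y YE]; first exact: ZE.
have E : spread Y = spread Z by rewrite ZE; exact: YE.
by rewrite -(unspreadK pK Y) E unspreadK.
Qed.

(** By cot312E, kappa is applied to the classes of beta (c_<0>^(2) ⊗ c_<-1>), which
gives the factors counit (c_<0>^(2)) and leaves c_<-1> ⊗ c_<0>. *)
Lemma coaction_val (c : CD C) :
  tmap idfun (valCD C) (coaction c) = flip (coact_pre (\val c)).
Proof.
have [r rK] := retraction_ex (coinv C); pose r' : {linear C -> CD C} := r.
pose y0 := tmap (@idfun H) r' (flip (coact_pre (\val c))).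
have y0E : tmap idfun (valCD C) y0 = flip (coact_pre (\val c)).
  apply: (@slice_sub _ _ _ (coinv C) r) => // chi phi.
  by rewrite -(slice_map _ (rcontr phi)) -(slice_map _ (lcontr phi)) -!flip_map coact_pre_CD.
have eE : \sum_(w <- terms (cot312 (\val c))) kappa (qclass (cot_coinv_rel C) w.1) ⊗ w.2 =
    flip (coact_pre (\val c)).
  rewrite -/(tsum _ (fun a b => kappa (qclass (cot_coinv_rel C) a) ⊗ b)).
  transitivity (\tsum_(w, x <- cot312 (\val c)) eps_gam w ⊗ x).
    by apply: eq_tsum => w x; rewrite kappaE.
  pose F0 (Y : tensor (subvect (cotensor C)) C) : tensor H C :=
    \tsum_(w, x <- Y) eps_gam w ⊗ x.
  have Fl : linear F0 by rewrite /F0; lin.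
  rewrite -/(F0 _).
  rewrite cot312E (lin_tsum _ _ Fl) /flip; apply: eq_tsum => a h.
  rewrite (lin_tsum _ _ Fl).
  transitivity (\tsum_(x, y <- comul a) (counit y : k) *: (h ⊗ x)).
    apply: eq_tsum => x y; rewrite /F0 tsumE; last by lin.
    have -> : eps_gam (beta (y ⊗ h)) = (counit y : k) *: h.
      suff : eps_gam_fun (beta (y ⊗ h)) = (counit y : k) *: h by [].
      by rewrite /eps_gam_fun gamP.1 /eps_id tsumE //; lin.
    exact: (linZ _ _ (pure_linearl x)).
  by rewrite (@tsum_counitr _ _ _ (fun x => h ⊗ x)) //; lin.
suff -> : coaction c = y0 by [].
apply: xget_unique => [|Y YE]; first by rewrite /= eE; exact: y0E.
have {}YE : tmap idfun (valCD C) Y = flip (coact_pre (\val c)) by rewrite -eE; exact: YE.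
rewrite /y0 -YE; move: {YE} Y; apply: tensor_ext; [by lin | by lin | move=> h b].
by rewrite !tmapEr; congr (_ ⊗ _); apply/esym/rK.
Qed.

End Coaction.

(** * The antipode *)

Section Antipode.
Variables (k : fieldType) (H : hopfType k).
Local Notation S := (@antipode k H).

Lemma antipode1 : S 1 = 1.
Proof.
have := antipodel (1 : H); rewrite /sw comul1 -/(tsum _ (fun a b => S a * b)).
by rewrite tsumE ?counit1 ?scale1r ?mulr1 //; lin.
Qed.

Lemma antipode_l (X : lmodType k) (f : H -> X) h : linear f ->
  \tsum_(a, b <- comul h) f (S a * b) = (counit h : k) *: f 1.
Proof.
move=> fl; rewrite -(linZ _ _ fl) -(antipodel h).
by rewrite -[RHS]/(mklin fl _) linear_sum.
Qed.

Lemma antipode_r (X : lmodType k) (f : H -> X) h : linear f ->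
  \tsum_(a, b <- comul h) f (a * S b) = (counit h : k) *: f 1.
Proof.
move=> fl; rewrite -(linZ _ _ fl) -(antipoder h).
by rewrite -[RHS]/(mklin fl _) linear_sum.
Qed.

Lemma tsum_comulM (X : lmodType k) (f : H -> H -> X) (g h : H) : bilin f ->
  \tsum_(a, b <- comul (g * h)) f a b =
  \tsum_(a, b <- comul g) \tsum_(x, y <- comul h) f (a * x) (b * y).
Proof.
move=> fb; have fl : linear (fun x => tsum x f) by apply: tsum_lin => //; lin.
rewrite comulM -/(tsum _ (fun a b => \sum_(q <- sw h) (a * q.1) ⊗ (b * q.2))).
rewrite (lin_tsum _ _ fl); apply: eq_tsum => a b.
rewrite -/(tsum _ (fun x y => (a * x) ⊗ (b * y))) (lin_tsum _ _ fl).
by apply: eq_tsum => x y; rewrite tsumE.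
Qed.

(** Both sides are values of S(g^(1) h^(1)) g^(2) h^(2) S(h^(3)) S(g^(3)), with the
cancellation done on the right or on the left. *)
Lemma antipodeM g h : S (g * h) = S h * S g.
Proof.
pose f g1 h1 g2 h2 g3 h3 := S (g1 * h1) * (g2 * h2 * (S h3 * S g3)).
transitivity (\tsum_(g1, g' <- comul g) \tsum_(g2, g3 <- comul g')
   \tsum_(h1, h' <- comul h) \tsum_(h2, h3 <- comul h') f g1 h1 g2 h2 g3 h3).
  transitivity (\tsum_(g1, g' <- comul g) (counit g' : k) *: S (g1 * h)).
    by rewrite (@tsum_counitr _ _ _ (fun g1 => S (g1 * h))) //; lin.
  apply: eq_tsum => g1 g'; rewrite exchange_tsum.
  transitivity (\tsum_(h1, h' <- comul h) (counit h' : k) *: ((counit g' : k) *: S (g1 * h1))).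
    by rewrite (@tsum_counitr _ _ _ (fun h1 => (counit g' : k) *: S (g1 * h1))) //; lin.
  apply: eq_tsum => h1 h'.
  transitivity (\tsum_(g2, g3 <- comul g') (counit h' : k) *: (S (g1 * h1) * (g2 * S g3))).
    rewrite -(lin_tsum (F := fun x => (counit h' : k) *: x)); last by lin.
    by rewrite (@antipode_r _ (fun x => S (g1 * h1) * x)) ?mulr1 //; lin.
  apply: eq_tsum => g2 g3; rewrite /f.
  transitivity (\tsum_(h2, h3 <- comul h') S (g1 * h1) * (g2 * (h2 * S h3) * S g3)).
    rewrite (@antipode_r _ (fun x => S (g1 * h1) * (g2 * x * S g3))) ?mulr1 //; lin.
  by apply: eq_tsum => h2 h3; rewrite !mulrA.
rewrite -(tsum_coassoc (f := fun g1 g2 g3 => \tsum_(h1, h' <- comul h)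
    \tsum_(h2, h3 <- comul h') f g1 h1 g2 h2 g3 h3)); last by split=> ? ?; rewrite /f; lin.
transitivity (\tsum_(g', g3 <- comul g) (counit g' : k) *: (S h * S g3)); last first.
  by rewrite (@tsum_counitl _ _ _ (fun g3 => S h * S g3)) //; lin.
apply: eq_tsum => g' g3.
transitivity (\tsum_(h', h3 <- comul h) (counit h' : k) *: ((counit g' : k) *: (S h3 * S g3))); last first.
  by rewrite (@tsum_counitl _ _ _ (fun h3 => (counit g' : k) *: (S h3 * S g3))) //; lin.
transitivity (\tsum_(g1, g2 <- comul g') \tsum_(h', h3 <- comul h)
    \tsum_(h1, h2 <- comul h') f g1 h1 g2 h2 g3 h3).
  apply: eq_tsum => g1 g2.
  by rewrite (tsum_coassoc (f := fun h1 h2 h3 => f g1 h1 g2 h2 g3 h3)) //; split=> ? ?; rewrite /f; lin.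
rewrite exchange_tsum; apply: eq_tsum => h' h3.
transitivity (\tsum_(x, y <- comul (g' * h')) (S x * y) * (S h3 * S g3)).
  rewrite tsum_comulM; last by lin.
  by apply: eq_tsum => g1 g2; apply: eq_tsum => h1 h2; rewrite /f mulrA.
rewrite (@antipode_l _ (fun x => x * (S h3 * S g3))); last by lin.
by rewrite mul1r counitM scalerA mulrC.
Qed.
End Antipode.

(** * Transport of cocyclic structures and cyclic cohomology *)

Section Transport.
Variables (k : fieldType) (X Y : nat -> lmodType k) (B : cocyclic Y).
Variables (f : forall n, {linear X n -> Y n}) (g : forall n, {linear Y n -> X n}).
Hypotheses (fK : forall n, cancel (f n) (g n)) (gK : forall n, cancel (g n) (f n)).

Fact conj_map_linear n m (F : {linear Y n -> Y m}) : linear (fun x => g m (F (f n x))).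
Proof. by move=> a u v; rewrite !linearP. Qed.
Definition conj_map n m (F : {linear Y n -> Y m}) : {linear X n -> X m} :=
  mklin (conj_map_linear F).
Lemma conj_mapK n m (F : {linear Y n -> Y m}) x : f m (conj_map F x) = F (f n x).
Proof. exact: gK. Qed.

Let inj n := can_inj (@fK n).

Definition transport : cocyclic X.
Proof.
refine (@Cocyclic k X
  (fun n i => conj_map (coface B n i)) (fun n i => conj_map (codeg B n i))
  (fun n => conj_map (cyc B n)) _ _ _ _ _ _ _ _ _ _).
- by move=> n i j x ij; apply: inj; rewrite !conj_mapK coface_coface.
- by move=> n i j x ij; apply: inj; rewrite !conj_mapK codeg_codeg.
- by move=> n i j x ij; apply: inj; rewrite !conj_mapK codeg_coface_lt.
- by move=> n i j x ltj ij; apply: inj; rewrite !conj_mapK codeg_coface_id.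
- by move=> n i j x ij; apply: inj; rewrite !conj_mapK codeg_coface_gt.
- by move=> n i x ij; apply: inj; rewrite !conj_mapK cyc_coface.
- by move=> n x; apply: inj; rewrite !conj_mapK cyc_coface0.
- by move=> n i x ij; apply: inj; rewrite !conj_mapK cyc_codeg.
- by move=> n x; apply: inj; rewrite !conj_mapK cyc_codeg0.
- move=> n x; apply: inj; rewrite -[RHS](cyc_order B).
  by elim: n.+1 => // m IHm; rewrite !iterS conj_mapK IHm.
Defined.

Lemma transport_iso : cocyclic_iso transport B f.
Proof.
split=> [n|n i x _|n i x _|n x]; [|exact: conj_mapK|exact: conj_mapK|exact: conj_mapK].
by exists (g n); [exact: fK | exact: gK].
Qed.
End Transport.

Section CohomologyMap.
Variables (k : fieldType) (X Y : nat -> lmodType k) (A : cocyclic X) (B : cocyclic Y).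
Variable f : forall n, {linear X n -> Y n}.
Hypothesis f_coface : forall n i x, (i <= n.+1)%N ->
  f n.+1 (coface A n i x) = coface B n i (f n x).
Hypothesis f_cyc : forall n x, f n (cyc A n x) = cyc B n (f n x).

Lemma map_hochschild n x : f n.+1 (hochschild A x) = hochschild B (f n x).
Proof.
rewrite /hochschild linear_sum; apply: eq_bigr => i _.
by rewrite linearZ_LR f_coface // -ltnS.
Qed.

Lemma map_cochain n x : cyclic_cochain A n x -> cyclic_cochain B n (f n x).
Proof.
move=> xA; suff: signed_cyc B (f n x) = f n x by [].
have E : signed_cyc A x = x by exact: xA.
by rewrite -[in RHS]E /signed_cyc linearZ_LR f_cyc.
Qed.

Lemma map_cocycle n x : cyclic_cocycle A n x -> cyclic_cocycle B n (f n x).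
Proof.
move=> xA []; first exact: map_cochain (xA true).
suff: hochschild B (f n x) = 0 by [].
have E : hochschild A x = 0 by exact: (xA false).
by rewrite -map_hochschild E linear0.
Qed.

Let fc n := restrict (@map_cocycle n).

Lemma map_cobound n u : cyclic_cobound A n u -> cyclic_cobound B n (fc n u).
Proof.
suff: is_cobound A (\val u) -> is_cobound B (f n (\val u)) by [].
case: n u => [|n] u /=; first by move=> ->; rewrite linear0.
move=> [y yA ->]; exists (f n y); first exact: map_cochain.
exact: map_hochschild.
Qed.

Let hc n := lin_comp (qclass (cyclic_cobound B n)) (fun a u v => linearP (fc n) a u v).

Lemma HC_map_ex n : exists F : {linear HC A n -> HC B n},
  forall u v, \val v = f n (\val u) ->
  F (qclass (cyclic_cobound A n) u) = qclass (cyclic_cobound B n) v.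
Proof.
have h0 u : cyclic_cobound A n u -> mklin (@hc n) u = 0.
  by move=> uA; apply/qclass_eq; rewrite subr0; exact: map_cobound.
exists (mklin (qlift_linear h0)) => u v vE.
rewrite mklinE qlift_class // mklinE; congr (qclass _ _); exact/val_inj/esym.
Qed.
End CohomologyMap.

Lemma cocyclic_iso_HC (k : fieldType) (X Y : nat -> lmodType k)
    (A : cocyclic X) (B : cocyclic Y) (f : forall n, {linear X n -> Y n})
    (g : forall n, {linear Y n -> X n}) :
  (forall n, cancel (f n) (g n)) -> (forall n, cancel (g n) (f n)) ->
  cocyclic_iso A B f -> forall n, lin_iso (HC A n) (HC B n).
Proof.
move=> fK gK [_ fd fs ft] n.
have gd m i x : (i <= m.+1)%N -> g m.+1 (coface B m i x) = coface A m i (g m x).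
  by move=> lti; apply: (can_inj (fK m.+1)); rewrite gK fd // gK.
have gt m x : g m (cyc B m x) = cyc A m (g m x).
  by apply: (can_inj (fK m)); rewrite gK ft gK.
have [F FE] := HC_map_ex fd ft n; have [G GE] := HC_map_ex gd gt n.
exists F; exists G => x; rewrite -[x]qclassK; set u := repr x.
  rewrite (FE u (restrict (map_cocycle fd ft (n:=n)) u)) //.
  by apply: GE; rewrite val_restrict fK.
rewrite (GE u (restrict (map_cocycle gd gt (n:=n)) u)) //.
by apply: FE; rewrite val_restrict gK.
Qed.

Lemma linear_inverse_ex (k : fieldType) (V W : lmodType k) (f : {linear V -> W}) :
  bijective f -> exists g : {linear W -> V}, cancel f g /\ cancel g f.
Proof.
move=> [g fK gK]; have gl : linear g.
  by move=> a u v; apply: (can_inj fK); rewrite gK linearP !gK.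
by exists (mklin gl).
Qed.

(** * The operators on the Hopf side *)

Section ConsOperators.
Variables (k : fieldType) (C : coalgType k).

Lemma face0_tcons n (c : C) (x : tpow C n) :
  face 0 (tcons c x) = \tsum_(a, b <- comul c) tcons a (tcons b x).
Proof.
move: x; apply: tpow_ext; [by lin | by lin | move=> f].
rewrite tcons_mp face_mp //; apply: eq_tsum => a b.
by rewrite !tcons_mp; apply: eq_mp => -[|[|j]].
Qed.

Lemma faceS_tcons n i (c : C) (x : tpow C n.+1) : (i <= n)%N ->
  face i.+1 (tcons c x) = tcons c (face i x).
Proof.
move=> lti; move: x; apply: tpow_ext; [by lin | by lin | move=> f].
rewrite tcons_mp !face_mp // linear_tsum; apply: eq_tsum => a b /=.
by rewrite tcons_mp; apply: eq_mp => -[|j] _; rewrite /ins2 //= !ltnS; ifs; destruct j => //; lia.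
Qed.

Lemma degen0_tcons n (c d : C) (x : tpow C n) :
  degen 0 (tcons c (tcons d x)) = (counit d : k) *: tcons c x.
Proof.
move: x; apply: tpow_ext; [by lin | by lin | move=> f].
rewrite !tcons_mp degen_mp //; congr (_ *: _).
by apply: eq_mp => -[|j].
Qed.

Lemma degenS_tcons n i (c : C) (x : tpow C n.+2) : (i <= n)%N ->
  degen i.+1 (tcons c x) = tcons c (degen i x).
Proof.
move=> lti; move: x; apply: tpow_ext; [by lin | by lin | move=> f].
rewrite tcons_mp !degen_mp // [RHS]linearZ_LR /= tcons_mp; congr (_ *: _).
by apply: eq_mp => -[|j] _; rewrite /rmf //= ltnS; ifs.
Qed.

Lemma tcyc_tcons n (c d : C) (x : tpow C n) :
  tcons c (tcyc (tcons d x)) = tcyc (tcons d (tcons c x)).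
Proof.
move: x; apply: tpow_ext; [by lin | by lin | move=> f].
by rewrite !tcons_mp !tcyc_mp tcons_mp; apply: eq_mp => -[|j].
Qed.

Lemma tcyc_single (x : tpow C 1) : tcyc x = x.
Proof.
move: x; apply: tpow_ext; [by lin | by lin | move=> f].
by rewrite tcyc_mp; apply: eq_mp => -[|j].
Qed.
End ConsOperators.

Section Formulas.
Variables (k : fieldType) (H : hopfType k) (C : modCoalgType H).
Local Notation S := (@antipode k H).
Implicit Types (h : nat -> H) (c : C) (n i : nat).

Definition insf i h j : H := if (j < i)%N then h j else if j == i then 1 else h j.-1.
Definition mergef i h j : H :=
  if (j < i)%N then h j else if j == i then h i * h i.+1 else h j.+1.

(** Acting by 1 on c^(2) leaves the coproduct of c, and then the first two factors
are, by coassociativity, the coproduct of the first one. *)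
Lemma Psi_face0 n (y : tpow H n) c :
  Psi C n.+1 (tcons 1 y ⊗ c) = face 0 (Psi C n (y ⊗ c)).
Proof.
rewrite Psi_cons; case: n y => [|n]; last first.
  apply: tpow_cons_ext; [by lin | by lin | move=> h y].
  rewrite Psi_cons linear_tsum.
  transitivity (\tsum_(a, b <- comul c) \tsum_(x, x' <- comul b)
    tcons a (tcons x (Psi C n (y ⊗ (x' ◁ h))))).
    by apply: eq_tsum => a b; rewrite ract1 Psi_cons linear_tsum.
  rewrite -(tsum_coassoc (f := fun a x x' => tcons a (tcons x (Psi C n (y ⊗ (x' ◁ h)))))); last first.
    by split=> ? ?; lin.
  by apply: eq_tsum => a b; rewrite /= face0_tcons.
apply: tpow_ext; [by lin | by lin | move=> h].
rewrite Psi_nil mp1_cons face0_tcons; apply: eq_tsum => a b.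
by rewrite ract1 Psi_nil mp1_cons.
Qed.

Lemma Psi_face n i h c : (i <= n)%N ->
  Psi C n.+1 (mp n.+1 (insf i h) ⊗ c) = face i (Psi C n (mp n h ⊗ c)).
Proof.
elim: i n h c => [|i IHi] n h c lti.
  rewrite -Psi_face0; congr (Psi C n.+1 (_ ⊗ c)); rewrite mp_cons.
  by congr tcons; apply: eq_mp => -[|j].
case: n lti => // n lti; rewrite (mp_cons _ (insf _ _)) (mp_cons _ h) !Psi_cons (lin_tsum _ _ (@face_linear _ C _ _)).
apply: eq_tsum => a b; rewrite faceS_tcons // -IHi //; congr (tcons a (Psi C n.+1 (_ ⊗ _))).
by apply: eq_mp => j _; rewrite /insf ltnS eqSS; ifs; destruct j => //; lia.
Qed.

(** By induction on i. At i = 0 the counit removes the factor between the actions of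
h_1 and h_2, after which both act on the same element. *)
Lemma Psi_degen n i h c : (i < n)%N ->
  Psi C n (mp n (mergef i h) ⊗ c) = degen i (Psi C n.+1 (mp n.+1 h ⊗ c)).
Proof.
elim: i n h c => [|i IHi] [|n] h c lti //.
  rewrite (mp_cons _ (mergef _ _)) (mp_cons _ h) (mp_cons _ (fun j => h j.+1)) !Psi_cons (lin_tsum _ _ (@degen_linear _ C _ _)).
  set y := mp n _.
  apply: eq_tsum => a b; rewrite Psi_cons (linear_tsum (@tcons _ C _ a)) (lin_tsum _ _ (@degen_linear _ C _ _)).
  transitivity (\tsum_(u, v <- comul (b ◁ h 0%N)) (counit u : k) *:
      tcons a (Psi C n (y ⊗ (v ◁ h 1%N)))).
    rewrite (@tsum_counitl _ _ _ (fun v => tcons a (Psi C n (y ⊗ (v ◁ h 1%N))))).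
      by rewrite /mergef /= ractM.
    by lin.
  by apply: eq_tsum => u v /=; rewrite degen0_tcons.
rewrite (mp_cons _ (mergef _ _)) (mp_cons _ h) !Psi_cons (lin_tsum _ _ (@degen_linear _ C _ _)).
apply: eq_tsum => a b; rewrite degenS_tcons; last by lia.
exact: (congr1 (@tcons _ C _ a) (IHi n (fun j => h j.+1) (b ◁ h 0%N) lti)).
Qed.

Lemma Psi_degen_last n h c :
  degen n (Psi C n.+1 (mp n.+1 h ⊗ c)) = (counit (h n) : k) *: Psi C n (mp n h ⊗ c).
Proof.
elim: n h c => [|n IHn] h c; rewrite (mp_cons _ h) Psi_cons (lin_tsum _ _ (@degen_linear _ C _ _)).
  rewrite Psi_nil mp1_cons.
  transitivity (\tsum_(a, b <- comul c) (counit b : k) *: ((counit (h 0%N) : k) *: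
      tcons a (mp 0 (fun=> 0 : C)))).
    apply: eq_tsum => a b; rewrite Psi_nil mp1_cons degen0_tcons counit_ract scalerA.
    by [].
  rewrite (@tsum_counitr _ _ _ (fun a => (counit (h 0%N) : k) *: tcons a (mp 0 (fun=> 0 : C)))) //.
  by lin.
rewrite (mp_cons _ h) Psi_cons (lin_tsum (F := fun x => (counit (h n.+1) : k) *: x)); last by lin.
apply: eq_tsum => a b; rewrite degenS_tcons // IHn.
exact: (linZ _ _ (@tcons_linear _ C n.+1 a)).
Qed.

Lemma sweedler1 (X : lmodType k) (g : H) (F : seq H -> X) :
  \sum_(s <- sweedler 1 g) F s = \tsum_(a, b <- comul g) F [:: a; b].
Proof. by rewrite sweedlerS; apply: eq_tsum => a b; rewrite big_seq1. Qed.

(** As g^(1) acts on both factors of the coproduct of b, the second half of it meets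
the antipode of g^(2). *)
Lemma act_antipode (X : lmodType k) (f : C -> C -> X) b (g x : H) : bilin f ->
  \tsum_(x1, x2 <- comul g) \tsum_(a1, a2 <- comul (b ◁ x1)) f a1 (a2 ◁ (S x2 * x)) =
  \tsum_(b1, b2 <- comul b) f (b1 ◁ g) (b2 ◁ x).
Proof.
move=> fb; have f1 w : linear (f^~ w) by exact: fb.1.
have f2 w : linear (f w) by exact: fb.2.
transitivity (\tsum_(x1, x2 <- comul g) \tsum_(b1, b2 <- comul b)
    \tsum_(y1, y2 <- comul x1) f (b1 ◁ y1) (b2 ◁ (y2 * (S x2 * x)))).
  apply: eq_tsum => x1 x2; rewrite tsum_ract.
    by apply: eq_tsum => b1 b2; apply: eq_tsum => y1 y2; rewrite ractM.
  split=> w; first exact: f1.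
  by apply: (lin_comp_fun (f := f w)) => //; lin.
rewrite exchange_tsum; apply: eq_tsum => b1 b2.
have l1 w : linear (fun y => f (b1 ◁ y) w).
  by apply: (lin_comp_fun (f := f^~ w)) => //; lin.
have l2 w (G : H -> H) : linear G -> linear (fun y => f w (b2 ◁ G y)).
  by move=> Gl; apply: (lin_comp_fun (f := f w)) => //; lin.
rewrite (tsum_coassoc (f := fun y1 y2 x2 => f (b1 ◁ y1) (b2 ◁ (y2 * (S x2 * x))))); last first.
  split=> u v; first exact: l1.
  - by apply: l2; lin.
  - by apply: l2; lin.
transitivity (\tsum_(y1, z <- comul g) (counit z : k) *: f (b1 ◁ y1) (b2 ◁ x)).
  apply: eq_tsum => y1 z.
  transitivity (\tsum_(y2, x2 <- comul z) f (b1 ◁ y1) (b2 ◁ ((y2 * S x2) * x))).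
    by apply: eq_tsum => y2 x2; rewrite mulrA.
  rewrite (@antipode_r _ _ _ (fun t => f (b1 ◁ y1) (b2 ◁ (t * x)))) ?mul1r //.
  by apply: l2; lin.
exact: (@tsum_counitr _ _ _ (fun y1 => f (b1 ◁ y1) (b2 ◁ x))).
Qed.

Lemma act_bilin (X : lmodType k) (f : C -> C -> X) (g : H) : bilin f ->
  bilin (fun a b => f (a ◁ g) b).
Proof.
move=> [f1 f2]; split=> w; last exact: f2.
by apply: (lin_comp_fun (f := f^~ w)) => //; lin.
Qed.

(** The entries that tau and the last coface produce, with x for the contribution of
the coaction. *)
Definition antif n (x : H) (w : nat -> nat -> H) j : H :=
  if (j < n)%N then w j 0%N else S (\prod_(i < n) w i 1%N) * x.

Lemma antif_consw n x x1 x2 (w : nat -> nat -> H) :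
  mp n.+2 (antif n.+1 x (consw [:: x1; x2] w)) =
  tcons x1 (mp n.+1 (antif n (S x2 * x) w)).
Proof.
rewrite tcons_mp; apply: eq_mp => -[|j] _ //=.
rewrite /antif ltnS; case: ltnP => // _.
by rewrite big_ord_recl antipodeM mulrA.
Qed.

(** By induction on n. Once the first factor is split off, the induction hypothesis
removes the antipodes of the other h_i, which by antipodeM stand to the left of
that of h_1^(2), and act_antipode removes the latter. *)
Lemma Psi_antipode n (h : {ffun 'I_n -> H}) (x : H) c :
  \sum_(w <- sweedlers (fun=> 1%N) h) Psi C n.+1 (mp n.+1 (antif n x w) ⊗ c) =
  \tsum_(a, b <- comul c) tcyc (tcons (b ◁ x) (Psi C n (mpure h ⊗ a))).
Proof.
elim: n h x c => [|n IHn] h x c.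
  rewrite sweedlers0 mp_cons Psi_cons; apply: eq_tsum => a b.
  rewrite Psi_nil (mpureE h) Psi_nil !mp1_cons -tcyc_tcons tcyc_single.
  by rewrite /antif /= big_ord0 antipode1 mul1r.
rewrite sweedlersS sweedler1.
pose T (u v : C) := tcyc (tcons v (Psi C n (mpure (tailf h) ⊗ u))).
have Tb : bilin T by rewrite /T; lin.
transitivity (\tsum_(x1, x2 <- comul (h ord0)) \tsum_(a, b <- comul c)
    tcons a (\tsum_(b1, b2 <- comul (b ◁ x1)) T b1 (b2 ◁ (S x2 * x)))).
  apply: eq_tsum => x1 x2; transitivity (\sum_(w <- sweedlers (fun=> 1%N) (tailf h))
      \tsum_(a, b <- comul c) tcons a (Psi C n.+1 (mp n.+1 (antif n (S x2 * x) w) ⊗ (b ◁ x1)))).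
    by apply: eq_bigr => w _; rewrite antif_consw Psi_cons.
  rewrite -tsum_sum; apply: eq_tsum => a b.
  by rewrite -(linear_sum (@tcons _ C _ a)) IHn.
rewrite exchange_tsum mpure_cons.
transitivity (\tsum_(a, b <- comul c) \tsum_(b1, b2 <- comul b)
    tcons a (T (b1 ◁ h ord0) (b2 ◁ x))).
  apply: eq_tsum => a b; rewrite -(linear_tsum (@tcons _ C _ a)).
  by rewrite act_antipode // linear_tsum.
transitivity (\tsum_(a, b <- comul c) \tsum_(a1, a2 <- comul a)
    tcons a1 (T (a2 ◁ h ord0) (b ◁ x))); last first.
  apply: eq_tsum => a b; rewrite Psi_cons (linear_tsum (@tcons _ C _ _)) linear_tsum.
  by apply: eq_tsum => a1 a2 /=; rewrite -tcyc_tcons.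
rewrite (tsum_coassoc (f := fun a1 a2 b => tcons a1 (T (a2 ◁ h ord0) (b ◁ x)))) //.
by split=> u v; rewrite /T; lin.
Qed.

Variable gam : {linear tensor C C -> tensor C H}.
Hypothesis gamP : galois_inverse gam.

(** The form in which the coaction is used: beta (c_<0> ⊗ c_<-1>) is c^(2) ⊗ c^(1). *)
Lemma coaction_tsum (X : lmodType k) (T : C -> C -> X) (c : CD C) : bilin T ->
  \sum_(p <- terms (coaction c)) \tsum_(a, b <- comul (\val p.2)) T a (b ◁ p.1) =
  \tsum_(a, b <- comul (\val c)) T b a.
Proof.
move=> Tb; have T2 w : linear (T w) by exact: Tb.2.
have Tr w (g : H) : linear (fun b => T w (b ◁ g)).
  by apply: (lin_comp_fun (f := T w)) => //; lin.
pose U (g : H) (a : C) := \tsum_(u, v <- comul a) T u (v ◁ g).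
have Ub : bilin U.
  split=> [a|g]; rewrite /U.
    apply: tsum_lin_body => u v; apply: (lin_comp_fun (f := T u)) => //; lin.
  by apply: tsum_lin; [split=> w; [exact: Tb.1 | exact: Tr] | lin].
have Ul : linear (fun x => tsum x U) by apply: tsum_lin => //; lin.
have Tl : linear (fun x => tsum x T) by apply: tsum_lin => //; lin.
transitivity (tsum (tmap idfun (valCD C) (coaction c)) U).
  rewrite /tmap (lin_tsum _ _ Ul); apply: eq_bigr => p _.
  by rewrite tsumE.
rewrite (coaction_val gamP) /flip (lin_tsum _ _ Ul).
transitivity (tsum (beta_fun (coact_pre gam (\val c))) T).
  rewrite -[in RHS](tsum_pure (coact_pre _ _)) (linear_tsum (@beta_fun _ _ C)) (lin_tsum _ _ Tl).
  apply: eq_tsum => a g; rewrite tsumE //= beta_funE (lin_tsum _ _ Tl).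
  by apply: eq_tsum => u v; rewrite tsumE.
by rewrite (beta_coact_pre gamP) flip_comul.
Qed.

Lemma Psi_last_face n (h : {ffun 'I_n -> H}) (c : CD C) :
  \sum_(w <- sweedlers (fun=> 1%N) h) \sum_(p <- terms (coaction c))
    Psi C n.+1 (mp n.+1 (antif n p.1 w) ⊗ \val p.2) =
  tcyc (face 0 (Psi C n (mpure h ⊗ \val c))).
Proof.
rewrite exchange_big; pose T (u v : C) := tcyc (tcons v (Psi C n (mpure h ⊗ u))).
have Tb : bilin T by rewrite /T; lin.
transitivity (\sum_(p <- terms (coaction c)) \tsum_(a, b <- comul (\val p.2)) T a (b ◁ p.1)).
  by apply: eq_bigr => p _; rewrite Psi_antipode.
rewrite coaction_tsum // -Psi_face0 Psi_cons linear_tsum.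
by apply: eq_tsum => a b; rewrite ract1.
Qed.

(** By Psi_antipode the last factor of the left-hand side is c_<0>^(2) ◁ c_<-1>, and
h_1 acts on c_<0>^(1) before the other h_i. By coaction_tsum these are c^(1) and
the action of h_1 on c^(2), and c^(1) is the first factor on the right, rotated to
the end. *)
Lemma Psi_cyc n (h : {ffun 'I_n.+1 -> H}) (c : CD C) :
  \sum_(w <- sweedlers (fun=> 1%N) h) \sum_(p <- terms (coaction c))
    Psi C n.+1 (mp n.+1 (fun j => antif n.+1 p.1 w j.+1) ⊗ (\val p.2 ◁ w 0%N 0%N)) =
  tcyc (Psi C n.+1 (mpure h ⊗ \val c)).
Proof.
rewrite sweedlersS sweedler1.
pose T (u v : C) := tcyc (tcons v (Psi C n (mpure (tailf h) ⊗ u))).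
have Tb : bilin T by rewrite /T; lin.
transitivity (\tsum_(x1, x2 <- comul (h ord0)) \sum_(p <- terms (coaction c))
    \tsum_(b1, b2 <- comul (\val p.2 ◁ x1)) T b1 (b2 ◁ (S x2 * p.1))).
  apply: eq_tsum => x1 x2; rewrite exchange_big; apply: eq_bigr => p _.
  rewrite -[RHS]Psi_antipode; apply: eq_bigr => w _ /=; congr (Psi C n.+1 (_ ⊗ _)).
  apply: eq_mp => j _; rewrite /antif ltnS /=; case: ltnP => // _.
  by rewrite big_ord_recl antipodeM mulrA.
rewrite tsum_sum.
transitivity (\sum_(p <- terms (coaction c)) \tsum_(b1, b2 <- comul (\val p.2))
    T (b1 ◁ h ord0) (b2 ◁ p.1)).
  by apply: eq_bigr => p _; rewrite act_antipode.
rewrite (coaction_tsum _ (act_bilin (h ord0) Tb)) mpure_cons Psi_cons linear_tsum.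
by [].
Qed.

End Formulas.

Section HopfSide.
Variables (k : fieldType) (H : hopfType k) (C : modCoalgType H).
Variable gam : {linear tensor C C -> tensor C H}.
Hypothesis gamP : galois_inverse gam.
Variable g : forall n, {linear rel_space C n -> hopf_space C n}.
Hypotheses (psiK : forall n, cancel (psi C n) (g n)) (gK : forall n, cancel (g n) (psi C n)).

Let A := transport (rel_cocyclic C) psiK gK.

Lemma psi_val_eq n (x y : hopf_space C n) :
  Psi C n (incl C n x) = Psi C n (incl C n y) -> x = y.
Proof. by move=> E; apply: (can_inj (@psiK n)); apply/val_inj. Qed.

Lemma val_transport n m (F : {linear rel_space C n -> rel_space C m}) x :
  Psi C m (incl C m (conj_map (psi C) g F x)) = \val (F (psi C n x)).
Proof. by rewrite -val_psi (conj_mapK gK). Qed.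

(** As psi is injective, each formula may be checked after applying Psi. *)
Lemma hopf_cocyclicP : is_hopf_cocyclic A.
Proof.
split; [split=> [n i h c lti|n h c] | split=> [n i h c lti|n h c] | split=> [x|n h c]];
  apply: psi_val_eq; rewrite [LHS]val_transport.
- rewrite (val_coface _ lti) val_psi !incl_pure (mpureE h) -Psi_face //.
  congr (Psi C n.+1 (_ ⊗ _)); rewrite mpureE; apply: eq_mp => j ltj.
  rewrite -[j in RHS]/(val (Ordinal ltj)) ext_ord ffunE /insf.
  case: unliftP => [j' /(congr1 val)|/(congr1 val)] /=; rewrite inordK // => ->;
    last by rewrite ltnn eqxx.
  by rewrite -ext_ord; have ltj' := ltn_ord j'; rewrite /bump; ifs; congr (ext _ _); lia.
- rewrite (val_coface_last (psi C n _)) val_psi incl_pure -(Psi_last_face gamP).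
  rewrite (linear_sum (incl C n.+1)) (linear_sum (Psi C n.+1)); apply: eq_bigr => w _.
  rewrite (linear_sum (incl C n.+1)) (linear_sum (Psi C n.+1)); apply: eq_bigr => p _.
  by rewrite incl_pure.
- rewrite val_codeg val_psi !incl_pure (mpureE h) -Psi_degen //.
  congr (Psi C n (_ ⊗ _)); rewrite mpureE; apply: eq_mp => j ltj.
  rewrite -[j in RHS]/(val (Ordinal ltj)) ext_ord ffunE /mergef /=.
  by rewrite !ext_inord; try lia; ifs.
- rewrite val_codeg val_psi incl_pure (mpureE h) Psi_degen_last.
  rewrite linearZ_LR [RHS]linearZ_LR incl_pure; congr ((counit _ : k) *: Psi C n (_ ⊗ _)).
    by rewrite -[n]/(val (@ord_max n)) ext_ord.
  rewrite mpureE; apply: eq_mp => j ltj.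
  by rewrite -[j in RHS]/(val (Ordinal ltj)) ext_ord ffunE -ext_ord.
- by rewrite val_cyc tcyc_single.
- rewrite val_cyc val_psi incl_pure -(Psi_cyc gamP).
  rewrite (linear_sum (incl C n.+1)) (linear_sum (Psi C n.+1)); apply: eq_bigr => w _.
  rewrite (linear_sum (incl C n.+1)) (linear_sum (Psi C n.+1)); apply: eq_bigr => p _.
  by rewrite incl_pure.
Qed.
End HopfSide.

Theorem theorem3p12 (R : realType) (H : hopfType R[i]) (C : modCoalgType H)
    (galC : hopf_galois C) :
  exists (A : cocyclic (hopf_space C)) (B : cocyclic (rel_space C))
    (psi : forall n, {linear hopf_space C n -> rel_space C n}),
    [/\ is_hopf_cocyclic A, is_rel_cocyclic B, is_psi psi,
        cocyclic_iso A B psi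
      & forall n, lin_iso (HC A n) (HC B n)].
Proof.
have [gam gamP] := galois_inverse_ex galC.
have gex n := linear_inverse_ex (psi_bij n gamP).
pose g n := projT1 (cid (gex n)).
have psiK n : cancel (psi C n) (g n) by rewrite /g; case: cid => ? [].
have gK n : cancel (g n) (psi C n) by rewrite /g; case: cid => ? [].
have iso := transport_iso (rel_cocyclic C) psiK gK.
exists (transport (rel_cocyclic C) psiK gK), (rel_cocyclic C), (psi C); split=> //.
- exact: (hopf_cocyclicP gamP).
- exact: rel_cocyclicP.
- exact: psiP.
- exact: (cocyclic_iso_HC psiK gK iso).
Qed.
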